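(* For every graph family $\mathcal{F}$ admitting strongly sublinear separators, $$\lim_{n\to\infty}\max_{G\in\mathcal{F},\ \mathsf{v}(G)=n}\frac{c(G)}{n}=\rho(\mathcal{F});$$ in particular, the limit exists.
   Context: All graphs are finite and simple. $\mathsf{d}(G)=\mathsf{e}(G)/\mathsf{v}(G)$; for $\mathsf{v}(H)\ge2$, $c(H)$ is the supremum of $\mathsf{d}(G)$ over non-null graphs $G$ with no $H$ minor. A jumbled model of $H$ in $G$ is a map $\mu$ from $V(H)$ to subsets of $V(G)$ such that each $G[\mu(v)]$ is connected (and nonempty) and for every edge $uv\in E(H)$ some edge of $G$ joins $\mu(u)$ and $\mu(v)$ (overlaps allowed); $\mu^{\#}(x)=|\{v:x\in\mu(v)\}|$. $\mathrm{Vol}_H(G)$ is the supremum of $\sum_i\alpha_i$ over finitely many reals $\alpha_i\ge0$ and jumbled models $\mu_i$ of $H$ in $G$ with $\sum_i\alpha_i\mu_i^{\#}(x)\le1$ for all $x$; $c_f(H)=\sup_G\mathsf{d}(G)/\mathrm{Vol}_H(G)$ over non-null $G$. The nucleus $\mathrm{nuc}(\mathcal{F})$ is the set of graphs $H$ such that $kH\in\mathcal{F}$ for every $k\in\mathbb{N}$ ($kH$ is the disjoint union of $k$ copies of $H$), and $\rho(\mathcal{F})=\sup_{H\in\mathrm{nuc}(\mathcal{F})}c_f(H)/\mathsf{v}(H)$ (over non-null $H$). A separation of $G$ is a pair $(A_1,A_2)$ of subsets of $V(G)$ with $G=G[A_1]\cup G[A_2]$, $A_1\setminus A_2\ne\emptyset\ne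 A_2\setminus A_1$, of order $|A_1\cap A_2|$, balanced if $|A_1|,|A_2|\ge\mathsf{v}(G)/3$. $\mathcal{F}$ admits strongly sublinear separators if it is closed under subgraphs and there are $\beta<1$, $c>0$ such that every $G\in\mathcal{F}$ has a balanced separation of order at most $c\,\mathsf{v}(G)^\beta$. *)

(* Defs.v *)
From HB Require Import structures.
From mathcomp Require Import all_boot all_order all_algebra.
From mathcomp Require Import all_classical all_reals all_analysis.

Set Implicit Arguments.
Unset Strict Implicit.
Unset Printing Implicit Defensive.

Import Order.TTheory GRing.Theory Num.Theory.

Local Open Scope ring_scope.

Record sgraph (T : finType) := SGraph {
  edges : {set {set T}};
  edges_card2 : [forall e in edges, #|e| == 2%N]
}.

HB.instance Definition _ (T : finType) := [isSub for @edges T].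
HB.instance Definition _ (T : finType) := [Finite of sgraph T by <:].

Section Graphs.
Variables (T : finType) (G : sgraph T).
Implicit Types (A B : {set T}) (x y : T).

Definition adj x y : bool := [set x; y] \in edges G.

Definition connected_in A : bool :=
  (A != finset.set0) &&
  [forall x in A, forall y in A,
     connect [rel u v | [&& u \in A, v \in A & adj u v]] x y].

Definition edges_in A : {set {set T}} := [set e in edges G | e \subset A].

Definition separation A B : bool :=
  [&& A :|: B == [set: T], edges_in A :|: edges_in B == edges G,
      A :\: B != finset.set0 & B :\: A != finset.set0].

Definition balanced A B : bool :=
  (#|T| <= 3 * #|A|)%N && (#|T| <= 3 * #|B|)%N.

End Graphs.

(* H is isomorphic to a subgraph of G *)
Definition subgraph (T U : finType) (H : sgraph U) (G : sgraph T) : Prop :=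
  exists2 f : U -> T, injective f &
    forall e, e \in edges H -> f @: e \in edges G.

Definition jumbled_model (T U : finType) (G : sgraph T) (H : sgraph U)
    (mu : U -> {set T}) : Prop :=
  (forall v, connected_in G (mu v)) /\
  (forall u v, adj H u v ->
     exists x y, [/\ x \in mu u, y \in mu v & adj G x y]).

Definition multiplicity (T U : finType) (mu : U -> {set T}) (x : T) : nat :=
  #|[set v | x \in mu v]|.

Definition has_minor (T U : finType) (G : sgraph T) (H : sgraph U) : Prop :=
  exists2 mu : U -> {set T}, jumbled_model G H mu &
    forall u v, u != v -> [disjoint mu u & mu v].

Definition copies_edges (k : nat) (U : finType) (H : sgraph U) :
    {set {set 'I_k * U}} :=
  [set pair i @: (e : {set U}) | i in 'I_k, e in edges H].

Lemma copies_card2 (k : nat) (U : finType) (H : sgraph U) :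
  [forall e in copies_edges k H, #|e| == 2%N].
Proof.
apply/forall_inP => _ /imset2P[i e _ eH ->].
rewrite card_imset; last by move=> x y [].
exact: (forall_inP (edges_card2 H)).
Qed.

Definition copies (k : nat) (U : finType) (H : sgraph U) :
    sgraph ('I_k * U)%type :=
  SGraph (copies_card2 k H).

Definition gfamily := forall T : finType, sgraph T -> Prop.

(* Since [subgraph] is up to isomorphism, such a family is in particular closed
   under isomorphism. *)
Definition subgraph_closed (F : gfamily) : Prop :=
  forall (T U : finType) (G : sgraph T) (H : sgraph U),
    subgraph H G -> F T G -> F U H.

Definition nucleus (F : gfamily) : gfamily :=
  fun U H => forall k : nat, F _ (copies k H).

Section Density.
Variable R : realType.
Local Open Scope ereal_scope.

Definition density (T : finType) (G : sgraph T) : R :=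
  (#|edges G|%:R / #|T|%:R)%R.

(* The supremum is over an empty set, and equal to -oo, when H has at most one
   vertex. *)
Definition extremal (U : finType) (H : sgraph U) : \bar R :=
  ereal_sup [set z | exists (T : finType) (G : sgraph T),
    [/\ (0 < #|T|)%N, ~ has_minor G H & z = (density G)%:E]].

Definition vol (T U : finType) (H : sgraph U) (G : sgraph T) : \bar R :=
  ereal_sup [set z | exists (k : nat) (alpha : 'I_k -> R)
      (mu : 'I_k -> U -> {set T}),
    [/\ forall i, (0 <= alpha i)%R,
        forall i, jumbled_model G H (mu i),
        forall x, (\sum_(i < k) alpha i * (multiplicity (mu i) x)%:R <= 1)%R
      & z = (\sum_(i < k) alpha i)%:E]].

(* The volume of a non-null G is 0 only if H has an edge and G has none; the
   quotient is then 0 / 0 = 0 in \bar R. *)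
Definition frac_extremal (U : finType) (H : sgraph U) : \bar R :=
  ereal_sup [set z | exists (T : finType) (G : sgraph T),
    (0 < #|T|)%N /\ z = (density G)%:E / vol H G].

Definition rho (F : gfamily) : \bar R :=
  ereal_sup [set z | exists (U : finType) (H : sgraph U),
    [/\ (0 < #|U|)%N, nucleus F H
      & z = frac_extremal H / #|U|%:R%:E]].

(* A graph has a separation if and only if it is not complete.  The complete
   graphs have to be exempted: a nonempty family closed under subgraphs contains
   the null graph, which has no separation at all. *)
Definition strongly_sublinear_separators (F : gfamily) : Prop :=
  subgraph_closed F /\
  exists beta c : R, [/\ (beta < 1)%R, (0 < c)%R &
    forall (T : finType) (G : sgraph T), F T G ->
      (exists A B, separation G A B) ->
      exists A B, [/\ separation G A B, balanced A B
        & (#|A :&: B|%:R <= c * #|T|%:R `^ beta)%R]].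

(* Up to isomorphism, the graphs with n vertices are those on 'I_n.  The maximum
   is -oo when F contains none of them. *)
Definition max_extremal (F : gfamily) (n : nat) : \bar R :=
  \big[maxe/-oo]_(G : sgraph 'I_n | `[< F _ G >]) (extremal G / n%:R%:E).

End Density.

(* Main.v *)
Require Import Defs.
From HB Require Import structures.
From mathcomp Require Import all_classical all_reals all_analysis.
From mathcomp Require Import all_boot all_order all_algebra.
From mathcomp Require Import zify ring lra.

Set Implicit Arguments.
Unset Strict Implicit.
Unset Printing Implicit Defensive.

Import Order.TTheory GRing.Theory Num.Theory.

(* Lower bound: if the blow-up of a graph S by independent sets of size m has a kH minor, then S has a fractional packing of jumbled models of H of weight k / m.  So the blow-up, of density m d(S), has no kH minor once k / m > Vol_H(S), while kH is in F for H in the nucleus.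

   Upper bound: let G in F have n vertices, and take a graph of density D = (rho + eps) n.  A minor-minimal dense minor of it has all its edges in about D triangles and no separations of order o(D).  So it contains either many disjoint "cut-dense" sets of size of order D, in which any two vertices are robustly joined by short paths, or a subgraph on O(D) vertices of density almost D.  On the other side, sublinear separators cover G by parts of bounded size with total overlap o(n).

   In the first case the parts are distributed among the cut-dense sets, and the o(n) overlapping vertices are assembled in one more such set, reached by the disjoint paths of Menger's theorem.  In the second case, all but o(n) vertices of G lie in components whose types are in the nucleus, since the other types occur boundedly often.  These components are extracted as follows: a random sequence of m vertices spans a graph S of almost the right density; by Erdos' theorem a positive proportion of such sequences gives a large blow-up of a single S, in which a fractional packing of S becomes a packing of disjoint models, and removing it decreases the density by at most (1 + eps) rho v(H) per model.  The o(n) remaining vertices are embedded, with their edges, as small dominating sets joined by short paths inside a reserve set chosen at the start. *)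

(** * Connectivity, degrees and minors *)

(** The obstacle is sharpness. Components of nucleus type may cost only (1 + eps) rho per vertex, so
    they have to be packed with almost no loss of density, whereas o(n) vertices may be embedded at
    any constant cost each. All constant costs are paid through [robust]: any two vertices are
    joined by a link of at most L vertices even when fewer than w vertices are forbidden, with L
    constant and w linear in n. Links can therefore be chosen greedily as long as their number is a
    small multiple of n, which is what the linear edge bound for F and the small overlap of the
    cover provide. Minimality of the dense minor is used twice: the triangles make neighbourhoods of
    low-degree vertices dense, and the absence of small separations feeds the paths that lead
    overlapping vertices to their common set. The constants are chosen in the order eps, gm, number
    M of pieces, size factor C0 of the dense subgraph (which grows with M), and last the lower bound
    on n. *)

Section Connectivity.
Variables (T : finType) (G : sgraph T).
Implicit Types (A B : {set T}) (x y : T).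

Definition in_rel A : rel T := [rel u v | [&& u \in A, v \in A & adj G u v]].

Lemma adjC x y : adj G x y = adj G y x.
Proof. by rewrite /adj setUC. Qed.

Lemma adjxx x : adj G x x = false.
Proof.
apply/negP => /(forall_inP (edges_card2 G)).
by rewrite setUid cards1.
Qed.

Lemma adj_neq x y : adj G x y -> x != y.
Proof. by apply: contraTN => /eqP->; rewrite adjxx. Qed.

Lemma edgeP e : e \in edges G -> exists x y, [/\ e = [set x; y], x != y & adj G x y].
Proof.
move=> eG; have /cards2P[x [y [xy ee]]] := forall_inP (edges_card2 G) _ eG.
by exists x, y; split=> //; rewrite /adj -ee.
Qed.

Lemma in_rel_sym A : connect_sym (in_rel A).
Proof.
apply: sym_connect_sym => u v; rewrite /in_rel /= adjC andbCA.
by rewrite !andbA [(v \in A) && _]andbC.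
Qed.

Lemma connectS A B x y : A \subset B -> connect (in_rel A) x y ->
  connect (in_rel B) x y.
Proof.
move=> /subsetP sAB; apply: connect_sub => u v /and3P[uA vA uv].
by apply: connect1; rewrite /in_rel /= !sAB.
Qed.

Lemma connected_in_root A x : x \in A ->
  (forall y, y \in A -> connect (in_rel A) x y) -> connected_in G A.
Proof.
move=> xA xy; apply/andP; split; first by apply/set0Pn; exists x.
apply/forall_inP => y yA; apply/forall_inP => z zA.
by apply: connect_trans (xy z zA); rewrite in_rel_sym xy.
Qed.

Lemma connected_inP A x y : connected_in G A -> x \in A -> y \in A ->
  connect (in_rel A) x y.
Proof. by case/andP=> _ /forall_inP h xA yA; exact: (forall_inP (h x xA)). Qed.

Lemma connected_in_neq0 A : connected_in G A -> exists x, x \in A.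
Proof. by case/andP=> /set0Pn. Qed.

Lemma connected_in1 x : connected_in G [set x].
Proof.
apply: (connected_in_root (x := x)); first by rewrite set11.
by move=> y /set1P->; exact: connect0.
Qed.

Lemma connected_inU A B x y : connected_in G A -> connected_in G B ->
  x \in A -> y \in B -> (x == y) || adj G x y -> connected_in G (A :|: B).
Proof.
move=> cA cB xA yB xy; apply: (connected_in_root (x := x)); first by rewrite inE xA.
have xyAB : connect (in_rel (A :|: B)) x y.
  case/orP: xy => [/eqP->|xy]; first exact: connect0.
  by apply: connect1; rewrite /in_rel /= !inE xA yB orbT xy.
move=> z /setUP[zA|zB].
  by apply: connectS (connected_inP cA xA zA); rewrite subsetUl.
apply: connect_trans xyAB _.
by apply: connectS (connected_inP cB yB zB); rewrite subsetUr.
Qed.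

Lemma connected_in_U1 A x y : connected_in G A -> y \in A -> adj G x y ->
  connected_in G (x |: A).
Proof.
move=> cA yA xy; apply: (connected_inU (x := x) (y := y)) => //.
- exact: connected_in1.
- exact: set11.
- by rewrite xy orbT.
Qed.

Lemma connected_in_bigcup (I : finType) (P : pred I) A (B : I -> {set T}) :
  connected_in G A ->
  (forall i, P i -> connected_in G (B i)) ->
  (forall i, P i -> exists x y, [/\ x \in A, y \in B i & (x == y) || adj G x y]) ->
  connected_in G (A :|: \bigcup_(i | P i) B i).
Proof.
move=> cA cB AB; rewrite -big_filter.
have sub i : i \in [seq i <- index_enum I | P i] -> P i by rewrite mem_filter => /andP[].
elim: [seq i <- _ | P i] sub => [|i s IHs] sub; first by rewrite big_nil setU0.
rewrite big_cons setUCA setUC.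
have Pi : P i by apply: sub; rewrite mem_head.
have [x [y [xA yB xy]]] := AB i Pi.
have {IHs} cs := IHs (fun j js => sub j (mem_behead (s := i :: s) js)).
by apply: (connected_inU cs (cB i Pi) _ yB xy); rewrite inE xA.
Qed.

Definition comp A x := [set y in A | connect (in_rel A) x y].

Lemma comp_sub A x : comp A x \subset A.
Proof. by apply/subsetP => y; rewrite inE => /andP[]. Qed.

Lemma connect_comp A x y : x \in A -> connect (in_rel A) x y ->
  (y \in A) && connect (in_rel (comp A x)) x y.
Proof.
move=> xA /connectP[p]; elim/last_ind: p y => [|p z IHp] y.
  by move=> _ /= ->; rewrite xA connect0.
rewrite rcons_path last_rcons => /andP[xp /and3P[lA zA lz]] ->.
have /andP[_ cl] := IHp _ xp erefl.
rewrite zA /=; apply: connect_trans cl (connect1 _).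
have xl : connect (in_rel A) x (last x p) by apply/connectP; exists p.
rewrite /in_rel /= !inE lA zA lz xl /= andbT.
by apply: connect_trans xl (connect1 _); rewrite /in_rel /= lA zA lz.
Qed.

Lemma comp_connected A x : x \in A -> connected_in G (comp A x).
Proof.
move=> xA; apply: (connected_in_root (x := x)); first by rewrite inE xA connect0.
by move=> y; rewrite inE => /andP[_ /(connect_comp xA)/andP[]].
Qed.

Lemma comp_closed A x y z : y \in comp A x -> z \in A -> adj G y z -> z \in comp A x.
Proof.
rewrite !inE => /andP[yA xy] zA yz; rewrite zA /=.
by apply: connect_trans xy (connect1 _); rewrite /in_rel /= yA zA yz.
Qed.

Lemma connect_exit (e : rel T) (C : {set T}) x y : connect e x y -> x \in C -> y \notin C ->
  exists u v, [/\ u \in C, v \notin C, e u v & connect e x u].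
Proof.
move=> /connectP[p xp ->]; elim/last_ind: p xp => [|p z IHp]; first by move=> _ /= ->.
rewrite rcons_path last_rcons => /andP[xp lz] xC zC.
have [lC|lC] := boolP (last x p \in C); last exact: IHp.
by exists (last x p), z; split=> //; apply/connectP; exists p.
Qed.

Lemma connected_exit A (C : {set T}) x y : connected_in G A -> x \in A -> y \in A ->
  x \in C -> y \notin C -> exists u v, [/\ u \in A, v \in A, u \in C, v \notin C & adj G u v].
Proof.
move=> cA xA yA xC yC.
have [u [v [uC vC /and3P[uA vA uv] _]]] := connect_exit (connected_inP cA xA yA) xC yC.
by exists u, v.
Qed.

End Connectivity.

Section Degrees.
Variables (T : finType) (G : sgraph T).
Implicit Types (A B : {set T}) (x y : T).

Definition nbhd x : {set T} := [set y | adj G x y].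

Definition deg_in A x : nat := #|nbhd x :&: A|.

(** Ordered pairs are counted, so [arcs G A A] is twice the number of edges inside A; hence the
    factors 2 in the density conditions below. *)
Definition arcs A B : nat := \sum_(x in A) deg_in B x.

Lemma deg_inE A x : deg_in A x = (\sum_(y in A) adj G x y)%N.
Proof.
rewrite /deg_in -sum1_card [RHS](bigID (adj G x)) /= [X in (_ + X)%N]big1 ?addn0.
  by apply: eq_big => [y|y]; rewrite !inE andbC // => /andP[_ ->].
by move=> y /andP[_ /negPf->].
Qed.

Lemma arcsC A B : arcs A B = arcs B A.
Proof.
rewrite /arcs; under eq_bigr do rewrite deg_inE.
rewrite exchange_big; apply: eq_bigr => x _; rewrite deg_inE.
by apply: eq_bigr => y _; rewrite adjC.
Qed.

Lemma deg_inU A B x : [disjoint A & B] -> deg_in (A :|: B) x = (deg_in A x + deg_in B x)%N.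
Proof. by move=> dAB; rewrite !deg_inE -bigU //=; apply: eq_bigl => y; rewrite !inE. Qed.

Lemma arcsUl A B C : [disjoint A & B] -> arcs (A :|: B) C = (arcs A C + arcs B C)%N.
Proof. by move=> dAB; rewrite /arcs -bigU //=; apply: eq_bigl => y; rewrite !inE. Qed.

Lemma arcsUr A B C : [disjoint A & B] -> arcs C (A :|: B) = (arcs C A + arcs C B)%N.
Proof. by move=> dAB; rewrite arcsC arcsUl // (arcsC A) (arcsC B). Qed.

Lemma arcsUU A B : [disjoint A & B] ->
  arcs (A :|: B) (A :|: B) = (arcs A A + arcs B B + 2 * arcs A B)%N.
Proof.
move=> dAB; rewrite arcsUl // !arcsUr // (arcsC B A); lia.
Qed.

Lemma deg_in_sub A B x : A \subset B -> (deg_in A x <= deg_in B x)%N.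
Proof. by move=> sAB; rewrite subset_leq_card // setIS. Qed.

Lemma deg_in_le A x : (deg_in A x <= #|A|)%N.
Proof. by rewrite subset_leq_card // subsetIr. Qed.

Lemma arcs_sub A B A' B' : A \subset A' -> B \subset B' -> (arcs A B <= arcs A' B')%N.
Proof.
move=> sA sB; apply: (@leq_trans (arcs A B')).
  by apply: leq_sum => x _; exact: deg_in_sub.
rewrite /arcs [X in (_ <= X)%N](bigID [in A]) /=.
have -> : (\sum_(i in A' | i \in A) deg_in B' i = \sum_(i in A) deg_in B' i)%N.
  by apply: eq_bigl => i; case: (boolP (i \in A)) => [/(subsetP sA)->|]; rewrite ?andbF.
exact: leq_addr.
Qed.

Lemma arcs_le A B : (arcs A B <= #|A| * #|B|)%N.
Proof.
rewrite /arcs -sum_nat_const; apply: leq_sum => x _; exact: deg_in_le.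
Qed.

Lemma arcs1l x B : arcs [set x] B = deg_in B x.
Proof. by rewrite /arcs big_set1. Qed.

Lemma arcsD A B : B \subset A ->
  (arcs A A <= arcs (A :\: B) (A :\: B) + 2 * arcs B A)%N.
Proof.
move=> sBA; have sB : B :|: A :\: B = A.
  by apply/setP => x; rewrite !inE; case: (boolP (x \in B)) => //= /(subsetP sBA).
have dB : [disjoint B & A :\: B] by rewrite disjoints_subset setCD subsetUr.
have := arcsUU dB; have := arcsUr B dB.
rewrite sB; lia.
Qed.

Lemma arcsT : arcs [set: T] [set: T] = (2 * #|edges G|)%N.
Proof.
have degE x : deg_in [set: T] x = (\sum_(e in edges G) (x \in e))%N.
  rewrite /deg_in setIT.
  have -> : #|nbhd x| = #|[set [set x; y] | y in nbhd x]|.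
    rewrite card_in_imset // => y z; rewrite !inE => xy xz /setP/(_ y).
    rewrite !inE eqxx orbT => /esym/orP[/eqP yx|/eqP //].
    by rewrite yx adjxx in xy.
  rewrite -sum1_card [RHS](bigID (fun e : {set T} => x \in e)) /= [X in (_ + X)%N]big1 ?addn0; last first.
    by move=> e /andP[_ /negPf->].
  apply: eq_big => [e|e /imsetP[y _ ->]]; last by rewrite !inE eqxx.
  apply/imsetP/andP => [[y]|[eG xe]].
    by rewrite inE => xy ->; rewrite !inE eqxx.
  have [a [b [ee ab abG]]] := edgeP eG.
  move: xe; rewrite ee !inE => /orP[]/eqP->.
    by exists b; rewrite ?inE.
  by exists a; rewrite ?inE 1?adjC // setUC.
rewrite /arcs (eq_bigr _ (fun x _ => degE x)) exchange_big /= mulnC -sum_nat_const.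
apply: eq_bigr => e eG; have := forall_inP (edges_card2 G) _ eG => /eqP <-.
rewrite -sum1_card [RHS]big_mkcond /=; apply: eq_big => [x|x _]; first by rewrite inE.
by case: (x \in e).
Qed.

End Degrees.

Section Constructions.
Variable T : finType.
Implicit Types (r : rel T) (G : sgraph T).

(** Loops are dropped and r is symmetrised, so that any relation defines a graph. *)
Definition rel_edges r : {set {set T}} :=
  [set e | [exists x, exists y, [&& x != y, r x y & e == [set x; y]]]].

Lemma rel_edges_card2 r : [forall e in rel_edges r, #|e| == 2%N].
Proof.
apply/forall_inP => e; rewrite inE => /existsP[x /existsP[y /and3P[xy _ /eqP->]]].
by rewrite cards2 xy.
Qed.

Definition mkgraph r : sgraph T := SGraph (rel_edges_card2 r).

Lemma adj_mkgraph r x y : adj (mkgraph r) x y = (x != y) && (r x y || r y x).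
Proof.
rewrite /adj /= inE; apply/existsP/andP => [[a /existsP[b /and3P[ab rab /eqP e]]]|[xy /orP[rxy|ryx]]].
- have : (x \in [set a; b]) && (y \in [set a; b]) by rewrite -e !inE !eqxx orbT.
  have : (a \in [set x; y]) && (b \in [set x; y]) by rewrite e !inE !eqxx orbT.
  rewrite !inE => /andP[/orP[]/eqP ax /orP[]/eqP bx]; subst; rewrite ?eqxx // in ab *.
    by rewrite ab rab.
  by move=> _; rewrite eq_sym ab rab orbT.
- by exists x; apply/existsP; exists y; rewrite xy rxy /=.
by exists y; apply/existsP; exists x; rewrite eq_sym xy ryx setUC /=.
Qed.

End Constructions.

Section Induced.
Variables (T : finType) (G : sgraph T) (A : {set T}).

Definition induced : sgraph {x | x \in A} :=
  mkgraph [rel u v : {x | x \in A} | adj G (val u) (val v)].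

Lemma adj_induced u v : adj induced u v = adj G (val u) (val v).
Proof.
rewrite adj_mkgraph /= adjC orbb; case: eqP => //= ->.
by rewrite adjxx.
Qed.

Lemma card_induced : #|{: {x | x \in A}}| = #|A|.
Proof. exact: card_sig. Qed.

Lemma arcs_induced : (2 * #|edges induced|)%N = arcs G A A.
Proof.
rewrite -arcsT /arcs big_set.
have sumS (f : T -> nat) : (\sum_(u : {x | x \in A}) f (val u) = \sum_(x in A) f x)%N.
  by rewrite [RHS]big_sub.
rewrite -(sumS (deg_in G A)); apply: eq_big => [u|u _]; first by [].
rewrite !deg_inE -sumS; apply: eq_big => [v|v _]; first by rewrite inE.
by rewrite adj_induced.
Qed.

Lemma subgraph_induced : subgraph induced G.
Proof.
exists val; first exact: val_inj.
move=> e /edgeP[u [v [-> uv]]]; rewrite adj_induced => huv.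
by rewrite imsetU !imset_set1.
Qed.

End Induced.

Section Minors.

Lemma jumbled_connected (T U : finType) (G : sgraph T) (H : sgraph U) mu (B : {set U}) :
  jumbled_model G H mu -> connected_in H B -> connected_in G (\bigcup_(u in B) mu u).
Proof.
move=> [cmu amu] cB; have [u0 u0B] := connected_in_neq0 cB.
have [x0 x0u0] := connected_in_neq0 (cmu u0).
apply: (connected_in_root (x := x0)); first by apply/bigcupP; exists u0.
move=> y /bigcupP[v vB yv].
have sub u : u \in B -> mu u \subset \bigcup_(u in B) mu u by move=> uB; exact: (bigcup_sup u).
have /connectP[p] := connected_inP cB u0B vB.
elim/last_ind: p v vB y yv => [|p w IHp] v vB y yv.
  by move=> _ vu0; subst v; apply: connectS (sub _ u0B) (connected_inP (cmu u0) x0u0 yv).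
rewrite rcons_path last_rcons => /andP[pp /and3P[lB wB lw]] vw; subst v.
have [a [b [al bw ab]]] := amu _ _ lw.
apply: connect_trans (IHp _ lB a al pp erefl) _.
apply: connect_trans (connect1 (y := b) _) _; last exact: connectS (sub _ wB) (connected_inP (cmu w) bw yv).
by rewrite /in_rel /= (subsetP (sub _ lB)) // (subsetP (sub _ wB)).
Qed.

Lemma has_minor_trans (T U V : finType) (G : sgraph T) (H : sgraph U) (K : sgraph V) :
  has_minor G H -> has_minor H K -> has_minor G K.
Proof.
move=> [mu jmu dmu] [nu [cnu anu] dnu].
exists (fun v => \bigcup_(u in nu v) mu u); first split=> [v|v w vw].
- exact: (jumbled_connected jmu (cnu v)).
- have [a [b [av bw ab]]] := anu v w vw.
  have [x [y [xa yb xy]]] := jmu.2 a b ab.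
  by exists x, y; split=> //; apply/bigcupP; [exists a | exists b].
move=> v w vw; apply/pred0P => x /=; apply/negP => /andP[/bigcupP[a av xa] /bigcupP[b bw xb]].
have ab : a != b.
  by apply: contraTneq av => ->; apply/negP => bv; have /pred0P/(_ b) := dnu v w vw; rewrite /= bv bw.
by have /pred0P/(_ x) := dmu a b ab; rewrite /= xa xb.
Qed.

Lemma has_minor_refl (T : finType) (G : sgraph T) : has_minor G G.
Proof.
exists (fun x => [set x]); first split=> [v|u v uv]; first exact: connected_in1.
  by exists u, v; rewrite !inE.
by move=> u v uv; rewrite disjoints1 inE.
Qed.

Lemma subgraph_minor (T U : finType) (G : sgraph T) (H : sgraph U) :
  subgraph H G -> has_minor G H.
Proof.
case=> f f_inj fe; exists (fun x => [set f x]); first split=> [v|u v uv].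
- exact: connected_in1.
- exists (f u), (f v); rewrite !inE; split=> //.
  by have := fe _ uv; rewrite imsetU !imset_set1.
by move=> u v uv; rewrite disjoints1 inE (inj_eq f_inj).
Qed.

Lemma induced_minor (T : finType) (G : sgraph T) A : has_minor G (induced G A).
Proof. exact/subgraph_minor/subgraph_induced. Qed.

End Minors.

(** * Robust linkage and cut-dense sets *)

Section Links.
Variables (T : finType) (G : sgraph T).
Implicit Types (u v : T) (U Q : {set T}).

(** A u-v path with interior Q, asymmetric on purpose: u and Q are absorbed into the branch set of
    u, and only an edge to v remains. *)
Definition link u v Q : bool :=
  connected_in G (u |: Q) && [exists z in u |: Q, adj G z v].

(** Only the part of U inside Z counts, because links run inside Z. The ends u and v may lie in U,
    so used roots remain available as ends. *)
Definition robust (V0 Z : {set T}) (w L : nat) : Prop :=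
  forall u v U, u \in V0 -> v \in V0 -> (#|U :&: Z| < w)%N ->
    exists Q, [/\ Q \subset Z :\: U, (#|Q| <= L)%N & link u v Q].

Lemma leq_card_bigcup (I : Type) (r : seq I) (P : pred I) (F : I -> {set T}) :
  (#|\bigcup_(i <- r | P i) F i| <= \sum_(i <- r | P i) #|F i|)%N.
Proof.
elim/big_rec2: _ => [|i n A _ leA]; first by rewrite cards0.
by apply: leq_trans (leq_card_setU _ _) _; rewrite leq_add2l.
Qed.

(** Links are chosen one at a time, each avoiding U and the earlier ones. An earlier link is an
    obstacle for j only if its host set meets [Zs j], and then it forbids at most L vertices. *)
Lemma multilink_seq (J : finType) (s t : J -> T) (Zs : J -> {set T}) (w L : nat) U :
  (forall j U', (#|U' :&: Zs j| < w)%N ->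
     exists Q, [/\ Q \subset Zs j :\: U', (#|Q| <= L)%N & link (s j) (t j) Q]) ->
  (forall j, (#|U :&: Zs j| + L * #|[set j' | ~~ [disjoint Zs j' & Zs j]]| < w)%N) ->
  forall js : seq J, uniq js ->
  exists Q : J -> {set T},
    (forall j, j \in js -> [/\ Q j \subset Zs j :\: U, (#|Q j| <= L)%N & link (s j) (t j) (Q j)]) /\
    (forall i j, i \in js -> j \in js -> i != j -> [disjoint Q i & Q j]).
Proof.
move=> rob cnt; elim=> [_|j js IH]; first by exists (fun=> set0).
move=> /= /andP[jjs ujs]; have [Q [Qok Qdis]] := IH ujs.
pose U' := U :|: \bigcup_(i <- js) Q i.
have : (#|U' :&: Zs j| < w)%N.
  apply: leq_ltn_trans (cnt j); rewrite /U' setIUl.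
  apply: leq_trans (leq_card_setU _ _) _; rewrite leq_add2l.
  have -> : (\bigcup_(i <- js) Q i) :&: Zs j = \bigcup_(i <- js | ~~ [disjoint Zs i & Zs j]) (Q i :&: Zs j).
    rewrite big_distrl /= big_seq [RHS]big_mkcond [RHS]big_seq; apply: eq_bigr => i ijs.
    case: ifPn => //; rewrite negbK => dij; apply/eqP; rewrite setI_eq0.
    have [sQ _ _] := Qok i ijs; apply: disjointWl dij.
    exact: subset_trans sQ (subsetDl _ _).
  apply: leq_trans (leq_card_bigcup _ _ _) _.
  apply: (@leq_trans (\sum_(i <- js | ~~ [disjoint Zs i & Zs j]) L)).
    rewrite big_seq_cond [leqRHS]big_seq_cond; apply: leq_sum => i /andP[ijs _].
    by have [_ le _] := Qok i ijs; apply: leq_trans le; rewrite subset_leq_card // subsetIl.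
  rewrite -big_filter (big_uniq _ (filter_uniq _ ujs)) sum_nat_const mulnC leq_mul2l.
  apply/orP; right; apply: subset_leq_card; apply/subsetP => i.
  by rewrite mem_filter inE => /andP[].
move=> /rob[Q0 [sQ0 leQ0 lQ0]]; exists (fun i => if i == j then Q0 else Q i).
have neq i : i \in js -> (i == j) = false by move=> ijs; apply: contraNF jjs => /eqP <-.
have dj i : i \in js -> [disjoint Q i & Q0].
  move=> ijs; have siU' : Q i \subset U'.
    by apply: subset_trans (subsetUr _ _); rewrite bigcup_seq; exact: (bigcup_sup i).
  rewrite disjoint_sym; apply: disjointWl sQ0 _; rewrite disjoint_sym disjoints_subset setCD.
  exact: subset_trans siU' (subsetUr _ _).
split=> [i|i k].
  rewrite inE => /orP[/eqP->|ijs]; last by rewrite neq //; exact: Qok.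
  rewrite eqxx; split=> //; apply: subset_trans sQ0 _; apply: setDS; exact: subsetUl.
rewrite !inE => /orP[/eqP->|ijs] /orP[/eqP->|kjs]; rewrite ?eqxx //.
- by move=> _; rewrite neq // disjoint_sym dj.
- by move=> _; rewrite neq // dj.
by rewrite !neq //; exact: Qdis.
Qed.

Lemma multilink (J : finType) (s t : J -> T) (Zs : J -> {set T}) (w L : nat) U :
  (forall j U', (#|U' :&: Zs j| < w)%N ->
     exists Q, [/\ Q \subset Zs j :\: U', (#|Q| <= L)%N & link (s j) (t j) Q]) ->
  (forall j, (#|U :&: Zs j| + L * #|[set j' | ~~ [disjoint Zs j' & Zs j]]| < w)%N) ->
  exists Q : J -> {set T},
    (forall j, [/\ Q j \subset Zs j :\: U, (#|Q j| <= L)%N & link (s j) (t j) (Q j)]) /\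
    (forall i j, i != j -> [disjoint Q i & Q j]).
Proof.
move=> rob cnt; have [Q [Q1 Q2]] := multilink_seq rob cnt (enum_uniq J).
by exists Q; split=> [j|i j ij]; [apply: Q1|apply: Q2]; rewrite ?mem_enum.
Qed.

(* Copies [c] of the vertices [pi c] of [H] are realised by disjoint connected sets [S c]; the copies of one vertex are merged, and the missing edges are realised, by disjoint links. *)
Lemma assemble_minor (V : finType) (H : sgraph V) (Cp : finType) (pi : Cp -> V) (S : Cp -> {set T})
    (J : finType) (src tgt : J -> Cp) (s t : J -> T) (Q : J -> {set T}) (ctr : V -> Cp) :
  (forall c, connected_in G (S c)) ->
  (forall c c', c != c' -> [disjoint S c & S c']) ->
  (forall j, [/\ s j \in S (src j), t j \in S (tgt j) & link (s j) (t j) (Q j)]) ->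
  (forall j c, [disjoint Q j & S c]) ->
  (forall i j, i != j -> [disjoint Q i & Q j]) ->
  (forall v : V, pi (ctr v) = v) ->
  (forall c, c != ctr (pi c) -> exists2 j, src j = c & tgt j = ctr (pi c)) ->
  (forall u v : V, adj H u v ->
     (exists c c' x y, [/\ pi c = u, pi c' = v, x \in S c, y \in S c' & adj G x y]) \/
     (exists j, ((pi (src j), pi (tgt j)) == (u, v)) || ((pi (src j), pi (tgt j)) == (v, u)))) ->
  has_minor G H.
Proof.
move=> cS dS st dQS dQ ctrK merge edge.
(* Every link is charged to its source copy; the target side contributes just the last adjacency.
   This keeps the sets [E c] disjoint. *)
pose E c := S c :|: \bigcup_(j | src j == c) (s j |: Q j).
have cE c : connected_in G (E c).
  apply: connected_in_bigcup => // j; first by have [_ _ /andP[]] := st j.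
  by move=> /eqP <-; exists (s j), (s j); rewrite !inE !eqxx; have [] := st j.
have subE c : S c \subset E c by exact: subsetUl.
exists (fun v : V => E (ctr v) :|: \bigcup_(c | pi c == v) E c); first split=> [v|u v uv].
- apply: connected_in_bigcup => // c /eqP cv.
  have [->|cn] := eqVneq c (ctr v).
    have [x xE] := connected_in_neq0 (cE (ctr v)).
    by exists x, x; rewrite eqxx.
  rewrite -cv in cn; have [j sj tj] := merge c cn.
  have [ss tt /andP[_ /exists_inP[z zQ zt]]] := st j.
  exists (t j), z; split; last by rewrite adjC zt orbT.
    by rewrite -cv -tj; apply: (subsetP (subE _)).
  rewrite -sj /E inE; apply/orP; right; apply/bigcupP; exists j => //.
- have mem c x : x \in E c -> x \in E (ctr (pi c)) :|: \bigcup_(c' | pi c' == pi c) E c'.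
    by move=> xE; rewrite inE; apply/orP; right; apply/bigcupP; exists c.
  case: (edge u v uv) => [[c [c' [x [y [<- <- xS yS xy]]]]]|[j ej]].
    by exists x, y; split=> //; apply: mem; apply: (subsetP (subE _)).
  have [ss tt /andP[_ /exists_inP[z zQ zt]]] := st j.
  have zE : z \in E (src j).
    by rewrite inE; apply/orP; right; apply/bigcupP; exists j.
  have tE : t j \in E (tgt j) by apply: (subsetP (subE _)).
  case/orP: ej => /eqP[<- <-].
    by exists z, (t j); split=> //; apply: mem.
  by exists (t j), z; split=> //; [apply: mem..|rewrite adjC].
have dE c c' : c != c' -> [disjoint E c & E c'].
  move=> cc'; apply/pred0P => x /=; apply/negP => /andP[].
  have memE d : x \in E d -> x \in S d \/ exists2 j, src j = d & x \in Q j.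
    rewrite inE => /orP[|/bigcupP[j /eqP sj]]; first by left.
    rewrite inE => /orP[/set1P->|xQ]; last by right; exists j.
    by left; rewrite -sj; have [] := st j.
  move=> /memE[xS|[j sj xQ]] /memE[xS'|[j' sj' xQ']].
  - by have /pred0P/(_ x) := dS c c' cc'; rewrite /= xS xS'.
  - by have /pred0P/(_ x) := dQS j' c; rewrite /= xS xQ'.
  - by have /pred0P/(_ x) := dQS j c'; rewrite /= xS' xQ.
  have jj' : j != j' by apply: contraNneq cc' => jj'; rewrite -sj -sj' jj'.
  by have /pred0P/(_ x) := dQ j j' jj'; rewrite /= xQ xQ'.
move=> u v uv; apply/pred0P => x /=; apply/negP => /andP[].
have memU (w : V) : x \in E (ctr w) :|: \bigcup_(c | pi c == w) E c -> exists2 c, pi c = w & x \in E c.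
  rewrite inE => /orP[xE|/bigcupP[c /eqP <- xE]]; last by exists c.
  by exists (ctr w).
move=> /memU[c cu xc] /memU[c' cv xc'].
have cc' : c != c' by apply: contraNneq uv => cc'; rewrite -cu -cv cc'.
by have /pred0P/(_ x) := dE c c' cc'; rewrite /= xc xc'.
Qed.

End Links.

Section CutDense.
Variables (R : realType) (T : finType) (G : sgraph T).
Implicit Types (P B Z : {set T}) (u v : T) (a : R).
Local Open Scope ring_scope.

Definition cut_dense a P : Prop :=
  forall B, B \subset P -> B != set0 -> B != P ->
    a * #|B|%:R * #|P :\: B|%:R <= (arcs G B (P :\: B))%:R.

(** A minimal set satisfying the inequality works: if both sides B and P' minus B of a cut violate
    it, the cross term 2 a x y of a (x + y)^2 has to be supplied by the arcs between them. *)
Lemma exists_cut_dense a D P : P != set0 ->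
  D * #|P|%:R + a * #|P|%:R ^+ 2 <= (arcs G P P)%:R ->
  exists2 P' : {set T}, P' \subset P & [/\ P' != set0, cut_dense a P' &
    D * #|P'|%:R + a * #|P'|%:R ^+ 2 <= (arcs G P' P')%:R].
Proof.
move=> P0 eP.
pose good (A : {set T}) := (A != set0) && (D * #|A|%:R + a * #|A|%:R ^+ 2 <= (arcs G A A)%:R).
have [P' minP' sP'] := minset_exists (P := good) (C := P) (introT andP (conj P0 eP)).
exists P' => //; have /andP[P'0 eP'] := minsetp minP'; split=> // B sB B0 BP'.
have ngood (A : {set T}) : A \subset P' -> A != P' -> A != set0 ->
    (arcs G A A)%:R < D * #|A|%:R + a * #|A|%:R ^+ 2.
  move=> sA AP' A0; rewrite ltNge; apply: contra AP' => eA.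
  by apply/eqP; apply: (minsetinf minP') => //; rewrite /good A0.
have P'E : P' = B :|: P' :\: B.
  by apply/setP => x; rewrite !inE; case: (boolP (x \in B)) => //= /(subsetP sB).
have dB : [disjoint B & P' :\: B] by rewrite disjoints_subset setCD subsetUr.
have D0 : P' :\: B != set0.
  by apply: contra BP'; rewrite setD_eq0 => s; rewrite eqEsubset sB.
have DP' : P' :\: B != P'.
  apply: contra B0 => /eqP e; rewrite -subset0; apply/subsetP => x xB.
  by have := subsetP sB x xB; rewrite -e inE xB.
have h1 := ngood B sB BP' B0; have h2 := ngood _ (subsetDl _ _) DP' D0.
have cP' : #|P'|%:R = #|B|%:R + #|P' :\: B|%:R :> R.
  by rewrite -natrD -cardsUI (disjoint_setI0 dB) cards0 addn0 -P'E.
have eA := arcsUU G dB; rewrite -P'E in eA.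
move: eP'; rewrite cP' eA natrD natrD natrM.
move: h1 h2; set x := #|B|%:R; set y := #|P' :\: B|%:R.
set e1 := (arcs G B B)%:R; set e2 := (arcs _ (_ :\: _) _)%:R; set e3 := (arcs _ _ _)%:R => h1 h2 h3.
nra.
Qed.

Fixpoint gball (P : {set T}) (th : nat) u k : {set T} :=
  if k is k'.+1 then gball P th u k' :|: [set v in P | (th <= deg_in G (gball P th u k') v)%N]
  else nbhd G u :&: P.

Lemma gball_sub P th u k : gball P th u k \subset P.
Proof.
elim: k => [|k IH] /=; first exact: subsetIr.
by rewrite subUset IH; apply/subsetP => v; rewrite inE => /andP[].
Qed.

Lemma gball_le P th u k l : (k <= l)%N -> gball P th u k \subset gball P th u l.
Proof.
elim: l => [|l IH]; first by rewrite leqn0 => /eqP->.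
rewrite leq_eqVlt => /orP[/eqP->//|kl].
by apply: subset_trans (IH kl) _; exact: subsetUl.
Qed.

(** Descend through the balls around one end: at each step the current vertex has w neighbours of Z
    in the previous ball, and one of them lies outside U. *)
Lemma gball_robust P Z th w K :
  (forall k u v, (k < K)%N -> u \in P -> v \in P -> (th <= deg_in G (gball P th u k) v)%N ->
     (w <= #|nbhd G v :&: gball P th u k :&: Z|)%N) ->
  (forall u v, u \in P -> v \in P -> v \in gball P th u K) -> robust G P Z w K.
Proof.
move=> samp full u v U uP vP Uw.
suff gen k u' : u' \in P -> (k <= K)%N -> u' \in gball P th v k ->
    exists Q : {set T}, [/\ Q \subset Z :\: U, (#|Q| <= k)%N & link G u' v Q].
  by apply: gen => //; exact: full.
elim: k u' => [|k IH] {uP}u uP kK /=.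
  rewrite !inE => /andP[vu _]; exists set0; split; rewrite ?sub0set ?cards0 //.
  apply/andP; split; first by rewrite setU0; exact: connected_in1.
  by apply/exists_inP; exists u; rewrite ?inE ?eqxx // adjC.
have bl : u \in gball P th v k -> exists Q : {set T}, [/\ Q \subset Z :\: U, (#|Q| <= k.+1)%N & link G u v Q].
  by move=> /(IH u uP (ltnW kK))[Q [sQ lQ Ql]]; exists Q; split=> //; exact: leqW.
case/setUP=> [//|]; rewrite inE => /andP[_ thu].
have := samp k v u kK vP uP thu => wle.
have /subsetPn[x] : ~~ (nbhd G u :&: gball P th v k :&: Z \subset U).
  apply: contraTN Uw => s; rewrite -leqNgt; apply: leq_trans wle _.
  by rewrite subset_leq_card // subsetI s subsetIr.
rewrite !inE => /andP[/andP[ux xb] xZ] xU.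
have xP := subsetP (gball_sub P th v k) x xb.
have [Q [sQ lQ /andP[cQ /exists_inP[z zQ zv]]]] := IH x xP (ltnW kK) xb.
exists (x |: Q); split.
- by rewrite subUset sQ sub1set inE xU xZ.
- by apply: leq_trans (leq_card_setU _ _) _; rewrite cards1 add1n ltnS.
apply/andP; split.
  by apply: (connected_in_U1 (y := x)) => //; rewrite !inE eqxx.
by apply/exists_inP; exists z => //; rewrite inE zQ orbT.
Qed.

Lemma cut_dense_deg a P v : cut_dense a P -> (1 < #|P|)%N -> v \in P ->
  a * (#|P|%:R - 1) <= (deg_in G P v)%:R.
Proof.
move=> cd P1 vP; have := cd [set v].
rewrite sub1set vP => /(_ isT); rewrite -card_gt0 cards1 => /(_ isT).
have -> : [set v] != P by apply: contraTneq P1 => <-; rewrite cards1.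
move=> /(_ isT); rewrite arcs1l mulr1.
have -> : #|P :\: [set v]|%:R = #|P|%:R - 1 :> R.
  by rewrite [#|P|](cardsD1 v) vP natrD addrC addKr.
move=> /le_trans; apply; rewrite ler_nat; apply: deg_in_sub; exact: subsetDl.
Qed.

Lemma sum_threshold (I : finType) (A : {set I}) (f : I -> nat) (th m : nat) :
  (forall i, i \in A -> (f i <= m)%N) ->
  (\sum_(i in A) f i <= #|[set i in A | (th <= f i)%N]| * m + #|A| * th)%N.
Proof.
move=> fm; rewrite (bigID (fun i => (th <= f i)%N)) /=; apply: leq_add.
  apply: (@leq_trans (\sum_(i in A | (th <= f i)%N) m)).
    by apply: leq_sum => i /andP[/fm].
  by rewrite sum_nat_cond_const leq_mul2r; apply/orP; right; apply: subset_leq_card; apply/subsetP => i; rewrite !inE.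
rewrite -sum_nat_const big_mkcondr; apply: leq_sum => i _.
by case: (leqP th (f i)) => //= /ltnW.
Qed.

(** The part of P outside the ball shrinks by the factor 1 - a/2 at each step: cut-density sends
    many arcs to the ball B, and vertices with fewer than [th] neighbours there account for at most
    half of them. Once it has at most a |P| / 4 vertices, the minimum degree a (|P| - 1) forces all
    of P into the next ball. *)
Lemma gball_full a P th K : 0 < a -> (1 < #|P|)%N -> cut_dense a P ->
  th%:R <= a ^+ 2 * #|P|%:R / 8 -> (1 - a / 2) ^+ K <= a / 4 ->
  forall u v, u \in P -> v \in P -> v \in gball P th u K.+1.
Proof.
move=> a0 P1 cd thle Kle u v uP vP.
set N := #|P|%:R in thle.
have N2 : 2 <= N by rewrite /N (ler_nat _ 2).
have degP x : x \in P -> a * (N - 1) <= (deg_in G P x)%:R by exact: cut_dense_deg.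
have a1 : a <= 1.
  have : (deg_in G P u <= #|P|.-1)%N.
    rewrite -ltnS prednK ?(ltnW P1) //; apply: proper_card; rewrite properE subsetIr /=.
    by apply/subsetPn; exists u => //; rewrite !inE adjxx.
  rewrite -(ler_nat R) => /(le_trans (degP u uP)); rewrite -subn1 natrB ?(ltnW P1) // -/N.
  by move=> h; nra.
have Bge k : a * N / 2 <= #|gball P th u k|%:R.
  apply: (@le_trans _ _ (a * (N - 1))); first by nra.
  apply: le_trans (degP u uP) _; rewrite ler_nat.
  by have := subset_leq_card (gball_le P th u (leq0n k)).
have step k : #|P :\: gball P th u k.+1|%:R <= (1 - a / 2) * #|P :\: gball P th u k|%:R :> R.
  set B := gball P th u k; set X := [set x in P :\: B | (th <= deg_in G B x)%N].
  have [D0|D0] := eqVneq (P :\: B) set0.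
    have -> : P :\: gball P th u k.+1 = set0.
      apply/eqP; rewrite setD_eq0; apply: subset_trans (gball_le P th u (leqnSn k)).
      by rewrite -setD_eq0 D0.
    by rewrite D0 cards0 mulr0.
  have BP : B != P by apply: contra D0 => /eqP ->; rewrite setDv.
  have B0 : B != set0.
    rewrite -card_gt0 -(ltr_nat R); apply: lt_le_trans (Bge k); nra.
  have := cd B (gball_sub _ _ _ _) B0 BP.
  rewrite arcsC => h; have := sum_threshold th (fun x _ => deg_in_le G B x) (A := P :\: B).
  rewrite -(ler_nat R) => /(le_trans h); rewrite natrD !natrM -/X.
  have -> : P :\: gball P th u k.+1 = (P :\: B) :\: X.
    by apply/setP => x; rewrite /= !inE -/B; case: (x \in P); case: (x \in B); case: leq.
  have XP : X \subset P :\: B by apply/subsetP => x; rewrite inE => /andP[].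
  rewrite [#|_ :\: X|]cardsD (setIidPr XP) natrB ?subset_leq_card //.
  have := Bge k; rewrite -/B; set b := #|B|%:R; set r := #|_ :\: _|%:R; set x := #|X|%:R => h1 h2.
  have r0 : 0 <= r by rewrite ler0n.
  have th2 : th%:R <= a * b / 2 by nra.
  have b0 : 0 < b by nra.
  have : a * b * r <= x * b + r * (a * b / 2).
    by apply: le_trans h2 _; rewrite lerD2l ler_wpM2l.
  move=> h3; suff : a / 2 * r <= x by lra.
  by rewrite -(ler_pM2r b0); lra.
have rk k : #|P :\: gball P th u k|%:R <= (1 - a / 2) ^+ k * N.
  elim: k => [|k IH]; first by rewrite expr0 mul1r ler_nat subset_leq_card // subsetDl.
  apply: le_trans (step k) _; rewrite exprS -mulrA ler_wpM2l //; lra.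
have rK : #|P :\: gball P th u K|%:R <= a / 4 * N.
  by apply: le_trans (rk K) _; rewrite ler_wpM2r //; lra.
rewrite /= !inE vP /=; apply/orP; right.
have : (deg_in G P v <= deg_in G (gball P th u K) v + #|P :\: gball P th u K|)%N.
  have PE : P = gball P th u K :|: P :\: gball P th u K.
    apply/setP => x; rewrite !inE; case: (boolP (x \in gball P th u K)) => //= h.
    by rewrite (subsetP (gball_sub P th u K)).
  rewrite {1}PE deg_inU ?leq_add2l ?deg_in_le //.
  by rewrite disjoints_subset setCD subsetUr.
rewrite -(ler_nat R) natrD -(ler_nat R) => h; have := degP v vP.
have a10 : 0 <= 1 - a by lra.
have N0 : 0 <= N by lra.
have aN := mulr_ge0 (mulr_ge0 (ltW a0) a10) N0.
have aN2 : 2 * a <= a * N by rewrite mulrC ler_wpM2l // ltW.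
lra.
Qed.

End CutDense.

(** * Packing models by sampling *)

Section Expectation.
Variables (R : realType) (T : finType) (W : {set T}).
Local Open Scope ring_scope.
Implicit Types (g : seq T -> R) (f : T -> R).

Definition avg f : R := (\sum_(v in W) f v) / #|W|%:R.

(** Expectation over m independent uniform elements of W, repetitions allowed. The recursion
    conditions on the first entry. *)
Fixpoint mean m g : R :=
  if m is m'.+1 then avg (fun v => mean m' (fun s => g (v :: s))) else g [::].

Lemma avgD f1 f2 : avg (fun v => f1 v + f2 v) = avg f1 + avg f2.
Proof. by rewrite /avg big_split mulrDl. Qed.

Lemma avgZ c f : avg (fun v => c * f v) = c * avg f.
Proof. by rewrite /avg -mulr_sumr mulrA. Qed.

Lemma eq_avg f1 f2 : (forall v, v \in W -> f1 v = f2 v) -> avg f1 = avg f2.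
Proof. by move=> e; rewrite /avg (eq_bigr _ e). Qed.

Lemma ler_avg f1 f2 : (forall v, v \in W -> f1 v <= f2 v) -> avg f1 <= avg f2.
Proof. by move=> e; rewrite /avg ler_wpM2r ?invr_ge0 // ler_sum. Qed.

Lemma avg_cst c : W != set0 -> avg (fun=> c) = c.
Proof.
move=> W0; rewrite /avg sumr_const -[_ *+ _]mulr_natr mulfK // pnatr_eq0.
by rewrite cards_eq0.
Qed.

Lemma eq_mean m g1 g2 : (forall s, size s = m -> all [in W] s -> g1 s = g2 s) ->
  mean m g1 = mean m g2.
Proof.
elim: m g1 g2 => [|m IH] g1 g2 e /=; first exact: e.
by apply: eq_avg => v vW; apply: IH => s sm sW; apply: e; rewrite /= ?sm ?vW.
Qed.

Lemma ler_mean m g1 g2 : (forall s, size s = m -> all [in W] s -> g1 s <= g2 s) ->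
  mean m g1 <= mean m g2.
Proof.
elim: m g1 g2 => [|m IH] g1 g2 e /=; first exact: e.
by apply: ler_avg => v vW; apply: IH => s sm sW; apply: e; rewrite /= ?sm ?vW.
Qed.

Lemma meanD m g1 g2 : mean m (fun s => g1 s + g2 s) = mean m g1 + mean m g2.
Proof.
elim: m g1 g2 => [//|m IH] g1 g2 /=; rewrite -avgD.
by apply: eq_avg => v _; rewrite -IH.
Qed.

Lemma meanZ m c g : mean m (fun s => c * g s) = c * mean m g.
Proof.
elim: m g => [//|m IH] g /=; rewrite -avgZ.
by apply: eq_avg => v _; rewrite -IH.
Qed.

Hypothesis W0 : W != set0.

Lemma mean_cst m c : mean m (fun=> c) = c.
Proof. by elim: m => //= m ->; rewrite avg_cst. Qed.

Lemma mean_sum (I : Type) (r : seq I) (P : pred I) m (G : I -> seq T -> R) :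
  mean m (fun s => \sum_(i <- r | P i) G i s) = \sum_(i <- r | P i) mean m (G i).
Proof.
elim: r => [|i r IH].
  by rewrite big_nil -[RHS](mean_cst m); apply: eq_mean => s _ _; rewrite big_nil.
rewrite big_cons; case Pi: (P i).
  by rewrite -IH -meanD; apply: eq_mean => s _ _; rewrite big_cons Pi.
by rewrite -IH; apply: eq_mean => s _ _; rewrite big_cons Pi.
Qed.

Lemma mean_linear m (d : T -> R) : mean m (fun s => \sum_(x <- s) d x) = m%:R * avg d.
Proof.
elim: m => [|m IH]; first by rewrite /= big_nil mul0r.
rewrite /= -natr1 mulrDl mul1r -IH addrC -[X in _ + X](avg_cst _ W0) -avgD.
apply: eq_avg => v _; rewrite -[X in X + _](mean_cst m) -meanD.
by apply: eq_mean => s _ _; rewrite big_cons.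
Qed.

(** Since d vanishes on the diagonal, a position paired with itself contributes nothing, which
    leaves m (m - 1) ordered pairs of independent entries. *)
Lemma mean_pairs m (d : T -> T -> R) : (forall x, d x x = 0) -> (forall x y, d x y = d y x) ->
  mean m (fun s => \sum_(x <- s) \sum_(y <- s) d x y) =
  m%:R * (m%:R - 1) * avg (fun x => avg (d x)).
Proof.
move=> d0 dC; elim: m => [|m IH]; first by rewrite /= big_nil !mul0r.
rewrite [mean _ _]/=.
transitivity (avg (fun v => mean m (fun s => \sum_(x <- s) \sum_(y <- s) d x y) + 2 * (m%:R * avg (d v)))).
  apply: eq_avg => v _; rewrite -mean_linear -meanZ -meanD; apply: eq_mean => s _ _.
  rewrite big_cons big_cons d0 add0r.
  under [X in _ + X]eq_bigr do rewrite big_cons dC.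
  by rewrite big_split /= addrA; ring.
rewrite avgD avg_cst // !avgZ IH -natr1; ring.
Qed.

(** Markov's inequality in the form g <= M times the indicator of g >= 0. *)
Lemma mean_pos_part m g (M mu : R) : 0 < M ->
  (forall s, size s = m -> all [in W] s -> g s <= M) ->
  mu <= mean m g -> mu / M <= mean m (fun s => ((0 <= g s)%R)%:R).
Proof.
move=> M0 gM mug; rewrite ler_pdivrMr // mulrC -meanZ; apply: le_trans mug _.
apply: ler_mean => s sm sW; case: (leP 0 (g s)) => [_|/ltW g0] /=.
  by rewrite mulr1; exact: gM.
by rewrite mulr0.
Qed.

Lemma sum_pigeonhole (I : finType) (P : pred I) (x : I -> R) (dl : R) n :
  0 < dl -> (#|[set i | P i]| <= n)%N -> dl <= \sum_(i | P i) x i ->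
  exists2 i, P i & dl / n%:R <= x i.
Proof.
move=> dl0 Pn h; case: (pickP (fun i => P i && (dl / n%:R <= x i))) => [i /andP[]|nh]; first by exists i.
have n0 : (0 < n)%N.
  case: (posnP n) => // n0; move: Pn h; rewrite n0 leqn0 cards_eq0 => /eqP P0.
  rewrite big_pred0 ?leNgt ?dl0 // => i; apply/negP => Pi.
  by move/setP/(_ i) : P0; rewrite !inE Pi.
have n0R : 0 < n%:R :> R by rewrite ltr0n.
have lt i : P i -> x i < dl / n%:R by move=> Pi; have := nh i; rewrite Pi /= => /negbT; rewrite ltNge.
have [P0|[i0 i0P]] := set_0Vmem [set i | P i].
  move: h; rewrite big_pred0 ?leNgt ?dl0 // => i; apply/negP => Pi.
  by move/setP/(_ i) : P0; rewrite !inE Pi.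
have : \sum_(i | P i) x i < \sum_(i | P i) (dl / n%:R).
  apply: ltr_sum => //; apply/hasP; exists i0; rewrite ?mem_index_enum //.
  by rewrite inE in i0P.
rewrite sumr_const => /(le_lt_trans h); rewrite ltNge -[_ *+ _]mulr_natr.
have -> : #|P| = #|[set i | P i]| by apply: eq_card => i; rewrite inE.
by move=> /negP[]; rewrite mulrAC ler_pdivrMr // ler_pM2l // ler_nat.
Qed.

End Expectation.

(** * Complete multipartite patterns in dense families of sequences *)

Section Erdos.
Variable R : realType.
Local Open Scope ring_scope.

(** Induction on m. Many first entries v have conditional probability at least dl/2; fix b of them.
    For enough tails s, at least t of these b entries extend s, and as there are at most 2^b sets of
    entries, one set B of size at least t serves a positive proportion of the tails. The sets found
    may overlap; [disjoint_subsets] repairs this. *)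
Lemma erdos_blowup m t (dl : R) : 0 < dl -> exists N0 : nat,
  forall (T : finType) (W : {set T}) (Q : seq T -> bool), W != set0 -> (N0 <= #|W|)%N ->
    dl <= mean W m (fun s => (Q s)%:R) ->
    exists A : seq {set T}, [/\ size A = m,
      (forall B : {set T}, B \in A -> B \subset W /\ (t <= #|B|)%N) &
      forall s, all2 (fun x (B : {set T}) => x \in B) s A -> Q s].
Proof.
elim: m dl => [|m IH] dl dl0.
  exists 0%N => T W Q W0 _ /= h; exists [::]; split=> // -[] // _.
  by case: (Q [::]) h => //=; rewrite leNgt dl0.
(* With b dl / 4 >= t, discarding the tails with fewer than t extensions costs at most half of the b
   dl / 2 available. *)
pose b := (Num.truncn (4 * t%:R / dl)).+1.
have bge : 4 * t%:R / dl <= b%:R by apply/ltW; rewrite truncnS_gt.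
have [N0 hN0] := IH (dl / 4 / (2 ^ b)%:R) ltac:(by rewrite !divr_gt0 // ltr0n expn_gt0).
exists (maxn N0 (Num.truncn (2 * b%:R / dl)).+1) => T W Q W0; rewrite geq_max => /andP[WN0 Wb] h.
pose f v := mean W m (fun s => (Q (v :: s))%:R : R).
have f1 v : f v <= 1.
  by rewrite -[leRHS](mean_cst W0 m); apply: ler_mean => s _ _; case: (Q _); rewrite ?ler01.
have N_gt0 : 0 < #|W|%:R :> R by rewrite ltr0n card_gt0.
pose W1 := [set v in W | dl / 2 <= f v].
have W1b : (b <= #|W1|)%N.
  rewrite -(ler_nat R).
  have : dl * #|W|%:R <= #|W1|%:R + #|W|%:R * (dl / 2).
    move: h; rewrite /= /avg ler_pdivlMr // => /le_trans; apply.
    rewrite (bigID (fun v => dl / 2 <= f v)) /=; apply: lerD.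
      apply: (@le_trans _ _ (\sum_(i in W | dl / 2 <= f i) 1)); first by apply: ler_sum => v _; exact: f1.
      by rewrite sumr_const ler_nat; apply: subset_leq_card; apply/subsetP => v; rewrite !inE.
    apply: (@le_trans _ _ (\sum_(i in W) (dl / 2))); last by rewrite sumr_const -[_ *+ _]mulr_natl.
    rewrite big_mkcondr; apply: ler_sum => v _.
    case: ifP => [|_]; last by rewrite divr_ge0 // ltW.
    by rewrite -ltNge => /ltW.
  have : 2 * b%:R / dl <= #|W|%:R.
    by apply/ltW/(lt_le_trans (truncnS_gt _)); rewrite ler_nat.
  rewrite ler_pdivrMr // => h1 h2; nra.
have [W2 sW2 cW2] : exists2 W2 : {set T}, W2 \subset W1 & #|W2| = b.
  exists [set x in take b (enum W1)].
    by apply/subsetP => x; rewrite inE => /mem_take; rewrite mem_enum.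
  rewrite cardsE; have /card_uniqP -> := take_uniq b (enum_uniq W1).
  by rewrite size_takel // -cardE.
have sumW2 : dl / 4 <= \sum_(B : {set T} | (B \subset W2) && (t <= #|B|)%N)
    mean W m (fun s => ([forall v in B, Q (v :: s)])%:R).
  rewrite -(mean_sum W0).
  have b0 : 0 < b%:R :> R by rewrite ltr0n.
  rewrite -(ler_pM2l b0) -meanZ.
  apply: (@le_trans _ _ (b%:R * (dl / 2) - t%:R)).
    by move: bge; rewrite ler_pdivrMr // => h1; lra.
  rewrite lerBlDr.
  apply: (@le_trans _ _ (\sum_(v in W2) f v)).
    rewrite mulr_natl -cW2 -sumr_const; apply: ler_sum => v /(subsetP sW2).
    by rewrite inE => /andP[].
  rewrite -(mean_sum W0) -[X in _ + X](mean_cst W0 m) -meanD; apply: ler_mean => s _ _.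
  (* If B has fewer than t elements the term t absorbs it; otherwise B is itself one of the sets
     summed over. *)
  rewrite -natr_sum; set B := [set v in W2 | Q (v :: s)].
  have -> : (\sum_(v in W2) Q (v :: s))%N = #|B|.
    rewrite -sum1_card big_mkcond [RHS]big_mkcond; apply: eq_bigr => v _.
    by rewrite inE; case: (v \in W2); case: (Q _).
  have sB : B \subset W2 by apply/subsetP => v; rewrite inE => /andP[].
  have [Bt|tB] := ltnP #|B| t.
    apply: (@le_trans _ _ t%:R); first by rewrite ler_nat ltnW.
    by rewrite lerDr mulr_ge0 ?ler0n // sumr_ge0.
  apply: (@le_trans _ _ (b%:R * 1)).
    by rewrite mulr1 -cW2 ler_nat subset_leq_card.
  apply: ler_wpDr => //; rewrite ler_wpM2l ?ler0n //.
  rewrite (bigD1 B) /= ?sB ?tB //.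
  have -> : [forall v in B, Q (v :: s)] by apply/forall_inP => v; rewrite inE => /andP[].
  by rewrite lerDl sumr_ge0.
have d40 : 0 < dl / 4 by rewrite divr_gt0.
have cP : (#|[set B : {set T} | (B \subset W2) && (t <= #|B|)%N]| <= 2 ^ b)%N.
  rewrite -cW2 -card_powerset; apply: subset_leq_card; apply/subsetP => B.
  by rewrite !inE => /andP[].
have [B /andP[sB tB] hB] := sum_pigeonhole d40 cP sumW2.
have [A [sA AW AQ]] := hN0 T W (fun s => [forall v in B, Q (v :: s)]) W0 WN0 hB.
exists (B :: A); split; first by rewrite /= sA.
  move=> B'; rewrite inE => /orP[/eqP->|/AW //]; split=> //.
  apply: subset_trans sB (subset_trans sW2 _); apply/subsetP => v; by rewrite inE => /andP[].
by move=> [|v s] //= /andP[vB /AQ /forall_inP/(_ v vB)].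
Qed.

Lemma disjoint_subsets (T : finType) (t m : nat) (A : seq {set T}) : (size A <= m)%N ->
  (forall B : {set T}, B \in A -> (t * m <= #|B|)%N) ->
  exists A' : seq {set T}, [/\ size A' = size A,
    forall i, nth set0 A' i \subset nth set0 A i,
    forall i, (i < size A)%N -> #|nth set0 A' i| = t &
    forall i j, i != j -> [disjoint nth set0 A' i & nth set0 A' j]].
Proof.
elim: A => [|B A IH] /=.
  move=> _ _; exists [::]; split=> // i j _.
  by rewrite nth_nil disjoints_subset sub0set.
move=> sA lB; have [|A' [sA' subA' cA' dA']] := IH (ltnW sA).
  by move=> C CA; apply: lB; rewrite inE CA orbT.
pose U := \bigcup_(C <- A') C.
have cU : (#|U| <= t * size A)%N.
  apply: leq_trans (leq_card_bigcup _ _ _) _.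
  rewrite (big_nth set0) sA' big_nat; apply: (@leq_trans (\sum_(0 <= i < size A) t)).
    by rewrite [leqRHS]big_nat; apply: leq_sum => i /andP[_ /cA' ->].
  by rewrite sum_nat_const_nat subn0 mulnC.
have : (t <= #|B :\: U|)%N.
  have h1 := lB B (mem_head _ _); have h2 : (t * (size A).+1 <= t * m)%N by rewrite leq_mul2l sA orbT.
  have h3 : (#|B| <= #|B :\: U| + #|U|)%N.
    rewrite -(cardsID U B) addnC leq_add2l subset_leq_card //; exact: subsetIr.
  rewrite mulnS in h2; lia.
move=> tB; pose B' := [set x in take t (enum (B :\: U))].
have sB' : B' \subset B :\: U.
  by apply/subsetP => x; rewrite inE => /mem_take; rewrite mem_enum.
have dB i : [disjoint B' & nth set0 A' i].
  have [iA|iA] := ltnP i (size A'); last by rewrite nth_default // disjoint_sym disjoints_subset sub0set.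
  apply: disjointWl sB' _; rewrite disjoint_sym disjoints_subset setCD.
  apply: subset_trans (subsetUr _ _); rewrite /U bigcup_seq; apply: (bigcup_sup (nth set0 A' i)).
  exact: mem_nth.
exists (B' :: A'); split=> /=; first by rewrite sA'.
- by case=> [|i] //=; apply: subset_trans sB' (subsetDl _ _).
- case=> [|i] /=; last by rewrite ltnS; exact: cA'.
  move=> _; rewrite cardsE; have /card_uniqP -> := take_uniq t (enum_uniq (B :\: U)).
  by rewrite size_takel // -cardE.
case=> [|i] [|j] //= ij; first by rewrite disjoint_sym.
by apply: dA'.
Qed.

End Erdos.

Section Packing.
Variables (T U : finType) (G : sgraph T) (H : sgraph U).
Implicit Types (W : {set T}) (M : nat -> U -> {set T}).

Lemma connected_imset (V : finType) (K : sgraph V) (f : V -> T) (B : {set V}) :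
  (forall x y, x \in B -> y \in B -> adj K x y -> adj G (f x) (f y)) ->
  connected_in K B -> connected_in G (f @: B).
Proof.
move=> fa cB; have [x0 x0B] := connected_in_neq0 cB.
apply: (connected_in_root (x := f x0)); first exact: imset_f.
move=> _ /imsetP[y yB ->]; have /connectP[p] := connected_inP cB x0B yB.
elim/last_ind: p y yB => [|p z IHp] y yB; first by move=> _ /= ->; exact: connect0.
rewrite rcons_path last_rcons => /andP[pp /and3P[lB zB lz]] ->.
apply: connect_trans (IHp _ lB pp erefl) (connect1 _).
by rewrite /in_rel /= !imset_f // fa.
Qed.

Lemma sum_bigcup (I : finType) (B : I -> {set T}) (f : T -> nat) :
  (forall i j, i != j -> [disjoint B i & B j]) ->
  (\sum_(v in \bigcup_i B i) f v = \sum_i \sum_(v in B i) f v)%N.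
Proof.
move=> dB; rewrite [RHS](exchange_big_dep [in \bigcup_i B i]) /=; last first.
  by move=> i v _ vB; apply/bigcupP; exists i.
apply: eq_bigr => v /bigcupP[i _ vi]; rewrite (bigD1 i) //= big1 ?addn0 // => j /andP[vj ji].
by have /pred0P/(_ v) := dB j i ji; rewrite /= vj vi.
Qed.

Definition hpack W n M : Prop :=
  [/\ forall i, (i < n)%N -> jumbled_model G H (M i),
      forall i u, (i < n)%N -> M i u \subset W &
      forall i j u v, (i < n)%N -> (j < n)%N -> (i, u) != (j, v) ->
        [disjoint M i u & M j v]].

Lemma hpack_trunc W n n' M : (n' <= n)%N -> hpack W n M -> hpack W n' M.
Proof.
move=> le [h1 h2 h3]; split=> [i /leq_trans h|i u /leq_trans h|i j u v /leq_trans hi /leq_trans hj].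
- exact/h1/h.
- exact/h2/h.
by apply: h3; [exact: hi|exact: hj].
Qed.

Lemma hpack_sub W W' n M : W \subset W' -> hpack W n M -> hpack W' n M.
Proof.
by move=> sW [h1 h2 h3]; split=> // i u lt; apply: subset_trans sW; exact: h2.
Qed.

Lemma hpack_cat W1 W2 n1 n2 M1 M2 : [disjoint W1 & W2] ->
  hpack W1 n1 M1 -> hpack W2 n2 M2 ->
  hpack (W1 :|: W2) (n1 + n2) (fun i => if (i < n1)%N then M1 i else M2 (i - n1)%N).
Proof.
move=> dW [a1 a2 a3] [b1 b2 b3].
have lt i : (i < n1 + n2)%N -> ~~ (i < n1)%N -> (i - n1 < n2)%N by lia.
split=> [i h|i u h|i j u v hi hj].
- by case: ifP => [/a1//|/negbT/(lt _ h)/b1].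
- case: ifP => [h'|/negbT/(lt _ h) h'].
    exact: subset_trans (a2 i u h') (subsetUl _ _).
  exact: subset_trans (b2 _ u h') (subsetUr _ _).
case: ifP => [h1|/negbT h1]; case: ifP => [h2|/negbT h2].
- exact: a3.
- by move=> _; apply: disjointWl (a2 _ u h1) (disjointWr (b2 _ v (lt _ hj h2)) dW).
- rewrite disjoint_sym => _; apply: disjointWl (a2 _ v h2) (disjointWr (b2 _ u (lt _ hi h1)) dW).
move=> ne; apply: b3; rewrite ?lt //.
apply: contra ne => /eqP[e ->]; rewrite xpair_eqE eqxx andbT; apply/eqP.
by move: h1 h2; rewrite -!leqNgt => h1 h2; rewrite -(subnK h1) -(subnK h2) e.
Qed.

(** A fractional packing with weights [n_ i] over the common denominator t becomes integral: each
    use of a vertex x of S by a copy of a model receives its own vertex of [A x], and adjacency is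
    inherited because the blow-up is complete between adjacent classes. *)
Lemma blowup_hpack (m : nat) (S : sgraph 'I_m) (A : 'I_m -> {set T}) (t k : nat)
    (n_ : 'I_k -> nat) (mu : 'I_k -> U -> {set 'I_m}) :
  (forall i, jumbled_model S H (mu i)) ->
  (forall x, \sum_i n_ i * multiplicity (mu i) x <= t)%N ->
  (forall x, t <= #|A x|)%N ->
  (forall x y, x != y -> [disjoint A x & A y]) ->
  (forall x y a b, adj S x y -> a \in A x -> b \in A y -> adj G a b) ->
  exists M, hpack (\bigcup_x A x) (\sum_i n_ i) M.
Proof.
move=> jmu mult tA dA aA.
pose J : finType := {i : 'I_k & 'I_(n_ i)}.
have cJ : #|{: J}| = (\sum_i n_ i)%N.
  rewrite card_tagged sumnE big_map big_enum /=.
  by apply: eq_bigr => i _; rewrite card_ord.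
(* The uses of x: pairs of a copy of a model and a vertex of H whose branch set contains x. They are
   injected into [A x] by their rank. *)
pose Dm x : {set J * U} := [set p | x \in mu (tag p.1) p.2].
have cDm x : (#|Dm x| <= #|A x|)%N.
  apply: leq_trans (tA x); apply: leq_trans (mult x).
  have -> : (\sum_i n_ i * multiplicity (mu i) x = \sum_(i : 'I_k) \sum_(c : 'I_(n_ i)) multiplicity (mu i) x)%N.
    by apply: eq_bigr => i _; rewrite sum_nat_const card_ord.
  rewrite (sig_big_dep xpredT (fun i (_ : 'I_(n_ i)) => true) (fun i _ => multiplicity (mu i) x)) /=.
  rewrite -sum1_card; under eq_bigl do rewrite inE.
  rewrite -(pair_big_dep xpredT (fun (j : J) u => x \in mu (tag j) u) (fun _ _ => 1%N)) /=.
  by apply: leq_sum => j _; rewrite sum1_card /multiplicity cardsE.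
suff [M0 [M1 M2 M3]] : exists M0 : J -> U -> {set T}, [/\ forall j, jumbled_model G H (M0 j),
    forall j u, M0 j u \subset \bigcup_x A x & forall (j j' : J) (u u' : U), (j, u) != (j', u') -> [disjoint M0 j u & M0 j' u']].
  exists (fun i u => if insub i is Some o then M0 (enum_val (o : 'I_#|{: J}|)) u else set0).
  rewrite -cJ; split=> [i lt|i u lt|i j u v lti ltj].
  - by rewrite insubT.
  - by rewrite insubT.
  rewrite !insubT => ne; apply: M3; apply: contra ne; rewrite !xpair_eqE => /andP[/eqP e ->].
  by rewrite andbT; move/enum_val_inj: e => /(congr1 val) /= ->.
have [a0|T0] := pickP [pred a : T | true]; last first.
  have noJ (j : J) (u : U) : False.
    have [x xmu] := connected_in_neq0 ((jmu (tag j)).1 u).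
    have : (0 < #|Dm x|)%N by rewrite card_gt0; apply/set0Pn; exists (j, u); rewrite inE.
    move=> /leq_trans/(_ (cDm x)); rewrite card_gt0 => /set0Pn[a _].
    by have := T0 a.
  by exists (fun _ _ => set0); split=> [j|j u|j j' u]; [split=> u; case: (noJ j u)|case: (noJ j u)|case: (noJ j u)].
move=> _; pose io x (p : J * U) := nth a0 (enum (A x)) (index p (enum (Dm x))).
have lti x p : p \in Dm x -> (index p (enum (Dm x)) < size (enum (A x)))%N.
  by move=> pD; rewrite -cardE; apply: leq_trans (cDm x); rewrite cardE index_mem mem_enum.
have ioA x p : p \in Dm x -> io x p \in A x.
  by move=> pD; rewrite -mem_enum mem_nth ?lti.
have ioI x p q : p \in Dm x -> q \in Dm x -> io x p = io x q -> p = q.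
  move=> pD qD /eqP; rewrite nth_uniq ?lti ?enum_uniq // => /eqP e.
  by rewrite -(nth_index p (s := enum (Dm x)) (x := p)) ?mem_enum // e nth_index ?mem_enum.
exists (fun j u => [set io x (j, u) | x in mu (tag j) u]); split.
- move=> j; split=> [u|u v uv].
    apply: connected_imset ((jmu (tag j)).1 u) => x y xu yu xy.
    by apply: aA xy _ _; apply: ioA; rewrite inE.
  have [x [y [xu yv xy]]] := (jmu (tag j)).2 u v uv.
  exists (io x (j, u)), (io y (j, v)); split; [by apply/imsetP; exists x|by apply/imsetP; exists y|].
  by apply: aA xy _ _; apply: ioA; rewrite inE.
- move=> j u; apply/subsetP => _ /imsetP[x xu ->]; apply/bigcupP; exists x => //.
  by apply: ioA; rewrite inE.
move=> j j' u u' ne; apply/pred0P => a /=; apply/negP => /andP[/imsetP[x xu ->] /imsetP[y yu e]].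
have [xy|xy] := eqVneq x y.
  subst y; move: ne; rewrite (ioI x (j, u) (j', u')) ?eqxx ?inE //.
have /pred0P/(_ (io x (j, u))) := dA x y xy.
by rewrite /= ioA ?inE // e ioA ?inE.
Qed.

End Packing.

Lemma big_mkseq (V : Type) (idx : V) (op : V -> V -> V) (I : Type) (f : nat -> I) m (F : I -> V) :
  \big[op/idx]_(x <- mkseq f m) F x = \big[op/idx]_(i < m) F (f i).
Proof. by rewrite big_map -(big_mkord xpredT (F \o f)) /index_iota subn0. Qed.

(** * Removing models at a controlled loss of density *)

Section SamplingStep.
Variables (R : realType) (U : finType) (H : sgraph U).
Local Open Scope ring_scope.

(* Equivalent to [frac_extremal R H <= B]; the slack [eta] replaces the supremum in [vol]. *)
Definition frac_pack_bound (B : R) : Prop :=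
  forall m (S : sgraph 'I_m) (eta : R), (0 < m)%N -> 0 < eta ->
  exists (k : nat) (alpha : 'I_k -> R) (mu : 'I_k -> U -> {set 'I_m}),
    [/\ forall i, 0 <= alpha i, forall i, jumbled_model S H (mu i),
        forall x, \sum_(i < k) alpha i * (multiplicity (mu i) x)%:R <= 1 &
        density R S - eta <= B * \sum_(i < k) alpha i].

(** Rounding t times each weight down loses at most 1 per model. The number [kS] of models is fixed
    before t, so the loss becomes negligible for large t. *)
Lemma frac_pack_blowup (B : R) m (S : sgraph 'I_m) (eta : R) : 0 <= B ->
  frac_pack_bound B -> (0 < m)%N -> 0 < eta ->
  exists kS : nat, forall t : nat, exists2 ka : nat,
    t%:R * (density R S - eta) - B * kS%:R <= B * ka%:R &
    forall (T : finType) (G : sgraph T) (A : 'I_m -> {set T}),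
      (forall x, t <= #|A x|)%N ->
      (forall x y, x != y -> [disjoint A x & A y]) ->
      (forall x y a b, adj S x y -> a \in A x -> b \in A y -> adj G a b) ->
      exists M, hpack G H (\bigcup_x A x) ka M.
Proof.
move=> B0 pk m0 eta0; have [k [al [mu [al0 jmu mult dS]]]] := pk m S eta m0 eta0.
exists k => t; pose n_ i := Num.truncn (t%:R * al i).
have tal0 i : 0 <= t%:R * al i by rewrite mulr_ge0 ?ler0n.
exists (\sum_i n_ i)%N; last first.
  move=> T G A tA dA aA; apply: blowup_hpack tA dA aA => // x.
  rewrite -(ler_nat R) natr_sum -[leRHS]mulr1.
  apply: le_trans (ler_wpM2l (ler0n R t) (mult x)); rewrite mulr_sumr; apply: ler_sum => i _.
  by rewrite natrM mulrA ler_wpM2r ?ler0n // truncn_le.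
have : t%:R * (\sum_i al i) - k%:R <= (\sum_i n_ i)%:R.
  rewrite natr_sum mulr_sumr -[k in _ - k%:R]card_ord -sum1_card natr_sum -sumrB.
  by apply: ler_sum => i _; rewrite lerBlDr natr1; apply/ltW/truncnS_gt.
move=> /(ler_wpM2l B0); apply: le_trans; rewrite [leRHS]mulrBr lerD2r mulrCA.
by rewrite ler_wpM2l ?ler0n.
Qed.

(** A blow-up P of S with classes of size t is removed. The loss of arcs is governed by the degree
    sum over P, the number of models gained by the density of S. On average over random sequences
    the former is covered by the latter, and positivity of the mean of [g] yields a positive
    proportion of good sequences. *)
Lemma extract_step (B eps C : R) : 0 <= B -> frac_pack_bound B ->
  0 < eps -> eps <= 1 -> 0 < C -> exists K n0 : nat,
  forall (T : finType) (G : sgraph T) (W : {set T}) (D : R), (n0 < #|W|)%N ->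
    (arcs G W W)%:R = 2 * D * #|W|%:R -> #|W|%:R <= C * D ->
    exists ka M (P : {set T}), [/\ (ka <= K)%N, P \subset W, (P != set0) && (W :\: P != set0), hpack G H P ka M &
      2 * (D - (1 + eps) * (B * ka%:R)) * #|W :\: P|%:R <= (arcs G (W :\: P) (W :\: P))%:R].
Proof.
move=> B0 pk e0 e1 C0.
(* Large enough that (1 + eps)(m - 1) >= (1 + eps/2) m: half of eps pays for the missing diagonal
   pairs. *)
pose m := (Num.truncn (2 * (1 + eps) / eps)).+1.
have mR : 2 * (1 + eps) <= m%:R * eps by rewrite -ler_pdivrMr //; apply/ltW/truncnS_gt.
have m0 : 0 < m%:R :> R by rewrite ltr0n.
(* Makes the error 2 (1 + eps) eta |W| at most D m eps / 8, because |W| <= C D. *)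
pose eta : R := m%:R * eps / (32 * C).
have eta0 : 0 < eta by rewrite /eta divr_gt0 ?mulr_gt0.
have etaE : eta * (32 * C) = m%:R * eps by rewrite divfK // gt_eqF // mulr_gt0.
move: eta eta0 etaE => eta eta0 etaE.
have [kS hkS] := choice (fun S : sgraph 'I_m => frac_pack_blowup S B0 pk (ltn0Sn _) eta0).
pose kk := (\sum_S kS S)%N.
(* Rounding costs at most B kk <= t eta for every S at once; together with the slack eta of the
   packing this explains the 2 eta in [g]. *)
pose t := (Num.truncn (B * kk%:R / eta)).+1.
have tR : B * kk%:R <= t%:R * eta by rewrite -ler_pdivrMr //; apply/ltW/truncnS_gt.
have t0 : 0 < t%:R :> R by rewrite ltr0n.
have /choice[ka hka] : forall S, exists kaS : nat, t%:R * (density R S - eta) - B * (kS S)%:R <= B * kaS%:R /\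
    forall (T : finType) (G : sgraph T) (A : 'I_m -> {set T}),
      (forall x, t <= #|A x|)%N ->
      (forall x y, x != y -> [disjoint A x & A y]) ->
      (forall x y a b, adj S x y -> a \in A x -> b \in A y -> adj G a b) ->
      exists M, hpack G H (\bigcup_x A x) kaS M.
  by move=> S; have [kaS ? ?] := hkS S t; exists kaS.
(* The mean D m eps / 8 divided by the maximum 2 m |W|, using |W| <= C D. *)
pose dl : R := eps / (16 * C).
have dl0 : 0 < dl by rewrite divr_gt0 ?mulr_gt0.
pose c := #|{: sgraph 'I_m}|.
have c0 : 0 < c%:R :> R.
  by rewrite ltr0n; apply/card_gt0P; exists (mkgraph (fun _ _ => false)).
have [N0 hN0] := erdos_blowup m (t * m) (divr_gt0 dl0 c0).
exists (\sum_S ka S)%N, (maxn N0 (Num.truncn (8 * (t * m)%:R / eps)).+1) => T G W D.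
rewrite gtn_max => /andP[WN0 Wt] eA NC.
have W0 : W != set0 by rewrite -card_gt0; apply: leq_ltn_trans WN0.
have [x0 x0W] := set0Pn _ W0.
set N : R := #|W|%:R in eA NC.
have NR : 0 < N by rewrite ltr0n card_gt0.
have tmN : 8 * (t * m)%:R <= eps * N.
  rewrite [leRHS]mulrC -ler_pdivrMr //; apply/ltW/(lt_le_trans (truncnS_gt _)); rewrite /N ler_nat; exact: ltnW Wt.
pose tau : R := (t * m)%:R; rewrite -/tau in tmN.
have D0 : 0 < D by rewrite -(pmulr_rgt0 _ C0); exact: lt_le_trans NC.
have D2 : 2 * D <= N.
  by rewrite -(ler_pM2r NR) -eA -expr2 -natrX ler_nat; apply: leq_trans (arcs_le _ _ _) _; rewrite mulnn.
pose dg x := deg_in G W x.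
pose a (s : seq T) : R := \sum_(x <- s) \sum_(y <- s) (adj G x y)%:R.
(* As [a s] is 2 m times the density of the graph S spanned by s, [g s >= 0] bounds the degree sum
   of s by D m + (1 + eps)(density S - 2 eta)(N - tau). Multiplied by t, this is exactly what the
   conclusion needs. *)
pose g (s : seq T) : R := (D * m%:R - 2 * (1 + eps) * eta * (N - tau)) +
   ((1 + eps) / (2 * m%:R) * (N - tau) * a s + (-1) * \sum_(x <- s) (dg x)%:R).
have avgdg : avg W (fun x => (dg x)%:R) = 2 * D.
  by rewrite /avg -natr_sum -[(\sum_(_ in _) _)%N]/(arcs G W W) eA mulfK // gt_eqF.
have avgadj : avg W (fun x => avg W (fun y => (adj G x y)%:R)) = 2 * D / N.
  rewrite -avgdg mulrC -avgZ; apply: eq_avg => x _.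
  by rewrite /avg -natr_sum -deg_inE mulrC.
have meang : mean W m g = (D * m%:R - 2 * (1 + eps) * eta * (N - tau)) +
    ((1 + eps) * (N - tau) * (m%:R - 1) * D / N - m%:R * (2 * D)).
  rewrite meanD mean_cst // meanD !meanZ mean_linear // avgdg mean_pairs //; first last.
  - by move=> x y; rewrite adjC.
  - by move=> x; rewrite adjxx.
  rewrite avgadj mulN1r; congr (_ + (_ - _)); field.
  by rewrite !gt_eqF.
have tau0 : 0 <= tau by rewrite ler0n.
have tauN : 0 <= N - tau by nra.
have mean_ge : D * m%:R * eps / 8 <= mean W m g.
  rewrite meang.
  have h1 : 2 * (1 + eps) * eta * (N - tau) <= D * m%:R * eps / 8.
    have -> : D * m%:R * eps / 8 = 4 * eta * (C * D).
      by have := congr1 (fun x => x * D / 8) etaE; clear; lra.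
    apply: (@le_trans _ _ (4 * eta * N)); last by rewrite ler_wpM2l // mulr_ge0 ?ltW.
    have e2 : 0 <= 1 + eps by clear -e0; lra.
    apply: ler_pM => //; [exact: mulr_ge0 (mulr_ge0 (ler0n R 2) e2) (ltW eta0)| |clear -tau0; lra].
    by rewrite ler_wpM2r ?(ltW eta0) //; clear -e1; lra.
  have h2 : (1 + eps / 4) * m%:R * D <= (1 + eps) * (N - tau) * (m%:R - 1) * D / N.
    rewrite ler_pdivlMr //.
    have -> : (1 + eps / 4) * m%:R * D * N = D * (m%:R * ((1 + eps / 4) * N)) by ring.
    have -> : (1 + eps) * (N - tau) * (m%:R - 1) * D = D * (((1 + eps) * (m%:R - 1)) * (N - tau)) by ring.
    rewrite ler_pM2l //.
    apply: (@le_trans _ _ (((1 + eps / 2) * m%:R) * (N - tau))); last first.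
      by rewrite ler_wpM2r //; clear -mR m0 e0; lra.
    rewrite [(1 + eps / 2) * _]mulrC -mulrA ler_pM2l //.
    have : (1 + eps / 2) * tau <= (1 + eps / 2) * (eps / 8 * N) by rewrite ler_wpM2l //; clear -e0 tmN; lra.
    move=> h; have := mulr_ge0 (mulr_ge0 (ltW e0) (ltW NR)) (_ : 0 <= 1 - eps); rewrite subr_ge0 => /(_ e1); clear -h tmN tau0; lra.
  clear -h1 h2; lra.
have g_le s : size s = m -> all [in W] s -> g s <= 2 * m%:R * N.
  move=> sm sW; rewrite /g.
  have am : a s <= m%:R * m%:R.
    have aE : a s <= \sum_(x <- s) \sum_(y <- s) 1.
      by apply: ler_sum => x _; apply: ler_sum => y _; case: adj; rewrite ?ler01.
    apply: le_trans aE _; rewrite !big_const_seq !count_predT sm !iter_addr_0.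
    by rewrite -mulrnA -natrM.
  have a0 : 0 <= a s by rewrite sumr_ge0 // => x _; rewrite sumr_ge0.
  have s0 : 0 <= \sum_(x <- s) (dg x)%:R :> R by rewrite sumr_ge0.
  have h1 : (1 + eps) / (2 * m%:R) * (N - tau) * a s <= m%:R * N.
    have -> : (1 + eps) / (2 * m%:R) * (N - tau) * a s = ((1 + eps) / 2) * (N - tau) * (a s / m%:R).
      by field; rewrite gt_eqF.
    have am' : a s / m%:R <= m%:R by rewrite ler_pdivrMr.
    have h : ((1 + eps) / 2) * (N - tau) <= N.
      by apply: le_trans (_ : 1 * (N - tau) <= _); [rewrite ler_wpM2r //; clear -e1; lra|clear -tau0; lra].
    rewrite mulrC; apply: ler_pM => //; first by rewrite divr_ge0 // ltW.
    by rewrite mulr_ge0 //; clear -e0; lra.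
  have e2 : 0 <= 1 + eps by clear -e0; lra.
  have h2 : 0 <= 2 * (1 + eps) * eta * (N - tau).
    exact: mulr_ge0 (mulr_ge0 (mulr_ge0 (ler0n R 2) e2) (ltW eta0)) tauN.
  have h3 : D * m%:R <= m%:R * N by rewrite mulrC ler_wpM2l //; clear -D2 D0; lra.
  rewrite mulN1r; clear -h1 h2 h3 s0; lra.
have := mean_pos_part (M := 2 * m%:R * N) (mu := D * m%:R * eps / 8) _ g_le mean_ge.
rewrite !mulr_gt0 // => /(_ isT) mQ.
have {}mQ : dl <= mean W m (fun s => ((0 <= g s)%R)%:R).
  apply: le_trans mQ; rewrite /dl.
  have -> : D * m%:R * eps / 8 / (2 * m%:R * N) = eps / 16 * (D / N) by field; rewrite !gt_eqF.
  have -> : eps / (16 * C) = eps / 16 * C^-1 by field; rewrite gt_eqF.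
  rewrite ler_pM2l ?divr_gt0 // ler_pdivlMr // mulrC ler_pdivrMr // mulrC //.
pose Sg s : sgraph 'I_m := mkgraph (fun i j : 'I_m => adj G (nth x0 s i) (nth x0 s j)).
(* Pigeonhole over the graphs on m vertices, so that all transversals found span the same S. *)
have [S _ hS] : exists2 S, true & dl / c%:R <= mean W m (fun s => ((0 <= g s)%R && (Sg s == S))%:R).
  apply: sum_pigeonhole => //; first by rewrite cardsT.
  rewrite -mean_sum //; apply: le_trans mQ _; apply: ler_mean => s _ _.
  rewrite (bigD1 (Sg s)) //= eqxx andbT lerDl sumr_ge0 //.
have [A [sA AW AQ]] := hN0 T W _ W0 (ltnW WN0) hS.
have [||A' [sA' subA' cA' dA']] := disjoint_subsets (t := t) (m := m) (A := A).
- by rewrite sA.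
- by move=> Y /AW[].
rewrite sA in sA' cA'.
(* The transversal of maximal degrees: t times its degree sum bounds the degree sum of all of P. *)
have /choice[pk' hpk'] : forall i, exists x, (i < m)%N -> x \in nth set0 A' i /\
    forall y, y \in nth set0 A' i -> (dg y <= dg x)%N.
  move=> i; have [im|mi] := ltnP i m; last by exists x0.
  have : (0 < #|nth set0 A' i|)%N by rewrite cA'.
  move=> /card_gt0P[y0 y0A]; case: (arg_maxnP dg y0A) => x xA xm.
  by exists x => _; split.
have A'Q (f : nat -> T) : (forall i, (i < m)%N -> f i \in nth set0 A' i) -> 
    (0 <= g (mkseq f m)) && (Sg (mkseq f m) == S).
  move=> fA; apply: AQ; rewrite all2E size_mkseq sA eqxx /=; apply/(all_nthP (x0, set0)) => i.
  rewrite size_zip size_mkseq sA minnn => im.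
  rewrite nth_zip ?size_mkseq ?sA //= nth_mkseq //.
  exact: subsetP (subA' i) _ (fA i im).
pose B' (x : 'I_m) := nth set0 A' x.
pose P := \bigcup_x B' x.
have PW : P \subset W.
  apply/bigcupsP => x _; apply: subset_trans (subA' x) _.
  by have [] := AW (nth set0 A x) (mem_nth _ _); rewrite ?sA.
have cB x : #|B' x| = t by rewrite /B' cA'.
have dB x y : x != y -> [disjoint B' x & B' y] by move=> xy; apply: dA'.
have cP : #|P| = (t * m)%N.
  rewrite -sum1_card sum_bigcup //.
  under eq_bigr do rewrite sum1_card cB.
  by rewrite sum_nat_const card_ord mulnC.
have tne x : B' x != set0 by rewrite -card_gt0 cB.
have Sg_adj s (i j : 'I_m) : adj (Sg s) i j = adj G (nth x0 s i) (nth x0 s j).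
  rewrite adj_mkgraph [X in _ && (_ || X)]adjC orbb.
  by case: eqP => // ->; rewrite adjxx.
have adjB x y u v : adj S x y -> u \in B' x -> v \in B' y -> adj G u v.
  move=> xy ux vy; have nxy := adj_neq xy.
  (* A transversal through u and v: it spans S, so u and v are adjacent whenever x and y are. *)
  pose f i := if i == x :> nat then u else if i == y :> nat then v else pk' i.
  have /andP[_ /eqP Sf] : (0 <= g (mkseq f m)) && (Sg (mkseq f m) == S).
    apply: A'Q => i im; rewrite /f; case: eqP => [->//|_]; case: eqP => [->//|_].
    by have [] := hpk' i im.
  move: xy; rewrite -Sf Sg_adj !nth_mkseq // /f !eqxx.
  by rewrite [_ == _ :> nat]eq_sym; case: eqP => // /ord_inj e; rewrite e eqxx in nxy.
have tB x : (t <= #|B' x|)%N by rewrite cB.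
have [dka hM] := hka S; have [M hMM] := hM T G B' tB dB adjB.
exists (ka S), M, P; split=> //.
- by rewrite (bigD1 S) //= leq_addr.
- rewrite -!card_gt0 cP muln_gt0 /= cardsD (setIidPr PW) cP subn_gt0 -(ltr_nat R) -/tau -/N.
  by apply: le_lt_trans (_ : eps * N / 8 < _); [clear -tmN; lra|have := ler_wpM2r (ltW NR) e1; clear -NR; lra].
have /andP[gpk /eqP Spk] : (0 <= g (mkseq pk' m)) && (Sg (mkseq pk' m) == S).
  by apply: A'Q => i im; have [] := hpk' i im.
have sumdg : (\sum_(v in P) dg v <= t * \sum_(x <- mkseq pk' m) dg x)%N.
  rewrite sum_bigcup // big_mkseq big_distrr /=; apply: leq_sum => x _.
  rewrite -(cB x) -sum_nat_const; apply: leq_sum => v vB.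
  by have [_] := hpk' x (ltn_ord x); apply.
have aS : a (mkseq pk' m) = 2 * m%:R * density R S.
  rewrite /density card_ord -mulrA [m%:R * _]mulrC divfK ?gt_eqF // -natrM -arcsT /arcs.
  rewrite -Spk /a big_mkseq natr_sum; apply: eq_big => [i|i _]; first by rewrite inE.
  rewrite big_mkseq deg_inE natr_sum; apply: eq_big => [j|j _]; first by rewrite inE.
  by rewrite Sg_adj !nth_mkseq.
have key : t%:R * \sum_(x <- mkseq pk' m) (dg x)%:R <=
    D * tau + (1 + eps) * (B * (ka S)%:R) * (N - tau).
  move: gpk; rewrite /g aS mulN1r => gpk.
  have h : \sum_(x <- mkseq pk' m) (dg x)%:R <= D * m%:R + (1 + eps) * (density R S - 2 * eta) * (N - tau).
    have : (1 + eps) / (2 * m%:R) * (N - tau) * (2 * m%:R * density R S) = (1 + eps) * density R S * (N - tau).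
      by field; rewrite gt_eqF.
    move=> e; rewrite e in gpk; clear -gpk; lra.
  apply: le_trans (ler_wpM2l (ltW t0) h) _.
  rewrite mulrDr /tau natrM; apply: lerD; first by rewrite mulrCA.
  rewrite -natrM -/tau.
  have -> : t%:R * ((1 + eps) * (density R S - 2 * eta) * (N - tau)) = ((1 + eps) * (N - tau)) * (t%:R * (density R S - 2 * eta)) by ring.
  have -> : (1 + eps) * (B * (ka S)%:R) * (N - tau) = ((1 + eps) * (N - tau)) * (B * (ka S)%:R) by ring.
  apply: ler_wpM2l; first by rewrite mulr_ge0 //; clear -e0; lra.
  apply: le_trans dka; have : B * (kS S)%:R <= t%:R * eta.
    by apply: le_trans tR; rewrite ler_wpM2l // ler_nat /kk (bigD1 S) //= leq_addr.
  clear; lra.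
have cWP : #|W :\: P|%:R = N - tau :> R.
  by rewrite cardsD (setIidPr PW) natrB ?subset_leq_card // cP.
rewrite cWP.
have := arcsD G PW; rewrite -(ler_nat R) natrD natrM eA => h.
have : (arcs G P W)%:R <= t%:R * \sum_(x <- mkseq pk' m) (dg x)%:R :> R.
  by rewrite -natr_sum -natrM ler_nat.
rewrite /N in h *; move=> h2; clear -h h2 key; lra.
Qed.

End SamplingStep.

Section IteratedSampling.
Variable R : realType.
Local Open Scope ring_scope.

(** [extract_step] is iterated. The last round may produce up to K models too many, hence [c0 = K]
    in the cost. A round may also produce none, so the induction is on |W|. The floor [Dlow] keeps
    |W| <= C D valid in all rounds. *)
Lemma extract_copies (U : finType) (H : sgraph U) (B eps C : R) : 0 <= B -> frac_pack_bound H B ->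
  0 < eps -> eps <= 1 -> 0 < C -> exists c0 n0 : nat,
  forall (T : finType) (G : sgraph T) (W : {set T}) (D Dlow : R) (k : nat),
    W != set0 -> 2 * D * #|W|%:R <= (arcs G W W)%:R -> #|W|%:R <= C * Dlow -> n0%:R < Dlow ->
    Dlow <= D - (1 + eps) * (B * (k + c0)%:R) ->
    exists M (W' : {set T}), [/\ W' \subset W, W' != set0, hpack G H (W :\: W') k M &
      2 * (D - (1 + eps) * (B * (k + c0)%:R)) * #|W'|%:R <= (arcs G W' W')%:R].
Proof.
move=> B0 pk e0 e1 C0; have [K [n0 step]] := extract_step B0 pk e0 e1 C0.
exists K, n0 => T G W D Dlow k; have [n] := ubnP #|W|.
elim: n W D k => // n IH W D k; rewrite ltnS => Wn W0 WD WC nD Dl.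
have eB : 0 <= (1 + eps) * B by rewrite mulr_ge0 //; lra.
have [k0|k0] := posnP k.
  exists (fun _ _ => set0), W; split=> //; first by rewrite k0; split.
  apply: le_trans WD; rewrite ler_wpM2r ?ler0n // ler_wpM2l //.
  by rewrite gerBl mulrA mulr_ge0.
have N0 : 0 < #|W|%:R :> R by rewrite ltr0n card_gt0.
(* The step takes the exact density, which is at least D. *)
pose D1 : R := (arcs G W W)%:R / (2 * #|W|%:R).
have D1E : (arcs G W W)%:R = 2 * D1 * #|W|%:R by rewrite /D1; field; rewrite gt_eqF.
have DD1 : D <= D1 by rewrite ler_pdivlMr ?mulr_gt0 //; lra.
have DlD : Dlow <= D.
  by apply: le_trans Dl _; rewrite gerBl mulrA mulr_ge0.
have D1N : 2 * D1 <= #|W|%:R.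
  by rewrite -(ler_pM2r N0) -D1E -expr2 -natrX ler_nat; apply: leq_trans (arcs_le _ _ _) _; rewrite mulnn.
have nW : (n0 < #|W|)%N by rewrite -(ltr_nat R); have := ler0n R n0; lra.
have WC1 : #|W|%:R <= C * D1 by apply: le_trans WC _; rewrite ler_pM2l //; lra.
have [ka [M [P [kaK PW /andP[P0 WP0] hM aP]]]] := step T G W D1 nW D1E WC1.
have WDP : W :\: (W :\: P) = P.
  by apply/setP => x; rewrite !inE; case: (boolP (x \in P)) => [/(subsetP PW)->|]; rewrite ?andbN //= ?negbK andNb.
have [kka|kak] := leqP k ka.
  exists M, (W :\: P); split=> //; first exact: subsetDl.
    by rewrite WDP; exact: hpack_trunc hM.
  apply: le_trans aP; rewrite ler_wpM2r ?ler0n // ler_wpM2l //.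
  by rewrite lerB // !mulrA ler_wpM2l // ler_nat; exact: leq_trans kaK (leq_addl _ _).
have ltWP : (#|W :\: P| < n)%N.
  apply: leq_trans Wn; apply: proper_card; rewrite properE subsetDl /=.
  have /set0Pn[x xP] := P0; apply/subsetPn; exists x; first exact: (subsetP PW).
  by rewrite inE xP.
have kE : (k - ka + K)%:R = (k + K)%:R - ka%:R :> R.
  by rewrite -natrB ?(leq_trans (ltnW kak) (leq_addr _ _)) // addnBAC // ltnW.
have [||||M' [W' [sW' W'0 hM' aW']]] := IH (W :\: P) (D - (1 + eps) * (B * ka%:R)) (k - ka)%N ltWP WP0.
- by apply: le_trans aP; rewrite ler_wpM2r ?ler0n // ler_wpM2l // lerB.
- apply: le_trans WC; rewrite ler_nat subset_leq_card //; exact: subsetDl.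
- exact: nD.
- by rewrite kE; lra.
exists (fun i => if (i < ka)%N then M i else M' (i - ka)%N), W'; split=> //.
- exact: subset_trans sW' (subsetDl _ _).
- rewrite -(subnKC (ltnW kak)); apply: (hpack_sub (W := P :|: ((W :\: P) :\: W'))).
    apply/subsetP => x; rewrite !inE => /orP[xP|/and3P[-> _ ->] //].
    rewrite (subsetP PW) // andbT; apply: contraTN xP => /(subsetP sW').
    by rewrite inE => /andP[].
  apply: hpack_cat => //; rewrite disjoints_subset; apply/subsetP => x xP.
  by rewrite !inE xP andbF.
apply: le_trans aW'; rewrite kE; lra.
Qed.

(** Labelled graphs on initial segments stand for isomorphism types. Isomorphic ones are kept apart,
    which is harmless since there are finitely many of each order. *)
Definition gtype := {h : nat & sgraph 'I_h}.

(* Models are indexed by natural numbers to keep the statement free of dependent types. *)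
Lemma extract_types (B eps C : R) (t0 : gtype) (ts : seq gtype) : 0 <= B ->
  (forall i, (i < size ts)%N ->
     frac_pack_bound (tagged (nth t0 ts i)) (B * (tag (nth t0 ts i))%:R)) ->
  0 < eps -> eps <= 1 -> 0 < C -> exists c0 n0 : nat,
  forall (T : finType) (G : sgraph T) (W : {set T}) (D Dlow : R) (ks : seq nat),
    size ks = size ts ->
    W != set0 -> 2 * D * #|W|%:R <= (arcs G W W)%:R -> #|W|%:R <= C * Dlow -> n0%:R < Dlow ->
    Dlow + (1 + eps) * B * \sum_(i < size ts) ((tag (nth t0 ts i)) * (nth 0 ks i + c0))%:R <= D ->
    exists (M : nat -> nat -> nat -> {set T}) (V : nat -> {set T}),
      [/\ forall i, (i < size ts)%N -> V i \subset W,
          forall i j, (i < size ts)%N -> (j < size ts)%N -> i != j -> [disjoint V i & V j] &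
          forall i, (i < size ts)%N ->
            hpack G (tagged (nth t0 ts i)) (V i) (nth 0 ks i)
              (fun c (u : 'I_(tag (nth t0 ts i))) => M i c u)].
Proof.
move=> B0 pk e0 e1 C0; elim: ts pk => [|t ts IH] pk.
  exists 0%N, 0%N => T G W D Dlow ks _ _ _ _ _ _.
  by exists (fun _ _ _ => set0), (fun _ => set0); split.
have [c1 [n1 h1]] := IH (fun i => pk i.+1).
have Bt : 0 <= B * (tag t)%:R by rewrite mulr_ge0.
have [c2 [n2 h2]] := extract_copies Bt (pk 0%N isT) e0 e1 C0.
exists (c1 + c2)%N, (n1 + n2)%N => T G W D Dlow [|k ks] //= [sk] W0 WD WC nD.
have nD1 : n1%:R < Dlow by apply: le_lt_trans nD; rewrite ler_nat leq_addr.
have nD2 : n2%:R < Dlow by apply: le_lt_trans nD; rewrite ler_nat leq_addl.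
rewrite big_ord_recl /= => hD.
have eB : 0 <= (1 + eps) * B by rewrite mulr_ge0 //; lra.
set s1 := \sum_(i < size ts) ((tag (nth t0 ts i)) * (nth 0 ks i + c1))%:R : R.
set s2 := \sum_(i < size ts) _ in hD.
have s12 : s1 <= s2.
  apply: ler_sum => i _; by rewrite ler_nat /= leq_mul2l leq_add2l leq_addr orbT.
have s10 : 0 <= s1 by rewrite sumr_ge0.
have h4 : (1 + eps) * B * s1 <= (1 + eps) * B * s2 by rewrite ler_wpM2l.
have h3 : (1 + eps) * (B * (tag t)%:R * (k + c2)%:R) <= (1 + eps) * B * (tag t * (k + (c1 + c2)))%:R.
  have -> : (1 + eps) * (B * (tag t)%:R * (k + c2)%:R) = (1 + eps) * B * (tag t * (k + c2))%:R.
    by rewrite natrM; ring.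
  by rewrite ler_wpM2l // ler_nat leq_mul2l leq_add2l leq_addl orbT.
have h5 : 0 <= (1 + eps) * B * s1 by rewrite mulr_ge0.
have [|||||M [W' [sW' W'0 hM aW']]] := h2 T G W D Dlow k => //.
  by move: hD; rewrite mulrDr; lra.
have [||||M' [V' [sV' dV' hV']]] := h1 T G W' (D - (1 + eps) * (B * (tag t)%:R * (k + c2)%:R)) Dlow ks sk W'0 => //.
- by apply: le_trans WC; rewrite ler_nat subset_leq_card.
- by move: hD; rewrite mulrDr -/s1; lra.
exists (fun i c u => if i is i'.+1 then M' i' c u else
   if insub u is Some u' then M c (u' : 'I_(tag t)) else set0).
exists (fun i => if i is i'.+1 then V' i' else W :\: W'); split.
- by case=> [_|i /sV' s]; [exact: subsetDl|exact: subset_trans s sW'].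
- have dW i : (i < size ts)%N -> [disjoint V' i & W :\: W'].
    move=> /sV' s; apply: disjointWl s _; rewrite disjoint_sym disjoints_subset.
    by apply/subsetP => x; rewrite !inE => /andP[].
  move=> [|i] [|j] //= li lj ij; first by rewrite disjoint_sym dW.
    exact: dW.
  exact: dV'.
case=> [_|i li] /=; last exact: hV'.
have eM c (u : 'I_(tag t)) : (if insub (u : nat) is Some u' then M c (u' : 'I_(tag t)) else set0) = M c u.
  by rewrite valK.
have [a1 a2 a3] := hM; split=> [c lc|c u lc|c d u v lc ld ne].
- rewrite (_ : (fun _ => _) = M c); first exact: a1.
  by apply/funext => u.
- by rewrite eM; exact: a2.
by rewrite !eM; exact: a3.
Qed.

End IteratedSampling.

(** * Reserve sets *)

Section Reserve.
Variable R : realType.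
Local Open Scope ring_scope.

Lemma expr_bernoulli (x : R) n : 0 <= x -> x <= 1 -> (1 - x) ^+ n * (1 + n%:R * x) <= 1.
Proof.
move=> x0 x1; elim: n => [|n IH]; first by rewrite expr0 mul0r addr0 mulr1.
apply: le_trans IH; rewrite exprSr -mulrA ler_wpM2l //; first by rewrite exprn_ge0 // subr_ge0.
rewrite -natr1; have : 0 <= (n%:R + 1) * x * x by rewrite !mulr_ge0 // addr_ge0.
lra.
Qed.

Lemma exists_expr_le (x y : R) : 0 < x -> x <= 1 -> 0 < y -> exists K, (1 - x) ^+ K <= y.
Proof.
move=> x0 x1 y0; exists (Num.truncn (1 / (x * y))).+1; set K := _.+1.
have xy : 0 < x * y by rewrite mulr_gt0.
have hK : 1 <= K%:R * (x * y) by rewrite -ler_pdivrMr //; apply/ltW/truncnS_gt.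
have h := expr_bernoulli K (ltW x0) x1.
have p0 : 0 < 1 + K%:R * x by rewrite ltr_wpDr // mulr_ge0 // ltW.
rewrite -(ler_pM2r p0); apply: le_trans h _; rewrite mulrDr mulr1; lra.
Qed.

(** First-moment argument with an exponential weight: under a random q-colouring the mean of
    2^(-count) over a set of size s is (1 - 1/(2q))^s. *)
Lemma good_partition (V I : finType) (S : I -> {set V}) (q w th : nat) : (0 < q)%N ->
  (forall i, (th <= #|S i|)%N) ->
  (#|I| * q * 2 ^ w)%:R * (1 - 1 / (2 * q%:R)) ^+ th < 1 :> R ->
  exists f : {ffun V -> 'I_q}, forall i c, (w < #|[set v in S i | f v == c]|)%N.
Proof.
move=> q0 thS lt1; have q0R : 0 < q%:R :> R by rewrite ltr0n.
have q1R : 1 <= q%:R :> R by rewrite ler1n.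
pose y : R := 1 - 1 / (2 * q%:R).
have y0 : 0 <= y by rewrite subr_ge0 ler_pdivrMr ?mulr_gt0 //; lra.
have y1 : y <= 1 by rewrite gerBl divr_ge0 // mulr_ge0.
pose g i (c : 'I_q) v (d : 'I_q) : R := if (v \in S i) && (d == c) then 1 / 2 else 1.
(* Each term is 2^(w - count), so it is at least 1 as soon as a count is at most w; a colouring with
   [Phi f < 1] has no such count. *)
pose Phi (f : {ffun V -> 'I_q}) : R := \sum_i \sum_c 2 ^+ w * \prod_v g i c v (f v).
have prodE i c (f : {ffun V -> 'I_q}) : \prod_v g i c v (f v) = (1 / 2) ^+ #|[set v in S i | f v == c]|.
  rewrite -prodr_const [RHS]big_mkcond; apply: eq_bigr => v _.
  by rewrite /g inE.
have sumPhi : \sum_f Phi f <= (q ^ #|V|)%:R * ((#|I| * q * 2 ^ w)%:R * y ^+ th).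
  rewrite /Phi exchange_big /=.
  have termE i c : \sum_(f : {ffun V -> 'I_q}) 2 ^+ w * \prod_v g i c v (f v) <= 2 ^+ w * ((q ^ #|V|)%:R * y ^+ th).
    rewrite -mulr_sumr ler_wpM2l ?exprn_ge0 // -bigA_distr_bigA /=.
    have sumg v : \sum_d g i c v d = q%:R * (if v \in S i then y else 1).
      rewrite (bigD1 c) //= /g eqxx andbT.
      have -> : \sum_(d | d != c) (if (v \in S i) && (d == c) then 1 / 2 else 1) = q%:R - 1 :> R.
        rewrite (eq_bigr (fun _ => 1)); last by move=> d /negPf ->; rewrite andbF.
        rewrite sumr_const cardC1 card_ord -subn1 natrB //.
      case: ifP => _; last by ring.
      by rewrite /y; field; rewrite gt_eqF.
    rewrite (eq_bigr _ (fun v _ => sumg v)) big_split /= prodr_const natrX.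
    rewrite ler_wpM2l ?exprn_ge0 //.
    rewrite -big_mkcond /= prodr_const.
    by apply: ler_wiXn2l; rewrite ?y0 ?y1.
  apply: (@le_trans _ _ (\sum_(i : I) \sum_(c : 'I_q) 2 ^+ w * ((q ^ #|V|)%:R * y ^+ th))).
    apply: ler_sum => i _; rewrite exchange_big /=; apply: ler_sum => c _; exact: termE.
  rewrite !sumr_const card_ord -[leLHS]mulr_natr -[X in X * _ <= _]mulr_natr !natrM (natrX _ 2) le_eqVlt; apply/orP; left; apply/eqP.
  by ring.
have [f Phif] : exists f, Phi f < 1.
  apply/not_existsP => nf.
  have : (q ^ #|V|)%:R <= \sum_(f : {ffun V -> 'I_q}) Phi f.
    have -> : (q ^ #|V|)%:R = \sum_(f : {ffun V -> 'I_q}) 1 :> R.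
      by rewrite sumr_const card_ffun card_ord.
    by apply: ler_sum => f _; rewrite leNgt; apply/negP => /nf.
  move=> /le_trans/(_ sumPhi); rewrite -[leLHS]mulr1 ler_pM2l; last by rewrite ltr0n expn_gt0 q0.
  by rewrite leNgt lt1.
exists f => i c; rewrite ltnNge; apply/negP => le; move: Phif; rewrite ltNge => /negP; apply.
rewrite /Phi (bigD1 i) //= (bigD1 c) //= prodE -addrA.
apply: (@le_trans _ _ (2 ^+ w * (1 / 2) ^+ #|[set v in S i | f v == c]|)).
  rewrite mul1r exprVn ler_pdivlMr ?exprn_gt0 // mul1r; apply: ler_weXn2l => //; lra.
have g0 i' c' v d : 0 <= g i' c' v d by rewrite /g; case: ifP => _; rewrite ?divr_ge0 ?ler01.
rewrite lerDl addr_ge0 // !sumr_ge0 // => j _; first by rewrite mulr_ge0 ?exprn_ge0 // prodr_ge0.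
by rewrite sumr_ge0 // => d _; rewrite mulr_ge0 ?exprn_ge0 // prodr_ge0.
Qed.

Lemma cut_dense_robust (a : R) : 0 < a -> a <= 1 -> exists L : nat,
  forall (T : finType) (G : sgraph T) (P : {set T}) (th : nat), (1 < #|P|)%N ->
    cut_dense G a P -> th%:R <= a ^+ 2 * #|P|%:R / 8 -> robust G P P th L.
Proof.
move=> a0 a1; have [|||K hK] := @exists_expr_le (a / 2) (a / 4); try by lra.
exists K.+1 => T G P th P1 cd thle; apply: (@gball_robust _ _ _ _ th).
  by move=> k u v _ uP vP; rewrite (setIidPl (_ : _ \subset P)) // subIset // gball_sub orbT.
exact: gball_full a0 P1 cd thle hK.
Qed.

(** A smallest class of a random q-colouring. It has to hit only (K + 2) |V0|^2 sets, the ones met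
    by [gball_robust], and each has linear size, so the exponentially small failure probability
    beats their number. *)
Lemma cut_dense_reserve (a : R) (q : nat) : 0 < a -> a <= 1 -> (0 < q)%N -> exists L N0 : nat,
  forall (T : finType) (G : sgraph T) (V0 : {set T}), (N0 < #|V0|)%N -> cut_dense G a V0 ->
  exists (Z : {set T}) (w : nat),
    [/\ Z \subset V0, (q * #|Z| <= #|V0|)%N, a ^+ 2 / (128 * q%:R) * #|V0|%:R <= w%:R,
        robust G V0 Z w L & forall v, v \in V0 -> (w <= deg_in G Z v)%N].
Proof.
move=> a0 a1 q0; have q0R : 0 < q%:R :> R by rewrite ltr0n.
have [|||K hK] := @exists_expr_le (a / 2) (a / 4); try by lra.
pose c : R := a ^+ 2 / (128 * q%:R).
have c0 : 0 < c by rewrite divr_gt0 ?exprn_gt0 // mulr_gt0.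
exists K.+1, (maxn 1 (maxn (Num.truncn (1 / c)).+1 (Num.truncn ((K.+2 * q)%:R / c ^+ 3)).+1)).
move=> T G V0; rewrite !gtn_max => /andP[V1 /andP[Vc Vq]] cd.
set N : R := #|V0|%:R.
have N0 : 0 < N by rewrite ltr0n; apply: leq_ltn_trans V1.
have cN : 1 <= c * N.
  rewrite mulrC -ler_pdivrMr //; apply/ltW/(lt_le_trans (truncnS_gt _)).
  by rewrite ler_nat; exact: ltnW Vc.
have KqN : (K.+2 * q)%:R < c ^+ 3 * N.
  rewrite mulrC -ltr_pdivrMr ?exprn_gt0 //; apply: (lt_trans (truncnS_gt _)).
  by rewrite ltr_nat; exact: Vq.
pose th := Num.truncn (a ^+ 2 * N / 8).
have thle : th%:R <= a ^+ 2 * N / 8 by rewrite truncn_le // divr_ge0 // mulr_ge0 // ?exprn_ge0 // ltW.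
pose w := (th %/ (16 * q))%N.
have wth : (16 * q * w <= th)%N by rewrite mulnC leq_trunc_div.
have cw : c * N <= w.+1%:R.
  have h1 : (th < w.+1 * (16 * q))%N by rewrite ltn_ceil // muln_gt0.
  have h2 : a ^+ 2 * N / 8 < (w.+1 * (16 * q))%:R.
    by apply: lt_le_trans (truncnS_gt _) _; rewrite ler_nat.
  have -> : c * N = a ^+ 2 * N / 8 / (16 * q%:R) by rewrite /c; field; rewrite gt_eqF.
  by rewrite ler_pdivrMr ?mulr_gt0 // -natrM -natrM; exact: ltW.
have degV v : v \in V0 -> (th <= deg_in G V0 v)%N.
  move=> vV; rewrite -(ler_nat R); apply: le_trans thle _.
  apply: le_trans (cut_dense_deg cd V1 vV); rewrite -/N.
  have N2 : 2 <= N by rewrite /N (ler_nat _ 2).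
  have h1 : a ^+ 2 * N <= a * N by rewrite ler_pM2r // expr2 ger_pMl.
  have h2 : a * 2 <= a * N by rewrite ler_pM2l.
  lra.
pose sV := {x | x \in V0}.
(* Levels 0 to K serve the links. At level K + 1 the ball is all of V0, which yields the degrees
   into the reserve. *)
pose I : finType := ('I_K.+2 * (sV * sV))%type.
pose S0 (i : I) := nbhd G (val i.2.2) :&: gball G V0 th (val i.2.1) i.1.
(* V0 is a default that gives all sets of the family size at least [th]. *)
pose S (i : I) := if (th <= #|S0 i|)%N then S0 i else V0.
have thS i : (th <= #|S i|)%N.
  rewrite /S; case: ifP => // _.
  exact: leq_trans (degV _ (valP i.2.1)) (deg_in_le _ _ _).
have cI : #|I| = (K.+2 * (#|V0| * #|V0|))%N.
  by rewrite !card_prod card_ord !card_sig; congr (_ * (_ * _))%N; apply: eq_card => x.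
have [|f hf] := @good_partition T I S q w th q0 thS.
  have y0 : 0 <= 1 / (2 * q%:R) :> R by rewrite divr_ge0 // mulr_ge0 // ltW.
  have y1 : 1 / (2 * q%:R) <= 1 :> R.
    by rewrite ler_pdivrMr ?mulr_gt0 // mul1r -natrM ler1n muln_gt0.
  set y := 1 / (2 * q%:R) in y0 y1 *.
  (* With 16 q w <= th and 3^4 >= 2^6, the failure probability of one set is at most 2^(-6w),
     against 2^w from the weight. *)
  have h4 : (1 - y) ^+ (4 * q) <= 1 / 3.
    have := expr_bernoulli (4 * q) y0 y1.
    have -> : 1 + (4 * q)%:R * y = 3 by rewrite /y natrM; field; rewrite gt_eqF.
    lra.
  have hth : (1 - y) ^+ th <= (1 / 3) ^+ (4 * w).
    apply: (@le_trans _ _ ((1 - y) ^+ (16 * q * w))).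
      by apply: ler_wiXn2l wth; lra.
    have -> : (16 * q * w = (4 * q) * (4 * w))%N by ring.
    by rewrite exprM; apply: lerXn2r h4; rewrite nnegrE ?exprn_ge0 //; lra.
  have hw : (1 / 3) ^+ (4 * w) <= (1 / 2) ^+ (6 * w) :> R.
    by rewrite !exprM; apply: lerXn2r; rewrite ?nnegrE ?exprn_ge0 //; lra.
  have cIR : (#|I| * q * 2 ^ w)%:R = (K.+2 * q)%:R * N ^+ 2 * 2 ^+ w.
    by rewrite cI !natrM natrX /N; ring.
  rewrite cIR; apply: (@le_lt_trans _ _ ((K.+2 * q)%:R * N ^+ 2 * 2 ^+ w * (1 / 2) ^+ (6 * w))).
    apply: ler_wpM2l; last exact: le_trans hth hw.
    by rewrite !mulr_ge0 ?exprn_ge0 // ltW.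
  have -> : (K.+2 * q)%:R * N ^+ 2 * 2 ^+ w * (1 / 2) ^+ (6 * w) = (K.+2 * q)%:R * N ^+ 2 / (2 ^+ w) ^+ 5.
    rewrite mul1r exprVn (_ : (6 * w = w + w * 5)%N); last by ring.
    rewrite exprD exprM; field.
    by rewrite expf_neq0.
  have wc : c * N <= 2 ^+ w.
    by apply: le_trans cw _; rewrite -natrX ler_nat; exact: ltn_expl.
  rewrite ltr_pdivrMr ?exprn_gt0 ?exprn_gt0 // mul1r.
  apply: (@lt_le_trans _ _ ((c * N) ^+ 5)); last first.
    by apply: lerXn2r wc; rewrite nnegrE ?exprn_ge0 // mulr_ge0 // ltW.
  apply: (@lt_le_trans _ _ ((c * N) ^+ 3)); last by apply: ler_weXn2l.
  have -> : (c * N) ^+ 3 = c ^+ 3 * N * N ^+ 2 by ring.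
  by rewrite ltr_pM2r ?exprn_gt0.
have [c1 hc1] : exists c1 : 'I_q, (q * #|[set v in V0 | f v == c1]| <= #|V0|)%N.
  apply/not_existsP => nc.
  have : (\sum_(c1 : 'I_q) (#|V0| + 1) <= \sum_(c1 : 'I_q) q * #|[set v in V0 | f v == c1]|)%N.
    apply: leq_sum => c1 _; rewrite addn1 ltnNge; apply/negP; exact: nc.
  rewrite sum_nat_const card_ord -big_distrr leq_mul2l /=.
  have -> : (\sum_(c1 : 'I_q) #|[set v in V0 | f v == c1]| = #|V0|)%N.
    rewrite -sum1_card (partition_big f xpredT) //=; apply: eq_bigr => c1 _.
    by rewrite -sum1_card; apply: eq_bigl => v; rewrite inE.
  by rewrite addn1 ltnn orbF => /eqP q00; rewrite q00 in q0.
exists [set v in V0 | f v == c1], w.+1; split=> //.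
- by apply/subsetP => v; rewrite inE => /andP[].
- have samp k u v : (k < K.+2)%N -> u \in V0 -> v \in V0 -> (th <= deg_in G (gball G V0 th u k) v)%N ->
     (w < #|nbhd G v :&: gball G V0 th u k :&: [set v in V0 | f v == c1]|)%N.
    move=> kK uV vV thd; have := hf (Ordinal kK, (exist _ u uV, exist _ v vV)) c1.
    rewrite /S /S0 /= thd => /leq_trans; apply; apply: subset_leq_card; apply/subsetP => x.
    rewrite !inE => /andP[/andP[-> xb] ->]; rewrite xb andbT /=.
    by rewrite andbT (subsetP (gball_sub _ _ _ _ _) _ xb).
  apply: (@gball_robust _ _ _ _ th).
    by move=> k u v kK; apply: samp; rewrite ltnS ltnW.
  exact: gball_full a0 V1 cd thle hK.
move=> v vV.
have bV : gball G V0 th v K.+1 = V0.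
  apply/eqP; rewrite eqEsubset gball_sub; apply/subsetP => x xV.
  exact: gball_full a0 V1 cd thle hK _ _ vV xV.
pose ix : I := (Ordinal (ltnSn K.+1), (exist _ v vV, exist _ v vV)).
have eS : S ix = nbhd G v :&: V0.
  have e0 : S0 ix = nbhd G v :&: V0 by exact: (congr1 (fun X : {set T} => nbhd G v :&: X) bV).
  by rewrite /S e0 degV.
have := hf ix c1; rewrite eS => /leq_trans; apply.
apply: subset_leq_card; apply/subsetP => x.
by rewrite !inE => /andP[/andP[-> ->] ->].
Qed.

End Reserve.

(** * Menger's theorem *)

Section Menger.
Variable T : finType.
Implicit Types (r : rel T) (A B X Y Z : {set T}) (x y : T).

Definition avoiding r X : rel T := [rel u v | [&& u \notin X, v \notin X & r u v]].

(** The case a = b is included, so X contains [A :&: B]. *)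
Definition separates r A B X : Prop :=
  forall a b, a \in A -> b \in B -> a \notin X -> b \notin X ->
    ~~ connect (avoiding r X) a b.

Definition rconn r (Q : {set T}) : Prop :=
  exists2 x, x \in Q & forall y, y \in Q -> connect [rel u v | [&& u \in Q, v \in Q & r u v]] x y.

(** Disjoint connected sets meeting A and B stand for disjoint A-B paths, which avoids all
    manipulation of paths. *)
Definition linked r A B (k : nat) : Prop :=
  exists I : {set T}, exists Q : T -> {set T},
    [/\ #|I| = k,
        forall i, i \in I -> rconn r (Q i),
        forall i, i \in I -> (exists2 a, a \in A & a \in Q i) /\ (exists2 b, b \in B & b \in Q i) &
        forall i j, i \in I -> j \in I -> i != j -> [disjoint Q i & Q j]].

Lemma rconn_sub r r' Q : (forall x y, r x y -> r' x y) -> rconn r Q -> rconn r' Q.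
Proof.
move=> sr [x xQ xc]; exists x => // y /xc; apply: connect_sub => u v /and3P[uQ vQ uv].
by apply: connect1; rewrite /= uQ vQ sr.
Qed.

Lemma rconnU r Q1 Q2 x y : symmetric r -> rconn r Q1 -> rconn r Q2 -> x \in Q1 -> y \in Q2 ->
  (x == y) || r x y -> rconn r (Q1 :|: Q2).
Proof.
move=> rC [x1 x1Q c1] [x2 x2Q c2] xQ yQ xy.
pose e := [rel u v | [&& u \in Q1 :|: Q2, v \in Q1 :|: Q2 & r u v]].
have eS : connect_sym e.
  by apply: sym_connect_sym => u v; rewrite /= rC; case: (u \in _); case: (v \in _).
have s1 z w : connect [rel u v | [&& u \in Q1, v \in Q1 & r u v]] z w -> connect e z w.
  apply: connect_sub => u v /and3P[uQ vQ uv]; apply: connect1.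
  by rewrite /= !inE uQ vQ uv.
have s2 z w : connect [rel u v | [&& u \in Q2, v \in Q2 & r u v]] z w -> connect e z w.
  apply: connect_sub => u v /and3P[uQ vQ uv]; apply: connect1.
  by rewrite /= !inE uQ vQ uv !orbT.
exists x; first by rewrite inE xQ.
have xx1 : connect e x x1 by rewrite eS; apply/s1/c1.
have xy' : connect e x y.
  case/orP: xy => [/eqP->|xy]; first exact: connect0.
  by apply: connect1; rewrite /= !inE xQ yQ xy orbT.
have yx2 : connect e y x2 by rewrite eS; apply/s2/c2.
move=> z /setUP[zQ|zQ]; first exact: connect_trans xx1 (s1 _ _ (c1 z zQ)).
exact: connect_trans xy' (connect_trans yx2 (s2 _ _ (c2 z zQ))).
Qed.

Lemma linked_onto r A B k : linked r A B k -> (#|B| <= k)%N ->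
  #|B| = k /\ exists Q : T -> {set T},
    [/\ forall b, b \in B -> rconn r (Q b), forall b, b \in B -> b \in Q b,
        forall b, b \in B -> exists2 a, a \in A & a \in Q b &
        forall b b', b \in B -> b' \in B -> b != b' -> [disjoint Q b & Q b']].
Proof.
move=> [I [Q [cI cQ mQ dQ]]] Bk.
have /choice[f hf] : forall i, exists b, i \in I -> b \in B /\ b \in Q i.
  move=> i; have [iI|iI] := boolP (i \in I); last by exists i.
  by have [_ [b bB bQ]] := mQ i iI; exists b.
have f_inj : {in I &, injective f}.
  move=> i j iI jI fij; apply/eqP/negPn/negP => ij.
  have /pred0P/(_ (f i)) := dQ i j iI jI ij.
  by rewrite /= (hf i iI).2 fij (hf j jI).2.
have fB : f @: I = B.
  apply/eqP; rewrite eqEcard card_in_imset // cI Bk andbT.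
  by apply/subsetP => _ /imsetP[i iI ->]; have [] := hf i iI.
split; first by rewrite -fB card_in_imset.
have /choice[g hg] : forall b, exists i, b \in B -> i \in I /\ f i = b.
  move=> b; have [bB|bB] := boolP (b \in B); last by exists b.
  by move: bB; rewrite -fB => /imsetP[i iI ->]; exists i.
exists (fun b => Q (g b)); split.
- by move=> b bB; have [gI _] := hg b bB; exact: cQ.
- by move=> b bB; have [gI gb] := hg b bB; rewrite -{1}gb; have [] := hf _ gI.
- by move=> b bB; have [gI _] := hg b bB; have [] := mQ _ gI.
move=> b b' bB bB' bb'; have [gI gb] := hg b bB; have [gI' gb'] := hg b' bB'.
by apply: dQ => //; apply: contraNneq bb' => e; rewrite -gb -gb' e.
Qed.

Lemma separatesC r A B X : symmetric r -> separates r A B X -> separates r B A X.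
Proof.
move=> rC h a b aB bA aX bX; rewrite sym_connect_sym; first exact: h.
by move=> u v; rewrite /avoiding /= rC; case: (u \in X); case: (v \in X).
Qed.

Lemma rconn_closed r Q (C : {set T}) z : (forall x y, r x y -> x \in C -> y \in C) ->
  rconn r Q -> symmetric r -> z \in Q -> z \in C -> Q \subset C.
Proof.
move=> rC [x xQ xc] rS zQ zC.
have eS : connect_sym [rel u v | [&& u \in Q, v \in Q & r u v]].
  by apply: sym_connect_sym => u v; rewrite /= rS; case: (u \in _); case: (v \in _).
apply/subsetP => y yQ; have : connect [rel u v | [&& u \in Q, v \in Q & r u v]] z y.
  by apply: connect_trans (xc y yQ); rewrite eS xc.
case/connectP => p; elim: p z zQ zC => [|w p IH] z zQ zC /=; first by move=> _ ->.
move=> /andP[/and3P[_ wQ zw] pp]; apply: IH pp => //; exact: rC zw zC.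
Qed.

(** Induction on the number of arcs. Delete an edge. If a set X with fewer than k vertices then
    separates, X together with either end of the edge has k vertices; the systems found on the two
    sides are joined along X and across the edge. *)
Lemma menger r A B k : symmetric r ->
  (forall X, separates r A B X -> (k <= #|X|)%N) -> linked r A B k.
Proof.
have [n] := ubnP #|[set p : T * T | r p.1 p.2]|.
elim: n r A B k => // n IH r A B k; rewrite ltnS => rn rC sepk.
have [[x y] /=|r0] := pickP [pred p : T * T | r p.1 p.2]; last first.
  have kAB : (k <= #|A :&: B|)%N.
    apply: sepk => a b aA bB aX bX; apply/negP => /connectP[[|c p] /=].
      by move=> _ ba; move: aX; rewrite inE aA -ba bB.
    by move=> /andP[/and3P[_ _ ac] _]; have := r0 (a, c); rewrite /= ac.
  exists [set z in take k (enum (A :&: B))], (fun z => [set z]).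
  have sub z : z \in [set z in take k (enum (A :&: B))] -> (z \in A) && (z \in B).
    by rewrite inE => /mem_take; rewrite mem_enum inE.
  split.
  - rewrite cardsE; have /card_uniqP -> := take_uniq k (enum_uniq (A :&: B)).
    by rewrite size_takel // -cardE.
  - by move=> z _; exists z; rewrite ?set11 // => w /set1P->; exact: connect0.
  - by move=> z /sub/andP[zA zB]; split; exists z; rewrite ?set11.
  by move=> z w _ _ zw; rewrite disjoints1 inE.
move=> rxy.
pose r' := [rel u v | [&& r u v, (u, v) != (x, y) & (u, v) != (y, x)]].
have r'C : symmetric r'.
  move=> u v; rewrite /= rC; case: (r v u) => //=; rewrite !xpair_eqE andbC.
  by congr (~~ _ && ~~ _); rewrite andbC.
have r'r u v : r' u v -> r u v by case/and3P.
have card_lt (e : rel T) : (forall u v, e u v -> r' u v) -> (#|[set p : T * T | e p.1 p.2]| < n)%N.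
  move=> er; apply: leq_trans rn; apply: proper_card; rewrite properE; apply/andP; split.
    by apply/subsetP => p; rewrite !inE => /er/r'r.
  apply/subsetPn; exists (x, y); rewrite inE //=.
  by apply/negP => /er; rewrite /= eqxx andbF.
have [sep'|] := pselect (forall X, separates r' A B X -> (k <= #|X|)%N).
  have [I [Q [cI cQ mQ dQ]]] := IH r' A B k (card_lt r' (fun _ _ => id)) r'C sep'.
  by exists I, Q; split=> // i iI; apply: rconn_sub (cQ i iI).
move=> /existsNP[X /not_implyP[sepX /negP]]; rewrite -ltnNge => Xk.
pose CA := [set v | (v \notin X) && [exists a in A, (a \notin X) && connect (avoiding r' X) a v]].
have CAX v : v \in CA -> v \notin X by rewrite inE => /andP[].
have CAB b : b \in B -> b \notin CA.
  move=> bB; rewrite inE; apply/negP => /andP[bX /exists_inP[a aA /andP[aX ab]]].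
  by have := sepX a b aA bB aX bX; rewrite ab.
have CAA a : a \in A -> a \notin X -> a \in CA.
  move=> aA aX; rewrite inE aX; apply/exists_inP; exists a => //.
  by rewrite aX connect0.
have CAstep u v : u \in CA -> v \notin X -> r' u v -> v \in CA.
  move=> uC vX uv; have uX := CAX u uC; move: uC; rewrite !inE => /andP[_ /exists_inP[a aA /andP[aX au]]].
  rewrite vX; apply/exists_inP; exists a => //; rewrite aX /=.
  by apply: connect_trans au (connect1 _); rewrite /avoiding /= uX vX.
(* The deleted edge must leave [CA], the part reached from A: otherwise X would separate A from B in
   r itself. This orients it from x0 to y0. *)
suff main x0 y0 : (forall u v, r u v -> ~~ r' u v -> ((u, v) == (x0, y0)) || ((u, v) == (y0, x0))) -> r x0 y0 ->
    x0 \in CA -> y0 \notin CA -> linked r A B k.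
  have diff u v : r u v -> ~~ r' u v -> ((u, v) == (x, y)) || ((u, v) == (y, x)).
    by move=> /= ->; rewrite /= -negb_or negbK.
  have [xC|xC] := boolP (x \in CA); have [yC|yC] := boolP (y \in CA).
  - exfalso; have : (k <= #|X|)%N; last by rewrite leqNgt Xk.
    apply: sepk => a b aA bB aX bX; apply/negP => /connect_exit/(_ (CAA a aA aX) (CAB b bB)).
    move=> [u [v [uC vC /and3P[uX vX uv] _]]].
    have [uv'|nuv'] := boolP (r' u v); first by rewrite (CAstep u v) in vC.
    by case/orP: (diff u v uv nuv') => /eqP[_ vE]; rewrite vE ?xC ?yC in vC.
  - exact: main diff rxy xC yC.
  - by apply: (main y x) => // [u v uv nuv|]; [rewrite orbC diff|rewrite rC].
  exfalso; have : (k <= #|X|)%N; last by rewrite leqNgt Xk.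
  apply: sepk => a b aA bB aX bX; apply/negP => /connect_exit/(_ (CAA a aA aX) (CAB b bB)).
  move=> [u [v [uC vC /and3P[uX vX uv] _]]].
  have [uv'|nuv'] := boolP (r' u v); first by rewrite (CAstep u v) in vC.
  by case/orP: (diff u v uv nuv') => /eqP[uE _]; rewrite uE ?(negPf xC) ?(negPf yC) in uC.
move=> {rxy} diff rxy xC yC.
have yX : y0 \notin X.
  apply/negP => yX; have : (k <= #|X|)%N; last by rewrite leqNgt Xk.
  apply: sepk => a b aA bB aX bX; apply/negP => /connect_exit/(_ (CAA a aA aX) (CAB b bB)).
  move=> [u [v [uC vC /and3P[uX vX uv] _]]].
  have [uv'|nuv'] := boolP (r' u v); first by rewrite (CAstep u v) in vC.
  case/orP: (diff u v uv nuv') => /eqP[uE vE]; first by rewrite vE yX in vX.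
  by rewrite uE (negPf yC) in uC.
have r'diff u v : r u v -> u != x0 -> u != y0 -> r' u v.
  move=> uv ux uy; apply: contraTT isT => /(diff u v uv)/orP[]/eqP[uE _].
    by rewrite uE eqxx in ux.
  by rewrite uE eqxx in uy.
pose C1 := CA :|: X.
pose r1 := [rel u v | [&& u \in C1, v \in C1 & r' u v]].
pose r2 := [rel u v | [&& u \notin CA, v \notin CA & r' u v]].
have r1C : symmetric r1 by move=> u v; have := r'C u v; rewrite /r1 /= => ->; case: (u \in C1); case: (v \in C1).
have r2C : symmetric r2 by move=> u v; have := r'C u v; rewrite /r2 /= => ->; case: (u \in CA); case: (v \in CA).
(* A path from A to B in r reaches x0 or X before it leaves [C1], so Y separates A from B in r as
   well. *)
have sep1 Y : separates r1 A (x0 |: X) Y -> (k <= #|Y|)%N.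
  move=> sY; apply: sepk => a b aA bB aY bY; apply/negP => ab.
  pose D := [set v | [&& v \notin Y, v \in C1 & connect (avoiding r1 Y) a v]].
  have aD : a \in D.
    by rewrite inE aY connect0 andbT in_setU; case: (boolP (a \in X)) => [_|/(CAA a aA)->]; rewrite ?orbT.
  have Dx u : u \in D -> u \notin x0 |: X.
    rewrite inE => /and3P[uY _ au]; apply/negP => uX.
    by have := sY a u aA uX aY uY; rewrite au.
  have bD : b \notin D.
    apply/negP => bD; have := Dx b bD; rewrite in_setU1 negb_or => /andP[_ bX].
    by move: bD; rewrite inE in_setU (negPf bX) orbF (negPf (CAB b bB)) /= andbF.
  have [u [v [uD vD /and3P[_ vY uv] _]]] := connect_exit ab aD bD.
  have := Dx u uD; rewrite inE negb_or => /andP[]; rewrite in_set1 => ux uX.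
  have uCA : u \in CA by move: uD; rewrite inE => /and3P[_ /setUP[//|uX']]; rewrite uX' in uX.
  have uy : u != y0 by apply: contraNneq yC => <-.
  have uv' := r'diff u v uv ux uy.
  have vC1 : v \in C1.
    rewrite inE; case: (boolP (v \in X)) => vX; first by rewrite orbT.
    by rewrite (CAstep u v).
  move: vD; rewrite inE vY vC1 /= => /negP; apply.
  move: (uD); rewrite inE => /and3P[uY uC1 au]; apply: connect_trans au (connect1 _).
  by rewrite /avoiding /= uY vY uC1 vC1.
have sep2 Y : separates r2 B (y0 |: X) Y -> (k <= #|Y|)%N.
  move=> sY; apply: sepk; apply: separatesC => // b a bB aA bY aY; apply/negP => ba.
  pose D := [set v | [&& v \notin Y, v \notin CA & connect (avoiding r2 Y) b v]].
  have bD : b \in D by rewrite inE bY connect0 CAB.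
  have Dx u : u \in D -> u \notin y0 |: X.
    rewrite inE => /and3P[uY _ bu]; apply/negP => uX.
    by have := sY b u bB uX bY uY; rewrite bu.
  have aD : a \notin D.
    apply/negP => aD; have := Dx a aD; rewrite inE negb_or => /andP[_ aX].
    by move: aD; rewrite inE (CAA a aA aX) andbF.
  have [u [v [uD vD /and3P[_ vY uv] _]]] := connect_exit ba bD aD.
  have := Dx u uD; rewrite inE negb_or => /andP[]; rewrite in_set1 => uy uX.
  have uCA : u \notin CA by move: uD; rewrite inE => /and3P[].
  have ux : u != x0 by apply: contraNneq uCA => ->.
  have uv' := r'diff u v uv ux uy.
  have vCA : v \notin CA.
    by apply: contra uCA => vCA; apply: CAstep vCA uX _; exact: etrans (r'C v u) uv'.
  move: vD; rewrite inE vY vCA /= => /negP; apply.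
  move: (uD); rewrite inE => /and3P[uY _ bu]; apply: connect_trans bu (connect1 _).
  by rewrite /avoiding /= uY vY uCA vCA.
have r1r' u v : r1 u v -> r' u v by case/and3P.
have r2r' u v : r2 u v -> r' u v by case/and3P.
have cx : (#|x0 |: X| <= k)%N by rewrite cardsU1 (CAX x0 xC) add1n.
have cy : (#|y0 |: X| <= k)%N by rewrite cardsU1 yX add1n.
have [cxk [Q1 [c1 z1 m1 d1]]] := linked_onto (IH r1 A (x0 |: X) k (card_lt r1 r1r') r1C sep1) cx.
have [_ [Q2 [c2 z2 m2 d2]]] := linked_onto (IH r2 B (y0 |: X) k (card_lt r2 r2r') r2C sep2) cy.
(* Matches the ends on the two sides: x0 with y0 across the edge, every vertex of X with itself. *)
pose h z := if z == x0 then y0 else z.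
have hX z : z \in x0 |: X -> h z \in y0 |: X.
  rewrite /h !inE; case: eqP => [_|_] /=; first by rewrite eqxx.
  by move=> ->; rewrite orbT.
have sub1 z : z \in x0 |: X -> Q1 z \subset C1.
  move=> zX; apply: (rconn_closed (r := r1) (z := z)) => //; [by move=> u v /and3P[]|exact: c1|exact: z1|].
  by move: zX; rewrite in_setU1 => /orP[/eqP->|zX]; rewrite in_setU ?xC // zX orbT.
have sub2 z : z \in y0 |: X -> Q2 z \subset ~: CA.
  move=> zX; apply: (rconn_closed (r := r2) (z := z)) => //; [by move=> u v /and3P[_ vC _] _; rewrite in_setC|exact: c2|exact: z2|].
  rewrite in_setC; move: zX; rewrite in_setU1 => /orP[/eqP->//|zX].
  by apply: contraTN zX => /CAX.
exists (x0 |: X), (fun z => Q1 z :|: Q2 (h z)); split=> //.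
- move=> z zX; apply: (rconnU (x := z) (y := h z)) => //.
  + by apply: rconn_sub (c1 z zX) => u v /r1r'/r'r.
  + by apply: rconn_sub (c2 _ (hX z zX)) => u v /r2r'/r'r.
  + exact: z1.
  + exact/z2/hX.
  by rewrite /h; case: (eqVneq z x0) => [->|_]; rewrite ?rxy ?eqxx ?orbT.
- move=> z zX; split.
    by have [a aA aQ] := m1 z zX; exists a => //; rewrite inE aQ.
  by have [b bB bQ] := m2 _ (hX z zX); exists b => //; rewrite inE bQ orbT.
(* Sets from opposite sides meet only in X, since the first lie in [C1] and the second outside [CA];
   a common vertex is then the end of both. *)
have mid z z' w : z \in x0 |: X -> z' \in x0 |: X -> z != z' -> w \in Q1 z -> w \in Q2 (h z') -> False.
  move=> zX zX' zz' w1 w2.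
  have wX : w \in X.
    have := subsetP (sub1 z zX) w w1; have := subsetP (sub2 _ (hX z' zX')) w w2.
    by rewrite in_setC in_setU => /negPf->.
  have wz : w = z.
    apply/eqP/negPn/negP => wz; have wX0 : w \in x0 |: X by rewrite !inE wX orbT.
    by have /pred0P/(_ w) := d1 w z wX0 zX wz; rewrite /= w1 z1.
  have wz' : w = h z'.
    apply/eqP/negPn/negP => wz'; have wX0 : w \in y0 |: X by rewrite !inE wX orbT.
    by have /pred0P/(_ w) := d2 w _ wX0 (hX z' zX') wz'; rewrite /= w2 z2.
  move: wz'; rewrite /h; case: eqP => [_ wy|_ wz'].
    by rewrite -wy wX in yX.
  by rewrite -wz wz' eqxx in zz'.
move=> z z' zX zX' zz'; apply/pred0P => w /=; apply/negP.
rewrite !inE => /andP[/orP[w1|w2] /orP[w1'|w2']].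
- by have /pred0P/(_ w) := d1 z z' zX zX' zz'; rewrite /= w1 w1'.
- exact: mid zX zX' zz' w1 w2'.
- by apply: mid zX' zX _ w1' w2; rewrite eq_sym.
have hh : h z != h z'.
  rewrite /h; have [zx|zx] := eqVneq z x0; have [zx'|zx'] := eqVneq z' x0 => //.
  - by rewrite zx zx' eqxx in zz'.
  - by apply: contraNneq yX => ->; move: zX'; rewrite in_setU1 (negPf zx').
  by apply: contraNneq yX => <-; move: zX; rewrite in_setU1 (negPf zx).

by have /pred0P/(_ w) := d2 _ _ (hX z zX) (hX z' zX') hh; rewrite /= w2 w2'.
Qed.

End Menger.

(** * Minimal dense minors *)

Section Contraction.
Variables (T : finType) (G : sgraph T) (x y : T).
Hypothesis xy : adj G x y.

Definition merge_rel : rel T := [rel u v | adj G u v || ((u == x) && adj G y v)].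

Definition contraction := induced (mkgraph merge_rel) [set~ y].

Lemma contraction_minor : has_minor G contraction.
Proof.
have nxy := adj_neq xy.
exists (fun u => if val u == x then [set x; y] else [set val u]); first split=> [u|u v].
- case: ifP => _; last exact: connected_in1.
  apply: (connected_in_U1 (y := y)) => //; first exact: connected_in1.
  exact: set11.
- have yv (w : {z | z \in [set~ y]}) : val w != y by have := valP w; rewrite !inE.
  have mem (w : {z | z \in [set~ y]}) : val w \in (if val w == x then [set x; y] else [set val w]).
    by case: ifP => [/eqP->|_]; rewrite !inE eqxx.
  rewrite adj_induced adj_mkgraph /= => /andP[_ /orP[/orP[uv|/andP[/eqP ux yv']]|/orP[vu|/andP[/eqP vx yu]]]].
  + by exists (val u), (val v); rewrite !mem.
  + by exists y, (val v); rewrite mem ux eqxx !inE eqxx orbT.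
  + by exists (val u), (val v); rewrite !mem adjC.
  by exists (val u), y; rewrite mem vx eqxx !inE eqxx orbT adjC.
move=> u v uv; rewrite disjoints_subset; apply/subsetP => w.
have := valP u; have := valP v; rewrite !inE => vy uy.
have uv' : val u != val v by apply: contra uv => /eqP/val_inj->.
case: eqP => [ux|ux]; case: eqP => [vx|vx]; rewrite !inE.
- by rewrite ux vx eqxx in uv'.
- move=> /orP[]/eqP->; first by rewrite eq_sym; apply/eqP.
  by rewrite eq_sym.
- move=> /eqP->; rewrite negb_or uy andbT; exact/eqP.
by move=> /eqP->.
Qed.

Lemma card_contraction : #|{: {z | z \in [set~ y]}}| = #|T|.-1.
Proof. by rewrite card_sig cardsC1. Qed.

(** Contraction loses the edge xy itself and one of the two edges to each common neighbour. *)
Lemma edges_contraction : (#|edges G| <= #|edges contraction| + #|nbhd G x :&: nbhd G y| + 1)%N.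
Proof.
have nxy := adj_neq xy.
(* The neighbours of y that become new neighbours of x. *)
pose S := nbhd G y :\: (x |: nbhd G x).
have cS : (#|nbhd G y| = #|nbhd G x :&: nbhd G y| + 1 + #|S|)%N.
  rewrite /S -(cardsID (x |: nbhd G x) (nbhd G y)) setIUr cardsU.
  have -> : nbhd G y :&: [set x] = [set x].
    by apply/setIidPr; rewrite sub1set inE adjC.
  have -> : [set x] :&: (nbhd G y :&: nbhd G x) = set0.
    by apply/eqP; rewrite -subset0; apply/subsetP => z; rewrite !inE => /andP[/eqP->]; rewrite adjxx andbF.
  by rewrite cards1 cards0 subn0 setIC [(1 + _)%N]addnC.
have e1 : (2 * #|edges G| = arcs G [set~ y] [set~ y] + 2 * #|nbhd G y|)%N.
  rewrite -arcsT -(setUCr [set y]) arcsUU; last by rewrite disjoints_subset setCK.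
  rewrite (arcs1l _ y [set y]) (arcs1l _ y [set~ y]).
  have -> : deg_in G [set y] y = 0%N.
    apply/eqP; rewrite cards_eq0 -subset0; apply/subsetP => z.
    by rewrite !inE => /andP[h /eqP zy]; rewrite zy adjxx in h.
  have -> : deg_in G [set~ y] y = #|nbhd G y|.
    rewrite /deg_in (setIidPl _) //; apply/subsetP => z; rewrite !inE => h.
    by rewrite eq_sym (adj_neq h).
  by [].
have e2 : (arcs G [set~ y] [set~ y] + 2 * #|S| <= 2 * #|edges contraction|)%N.
  rewrite arcs_induced /arcs.
  have SA : S \subset [set~ y].
    by apply/subsetP => z; rewrite !inE => /andP[_ h]; rewrite eq_sym (adj_neq h).
  have cS1 : (\sum_(u in [set~ y]) \sum_(v in [set~ y]) ((u == x) && (v \in S)) = #|S|)%N.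
    rewrite (bigD1 x) /=; last by rewrite !inE.
    rewrite [X in (_ + X)%N]big1 ?addn0; last by move=> u /andP[_ /negPf ux]; apply: big1 => v _; rewrite ux.
    rewrite eqxx -sum1_card big_mkcond [RHS]big_mkcond; apply: eq_bigr => v _ /=.
    case: (boolP (v \in S)) => [/(subsetP SA)->//|_]; by case: ifP.
  have cS2 : (\sum_(u in [set~ y]) \sum_(v in [set~ y]) ((v == x) && (u \in S)) = #|S|)%N.
    by rewrite exchange_big.
  rewrite mul2n -addnn -{1}cS1 -{1}cS2 !addnA -!big_split /=; apply: leq_sum => u uA.
  rewrite !deg_inE -!big_split /=; apply: leq_sum => v vA.
  have Sx w : w \in S -> [/\ w != x, ~~ adj G x w & adj G y w].
    by rewrite !inE negb_or => /andP[/andP[-> ->] ->].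
  rewrite adj_mkgraph /merge_rel /=.
  have [/andP[/eqP ux vS]|uxS] := boolP ((u == x) && (v \in S)).
    have [vx nxv yv] := Sx v vS; rewrite (negPf vx) ux (negPf nxv) /=.
    by rewrite eq_sym vx eqxx yv.
  have [/andP[/eqP vx uS]|vxS] := boolP ((v == x) && (u \in S)).
    have [ux nxu yu] := Sx u uS; rewrite vx adjC (negPf nxu) /= ux.
    by rewrite eqxx yu !orbT.
  by have [uv|uv] := boolP (adj G u v); rewrite // (adj_neq uv).
lia.
Qed.

End Contraction.

Section MinimalMinor.
Variable R : realType.
Local Open Scope ring_scope.

Lemma no_crossing_arcs (T : finType) (G : sgraph T) (A B : {set T}) : A :|: B = [set: T] ->
  (forall u v, u \in A :\: B -> v \in B :\: A -> ~~ adj G u v) ->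
  (arcs G [set: T] [set: T] <= arcs G A A + arcs G B B)%N.
Proof.
move=> AB nc.
have arcsE (X : {set T}) : arcs G X X = (\sum_u \sum_v ((u \in X) && (v \in X) && adj G u v))%N.
  rewrite /arcs big_mkcond /=; apply: eq_bigr => u _; case: (u \in X) => /=; last by rewrite big1.
  by rewrite deg_inE big_mkcond; apply: eq_bigr => v _; case: (v \in X).
rewrite !arcsE -big_split; apply: leq_sum => u _; rewrite -big_split; apply: leq_sum => v _.
rewrite !in_setT /=; have [uv|//] := boolP (adj G u v); rewrite !andbT.
have : u \in A :|: B by rewrite AB in_setT.
have : v \in A :|: B by rewrite AB in_setT.
have := nc u v; have := nc v u; rewrite adjC uv !inE.
by case: (u \in A); case: (u \in B); case: (v \in A); case: (v \in B) => //=.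
Qed.

(* The minor is chosen minimal, first in vertices and then in edges, among those with more than [D v - al D^2] edges and at least [D] vertices. *)
Lemma minimal_minor (T0 : finType) (G0 : sgraph T0) (D al : R) :
  (0 < #|T0|)%N -> 2 <= D -> 0 < al -> al <= 1 / 4 -> 1 <= al * D ^+ 2 ->
  D * #|T0|%:R <= #|edges G0|%:R ->
  exists (T : finType) (G : sgraph T),
    has_minor G0 G /\
    [/\ D <= #|T|%:R, forall x : T, D < #|nbhd G x|%:R,
        forall x y : T, adj G x y -> D < #|nbhd G x :&: nbhd G y|%:R + 1,
        forall A B : {set T}, A :|: B = [set: T] -> A :\: B != set0 -> B :\: A != set0 ->
          (forall u v, u \in A :\: B -> v \in B :\: A -> ~~ adj G u v) -> al * D < #|A :&: B|%:R &
        (1 - al) * D * #|T|%:R <= #|edges G|%:R <= D * #|T|%:R].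
Proof.
move=> T00 D2 al0 al4 alD eG0.
pose good (T : finType) (G : sgraph T) := [/\ has_minor G0 G, D <= #|T|%:R &
   D * #|T|%:R - al * D ^+ 2 < #|edges G|%:R].
pose good1 n := `[< exists (T : finType) (G : sgraph T), good T G /\ #|T| = n >].
pose good2 n m := `[< exists (T : finType) (G : sgraph T), [/\ good T G, #|T| = n & #|edges G| = m] >].
have v_le (T : finType) (G : sgraph T) : 2 * #|edges G|%:R <= #|T|%:R ^+ 2 :> R.
  rewrite -natrM -natrX ler_nat -arcsT; apply: leq_trans (arcs_le _ _ _) _.
  by rewrite cardsT mulnn.
have exg : exists n, good1 n.
  exists #|T0|; apply/asboolP; exists T0, G0; split=> //; split; first exact: has_minor_refl.
    have := v_le _ G0; have : 0 < #|T0|%:R :> R by rewrite ltr0n.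
    move=> v0 h; rewrite -(ler_pM2r v0); nra.
  by lra.
have [n /asboolP[T1 [G1 [gG1 nT1]]] nmin] := ex_minnP exg.
have exg2 : exists m, good2 n m by exists #|edges G1|; apply/asboolP; exists T1, G1.
have [m /asboolP[T [G [[mG DT eG] nT mE]]] mmin] := ex_minnP exg2.
have minV (T' : finType) (G' : sgraph T') : has_minor G G' -> D <= #|T'|%:R ->
    (#|T'| < #|T|)%N -> #|edges G'|%:R <= D * #|T'|%:R - al * D ^+ 2.
  move=> mG' DT' lt; rewrite leNgt; apply/negP => h.
  suff : good1 #|T'| by move=> /nmin; rewrite leqNgt -nT lt.
  by apply/asboolP; exists T', G'; split=> //; split=> //; exact: has_minor_trans mG mG'.
have minE (G' : sgraph T) : has_minor G G' ->
    (#|edges G'| < #|edges G|)%N -> #|edges G'|%:R <= D * #|T|%:R - al * D ^+ 2.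
  move=> mG' lt; rewrite leNgt; apply/negP => h.
  suff : good2 n #|edges G'| by move=> /mmin; rewrite leqNgt -mE lt.
  by apply/asboolP; exists T, G'; split=> //; split=> //; exact: has_minor_trans mG mG'.
have DD : 0 < D ^+ 2 by rewrite exprn_gt0 //; lra.
(* A graph on v vertices has at most v^2/2 edges, too few when v is close to D. Hence deleting or
   contracting leaves at least D vertices and minimality applies. *)
have vD : D + 1 <= #|T|%:R.
  have := v_le _ G; set v := #|T|%:R in DT eG *; set e := #|edges G|%:R in eG * => h.
  rewrite leNgt; apply/negP => vD.
  have h1 : 0 <= (v - D) * (3 / 2 * D - v) by apply: mulr_ge0; lra.
  have : al * D ^+ 2 <= 1 / 4 * D ^+ 2 by rewrite ler_wpM2r // ltW.
  have : D * v < D * (D + 1) by rewrite ltr_pM2l //; lra.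
  have : 0 <= (D - 2) * D by rewrite mulr_ge0 //; lra.
  nra.
have {T1 G1 gG1 nT1 exg2}T1 : (#|T|.-1 < #|T|)%N.
  by rewrite prednK // -(ltr_nat R); lra.
have T1R : #|T|.-1%:R = #|T|%:R - 1 :> R by rewrite -subn1 natrB // -(ltr_nat R); lra.
have degD x : D < #|nbhd G x|%:R.
  have := minV _ (induced G [set~ x]) (induced_minor _ _).
  rewrite card_sig cardsC1 T1R T1 => /(_ ltac:(lra) isT).
  have e1 : (2 * #|edges G| = 2 * #|edges (induced G [set~ x])| + 2 * #|nbhd G x|)%N.
    rewrite arcs_induced -arcsT -(setUCr [set x]) arcsUU; last by rewrite disjoints_subset setCK.
    rewrite (arcs1l _ x [set x]) (arcs1l _ x [set~ x]).
    have -> : deg_in G [set x] x = 0%N.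
      apply/eqP; rewrite cards_eq0 -subset0; apply/subsetP => z.
      by rewrite !inE => /andP[h /eqP zy]; rewrite zy adjxx in h.
    have -> : deg_in G [set~ x] x = #|nbhd G x|.
      rewrite /deg_in (setIidPl _) //; apply/subsetP => z; rewrite !inE => h.
      by rewrite eq_sym (adj_neq h).
    by [].
  have eE : #|edges G| = (#|edges (induced G [set~ x])| + #|nbhd G x|)%N by clear -e1; lia.
  move: eG; rewrite eE natrD; lra.
exists T, G; split=> //; split=> //.
- move=> x y xy; have := minV _ _ (contraction_minor xy).
  rewrite card_contraction T1R T1 => /(_ ltac:(lra) isT).
  have := edges_contraction xy; rewrite -(ler_nat R) !natrD; lra.
(* Both sides have more than D vertices by the degree bound, so minimality applies to each and the
   deficit al D^2 is charged twice. The overlap, counted twice, must make up for one of them: D |A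
   :&: B| > al D^2. *)
- move=> A B AB A0 B0 nc; rewrite ltNge; apply/negP => le.
  have big (X Y : {set T}) : X :|: Y = [set: T] -> X :\: Y != set0 ->
      (forall u v, u \in X :\: Y -> v \in Y :\: X -> ~~ adj G u v) -> D < #|X|%:R.
    move=> XY /set0Pn[u uX] ncX; apply: lt_le_trans (degD u) _; rewrite ler_nat.
    apply: subset_leq_card; apply/subsetP => v; rewrite inE => uv.
    apply: contraTT uv => vX; apply: ncX => //; rewrite inE vX /=.
    by have := in_setT v; rewrite -XY inE (negPf vX).
  have lt (X Y : {set T}) : Y :\: X != set0 -> (#|X| < #|T|)%N.
    move=> /set0Pn[u]; rewrite inE => /andP[uX _].
    by rewrite -cardsT; apply: proper_card; rewrite properE subsetT; apply/subsetPn; exists u.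
  have nc' u v : u \in B :\: A -> v \in A :\: B -> ~~ adj G u v.
    by move=> uB vA; rewrite adjC; exact: nc.
  have hA := minV _ (induced G A) (induced_minor _ _); rewrite card_sig in hA.
  have {}hA := hA (ltW (big A B AB A0 nc)) (lt A B B0).
  have hB := minV _ (induced G B) (induced_minor _ _); rewrite card_sig in hB.
  have AB' : B :|: A = [set: T] by rewrite setUC.
  have {}hB := hB (ltW (big B A AB' B0 nc')) (lt B A A0).
  have hE : (#|edges G| <= #|edges (induced G A)| + #|edges (induced G B)|)%N.
    have := no_crossing_arcs AB nc; rewrite arcsT -!arcs_induced; clear; lia.
  have cAB : #|T|%:R + #|A :&: B|%:R = #|A|%:R + #|B|%:R :> R.
    by rewrite -!natrD -cardsUI AB cardsT.
  move: hE; rewrite -(ler_nat R) natrD => hE.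
  have : D * #|A :&: B|%:R <= D * (al * D) by rewrite ler_wpM2l //; lra.
  have : D * #|A|%:R + D * #|B|%:R = D * #|T|%:R + D * #|A :&: B|%:R by rewrite -!mulrDr cAB.
  rewrite expr2 in eG hA hB *; lra.
apply/andP; split.
  apply: ltW; apply: le_lt_trans eG.
  have : al * D * D <= al * D * #|T|%:R by rewrite ler_wpM2l // mulr_ge0 //; lra.
  rewrite expr2; lra.
(* Minimality in edges: after deleting one edge the deficit al D^2 >= 1 is reached. *)
have [E0|[e0 e0E]] := set_0Vmem (edges G).
  by rewrite E0 cards0 mulr_ge0 ?ler0n //; lra.
have E1 : [forall e in edges G :\ e0, #|e| == 2%N].
  by apply/forall_inP => e; rewrite inE => /andP[_ /(forall_inP (edges_card2 G))].
pose G1 := SGraph E1.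
have m1 : has_minor G G1.
  apply: subgraph_minor; exists id => // e; rewrite imset_id inE => /andP[_ ->] //.
have c1 : #|edges G| = #|edges G1|.+1 by rewrite (cardsD1 e0) e0E.
have := minE G1 m1 ltac:(by rewrite c1).
rewrite c1 -natr1; lra.
Qed.

Definition piece (T : finType) (G : sgraph T) (gm D : R) (P : {set T}) : Prop :=
  [/\ cut_dense G (gm / 8) P, gm * D / 2 <= #|P|%:R & #|P|%:R <= 4 * D].

(** The density gm D is split in two: half remains as average degree, which bounds |P| from below,
    and half pays for cut-density gm/8, because |W| <= 4 D. *)
Lemma exists_piece (T : finType) (G : sgraph T) (W : {set T}) (gm D : R) :
  0 < gm -> W != set0 -> #|W|%:R <= 4 * D -> gm * D * #|W|%:R <= (arcs G W W)%:R ->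
  exists2 P : {set T}, P \subset W & piece G gm D P.
Proof.
move=> g0 W0 WD hW.
have h : gm * D / 2 * #|W|%:R + gm / 8 * #|W|%:R ^+ 2 <= (arcs G W W)%:R.
  apply: le_trans hW; have : 0 <= #|W|%:R * (4 * D - #|W|%:R) by rewrite mulr_ge0 // subr_ge0.
  move=> /(mulr_ge0 (ltW g0)); lra.
have [P sP [P0 cP eP]] := exists_cut_dense W0 h.
exists P => //; split=> //; last by apply: le_trans WD; rewrite ler_nat subset_leq_card.
have p0 : 0 < #|P|%:R :> R by rewrite ltr0n card_gt0.
have : (arcs G P P)%:R <= #|P|%:R * #|P|%:R :> R by rewrite -natrM ler_nat arcs_le.
move=> /(le_trans eP) h2; rewrite -(ler_pM2r p0); apply: le_trans h2.
by rewrite lerDl mulr_ge0 ?exprn_ge0 // divr_ge0 // ltW.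
Qed.

(* Take a maximal disjoint family of pieces inside neighbourhoods of vertices of low degree: if it is short, these vertices send almost all their edges to its union. *)
Lemma pieces_or_small_subgraph (T : finType) (G : sgraph T) (gm D : R) (M : nat) :
  0 < gm -> gm <= 1 / 8 -> 1 <= gm * D -> (0 < #|T|)%N ->
  (forall x : T, D < #|nbhd G x|%:R) ->
  (forall x y : T, adj G x y -> D < #|nbhd G x :&: nbhd G y|%:R + 1) ->
  (1 - gm) * D * #|T|%:R <= #|edges G|%:R <= D * #|T|%:R ->
  (exists Ps : nat -> {set T}, (forall i, (i < M)%N -> piece G gm D (Ps i)) /\
     (forall i j, (i < M)%N -> (j < M)%N -> i != j -> [disjoint Ps i & Ps j])) \/
  (exists2 V : {set T}, V != set0 &
     #|V|%:R <= 16 * (M%:R + 1) / gm * D /\ 2 * ((1 - 4 * gm) * D) * #|V|%:R <= (arcs G V V)%:R).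
Proof.
move=> g0 g8 gD T0 degD triD /andP[eG1 eG2].
have D0 : 0 < D by rewrite -(pmulr_rgt0 _ g0); exact: lt_le_trans gD.
have D1 : 1 <= D by apply: le_trans gD _; rewrite ger_pMl //; lra.
have v0 : 0 < #|T|%:R :> R by rewrite ltr0n.
elim: M => [|M [[Ps [hP dP]]|[V V0 [cV eV]]]].
- by left; exists (fun _ => set0).
- pose U := \bigcup_(i < M) Ps i.
  have cU : #|U|%:R <= M%:R * (4 * D).
    apply: (@le_trans _ _ (\sum_(i < M) #|Ps i|%:R)).
      by rewrite -natr_sum ler_nat; exact: leq_card_bigcup.
    rewrite -[M in M%:R * _]card_ord mulr_natl -sumr_const; apply: ler_sum => i _.
    by have [] := hP i (ltn_ord i).
  (* The average degree is at most 2 D, so at least half of the vertices are low. *)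
  pose low := [set x | #|nbhd G x|%:R <= 4 * D].
  have [/existsP[x /andP[xl /andP[W0 eW]]]|nx] :=
    boolP [exists x, (x \in low) && ((nbhd G x :\: U != set0) &&
      (gm * D * #|nbhd G x :\: U|%:R <= (arcs G (nbhd G x :\: U) (nbhd G x :\: U))%:R))].
    have cW : #|nbhd G x :\: U|%:R <= 4 * D.
      rewrite inE in xl; apply: le_trans xl; rewrite ler_nat subset_leq_card //; exact: subsetDl.
    have [P sP pP] := exists_piece g0 W0 cW eW.
    left; exists (fun i => if (i < M)%N then Ps i else P); split=> [i iM|i j iM jM ij].
      by case: ifP => [/hP//|_].
    have dPU k : (k < M)%N -> [disjoint Ps k & P].
      move=> kM; rewrite disjoint_sym; apply: disjointWl sP _.
      rewrite disjoint_sym disjoints_subset setCD; apply: subset_trans (subsetUr _ _).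
      exact: (bigcup_sup (Ordinal kM)).
    case: ifP => [iM'|iM']; case: ifP => [jM'|jM'].
    + exact: dP.
    + exact: dPU.
    + by rewrite disjoint_sym; exact: dPU.
    by move: iM jM ij iM' jM'; clear; lia.
  right.
  (* Each y in W = N(x) minus U has about D neighbours in N(x), while W itself spans fewer than gm D
     |W| arcs. So on average almost D of them lie in N(x) and U, which therefore has almost D
     elements. *)
  have nbU x : x \in low -> (1 - 2 * gm) * D <= (deg_in G U x)%:R.
    move=> xl; have := existsPn nx x; rewrite xl /=.
    set W := nbhd G x :\: U; rewrite negb_and negbK => /orP[W0|].
      have : (#|nbhd G x| <= deg_in G U x)%N.
        by apply: subset_leq_card; rewrite subsetI subxx -setD_eq0.
      rewrite -(ler_nat R) => h; have := degD x; have : 0 <= gm * D by lra.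
      lra.
    rewrite -ltNge => eW.
    have W0 : W != set0.
      by apply: contraTneq eW => ->; rewrite cards0 mulr0 -leNgt.
    have w0 : 0 < #|W|%:R :> R by rewrite ltr0n card_gt0.
    have nE : nbhd G x = W :|: (nbhd G x :&: U) by rewrite setUC setID.
    have dWU : [disjoint W & nbhd G x :&: U].
      by rewrite disjoints_subset; apply/subsetP => y; rewrite !inE negb_and => /andP[-> _]; rewrite orbT.
    have h1 : (D - 1) * #|W|%:R <= (arcs G W W)%:R + #|W|%:R * (deg_in G U x)%:R.
      apply: (@le_trans _ _ (arcs G W (nbhd G x))%:R); last first.
        rewrite [in X in X <= _]nE arcsUr // natrD lerD2l -natrM ler_nat; exact: arcs_le.
      rewrite /arcs natr_sum mulrC mulr_natl -sumr_const; apply: ler_sum => y.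
      rewrite !inE => /andP[_ xy]; rewrite lerBlDr; apply/ltW.
      by have := triD x y xy; rewrite setIC.
    have h2 : (D - 1 - gm * D) * #|W|%:R <= (deg_in G U x)%:R * #|W|%:R by lra.
    rewrite ler_pM2r // in h2; lra.
  (* A graph on O(D) vertices is already the wanted dense subgraph. *)
  have [Tsmall|Tbig] := lerP #|T|%:R (16 * (M.+1%:R + 1) / gm * D).
    exists [set: T]; first by rewrite -card_gt0 cardsT.
    rewrite cardsT; split=> //; rewrite arcsT natrM.
    have : 0 <= gm * D * #|T|%:R by rewrite !mulr_ge0 // ltW.
    lra.
  have clow : #|T|%:R <= 2 * #|low|%:R :> R.
    have h : (#|~: low|%:R) * (4 * D) <= 2 * (D * #|T|%:R).
      apply: (@le_trans _ _ (2 * #|edges G|%:R)); last by rewrite ler_pM2l.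
      rewrite -natrM -arcsT.
      apply: (@le_trans _ _ (arcs G (~: low) setT)%:R); last first.
        by rewrite ler_nat arcs_sub // subsetT.
      rewrite /arcs natr_sum mulr_natl -sumr_const; apply: ler_sum => x.
      by rewrite !inE -ltNge /deg_in setIT => /ltW.
    have cl : #|T|%:R = #|low|%:R + #|~: low|%:R :> R by rewrite -natrD cardsC.
    have : #|~: low|%:R * 2 <= #|T|%:R :> R.
      rewrite -(ler_pM2r (_ : 0 < 2 * D)) ?mulr_gt0 //; lra.
    lra.
  pose m1 : R := M%:R + 1.
  have m1E : M.+1%:R = m1 :> R by rewrite -natr1.
  have Mm1 : M%:R = m1 - 1 by rewrite /m1 addrK.
  have m10 : 1 <= m1 by rewrite /m1 lerDr.
  pose q := m1 * D / gm.
  have qg : q * gm = m1 * D by rewrite divfK // gt_eqF.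
  have mD : D <= m1 * D by rewrite ler_peMl // ltW.
  have q0 : 0 <= q by rewrite divr_ge0 ?mulr_ge0 // ltW // (lt_le_trans _ m10).
  have qD : 8 * (m1 * D) <= q by have := mulr_ge0 q0 (_ : 0 <= 1 - 8 * gm); rewrite subr_ge0 => /(_ ltac:(lra)); lra.
  have D'q : 16 * (M.+1%:R + 1) / gm * D = 16 * q + 16 * (D / gm).
    by rewrite /q m1E; field; rewrite gt_eqF.
  have Dg0 : 0 <= D / gm by rewrite divr_ge0 // ltW.
  (* Y is taken so large that |U| <= gm k: adding U hardly changes the vertex count, and the arcs
     between Y and U alone give the density. *)
  pose k := (Num.truncn (4 * q)).+1.
  have k1 : 4 * q <= k%:R by apply/ltW/truncnS_gt.
  have k2 : k%:R <= 4 * q + 1.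
    by rewrite /k -natr1 lerD2r truncn_le // mulr_ge0.
  have cLU : (k <= #|low :\: U|)%N.
    rewrite -(ler_nat R).
    have : #|low|%:R <= #|low :\: U|%:R + #|U|%:R :> R.
      rewrite -natrD ler_nat -(cardsID U low) addnC leq_add2l subset_leq_card //; exact: subsetIr.
    rewrite Mm1 in cU; rewrite D'q in Tbig; lra.
  have [Y sY cY] : exists2 Y : {set T}, Y \subset low :\: U & #|Y| = k.
    exists [set x in take k (enum (low :\: U))].
      by apply/subsetP => x; rewrite inE => /mem_take; rewrite mem_enum.
    rewrite cardsE; have /card_uniqP -> := take_uniq k (enum_uniq (low :\: U)).
    by rewrite size_takel // -cardE.
  have dUY : [disjoint U & Y].
    rewrite disjoint_sym disjoints_subset; apply/subsetP => x /(subsetP sY).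
    by rewrite !inE => /andP[].
  have cUY : #|U :|: Y|%:R = #|U|%:R + k%:R :> R.
    by rewrite -natrD -cY -cardsUI (disjoint_setI0 dUY) cards0 addn0.
  exists (U :|: Y).
    by rewrite -card_gt0 -(ltr_nat R) cUY ltr_wpDl // ltr0n.
  rewrite cUY; split; first by rewrite D'q; rewrite Mm1 in cU; lra.
  apply: (@le_trans _ _ (2 * ((1 - 2 * gm) * D * k%:R))).
    have : (1 - 4 * gm) * (#|U|%:R + k%:R) <= (1 - 2 * gm) * k%:R.
      have hU : #|U|%:R <= gm * k%:R.
        rewrite Mm1 in cU; have := ler_wpM2l (ltW g0) k1; lra.
      have : 0 <= (1 - 4 * gm) * (gm * k%:R - #|U|%:R) by rewrite mulr_ge0 //; lra.
      have : 0 <= gm * gm * k%:R by rewrite !mulr_ge0 // ltW.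
      have : 0 <= gm * k%:R by rewrite mulr_ge0 // ltW.
      lra.
    by move=> /(ler_wpM2l (ltW D0)); lra.
  apply: (@le_trans _ _ (2 * (arcs G U Y)%:R)); last first.
    by rewrite -natrM ler_nat arcsUU // leq_addl.
  rewrite ler_pM2l // arcsC /arcs natr_sum -cY mulr_natr -sumr_const; apply: ler_sum => x xY.
  by apply: nbU; have := subsetP sY x xY; rewrite inE => /andP[].
right; exists V => //; split=> //; apply: le_trans cV _.
rewrite ler_wpM2r ?(ltW D0) // ler_wpM2r ?invr_ge0 ?(ltW g0) //.
by rewrite ler_pM2l // lerD2r ler_nat.
Qed.

End MinimalMinor.

(** * Embedding into disjoint cut-dense sets *)

Section HubPaths.
Variables (T : finType) (G : sgraph T).
Implicit Types (A P Q X : {set T}).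

Lemma rconn_connected Q : rconn (adj G) Q -> connected_in G Q.
Proof. by case=> x xQ h; exact: connected_in_root xQ h. Qed.

(** Take the component of s in Q minus P. Either it contains e, or it can be extended by one vertex
    of P. *)
Lemma first_hit P Q s e : connected_in G Q -> s \in Q -> e \in Q ->
  (exists Q' : {set T}, [/\ Q' \subset Q, connected_in G Q', s \in Q', e \in Q' & [disjoint Q' & P]]) \/
  (exists f (Q1 : {set T}), [/\ Q1 \subset Q, connected_in G Q1, s \in Q1, f \in Q1 & Q1 :&: P = [set f]]).
Proof.
move=> cQ sQ eQ; have [sP|sP] := boolP (s \in P).
  right; exists s, [set s]; rewrite sub1set sQ set11; split=> //; first exact: connected_in1.
  by apply/setIidPl; rewrite sub1set.
have sD : s \in Q :\: P by rewrite inE sP sQ.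
pose C := comp G (Q :\: P) s.
have sC : s \in C by rewrite inE sD connect0.
have CQP : C \subset Q :\: P by exact: comp_sub.
have CQ : C \subset Q := subset_trans CQP (subsetDl _ _).
have cC : connected_in G C by exact: comp_connected.
have dC : [disjoint C & P] by apply: disjointWl CQP _; rewrite disjoints_subset setDE subsetIr.
have [eC|eC] := boolP (e \in C); first by left; exists C.
have [u [v [uQ vQ uC vC uv]]] := connected_exit cQ sQ eQ sC eC.
have vP : v \in P.
  by apply: contraNT vC => vP; apply: comp_closed uC _ uv; rewrite inE vP.
right; exists v, (v |: C); split=> //.
- by rewrite subUset sub1set vQ.
- by apply: (connected_in_U1 (y := u)) => //; rewrite adjC.
- by rewrite inE sC orbT.
- exact: setU11.
by rewrite setIUl (disjoint_setI0 dC) setU0; apply/setIidPl; rewrite sub1set.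
Qed.

(** A finite function, so that a system of minimum total size can be selected. *)
Definition path_system A P0 (Q : {ffun T -> {set T}}) : Prop :=
  (forall a, a \in A -> [/\ connected_in G (Q a), a \in Q a & exists2 b, b \in P0 & b \in Q a]) /\
  (forall a b, a \in A -> b \in A -> a != b -> [disjoint Q a & Q b]).

(** A path meeting P is cut at its first entry from either end, and the two entries are joined by a
    link inside P; it then uses at most L + 2 vertices of P. *)
Lemma reroute A P0 P (Q : {ffun T -> {set T}}) w L : path_system A P0 Q -> robust G P P w L -> (#|A| * (L + 2) < w)%N ->
  exists2 Q' : {ffun T -> {set T}}, path_system A P0 Q' &
    (\sum_(a in A) #|Q' a| <= \sum_(a in A) #|Q a :\: P| + #|A| * (L + 2))%N.
Proof.
move=> [Qok Qdis] rob cnt.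
(* [D a] says whether the path from [a] is rerouted. *)
have /choice[D hD] : forall a, exists D : bool * (T * T) * ({set T} * {set T}), a \in A ->
    if D.1.1 then
      [/\ D.2.1 \subset Q a, D.2.2 \subset Q a, connected_in G D.2.1 /\ connected_in G D.2.2,
          [/\ a \in D.2.1, D.1.2.1 \in D.2.1, D.1.2.2 \in D.2.2 & exists2 b, b \in P0 & b \in D.2.2] &
          D.2.1 :&: P = [set D.1.2.1] /\ D.2.2 :&: P = [set D.1.2.2]]
    else [/\ D.2.1 \subset Q a, connected_in G D.2.1, a \in D.2.1,
          [disjoint D.2.1 & P] & exists2 b, b \in P0 & b \in D.2.1].
  move=> a; have [aA|aA] := boolP (a \in A); last by exists (true, (a, a), (set0, set0)).
  have [cQ aQ [b bP0 bQ]] := Qok a aA.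
  case: (first_hit P cQ aQ bQ) => [[Q' [sQ' cQ' aQ' bQ' dQ']]|[f [Q1 [sQ1 cQ1 aQ1 fQ1 eQ1]]]].
    by exists (false, (a, a), (Q', set0)) => _ /=; split=> //; exists b.
  case: (first_hit P cQ bQ aQ) => [[Q' [sQ' cQ' bQ' aQ' dQ']]|[l [Q2 [sQ2 cQ2 bQ2 lQ2 eQ2]]]].
    by exists (false, (a, a), (Q', set0)) => _ /=; split=> //; exists b.
  by exists (true, (f, l), (Q1, Q2)) => _ /=; split=> //; split=> //; exists b.
pose J := {a | a \in [set a in A | (D a).1.1]}.
have JA (j : J) : val j \in A /\ (D (val j)).1.1.
  by have := valP j; rewrite inE => /andP[].
pose s (j : J) := (D (val j)).1.2.1.
pose t (j : J) := (D (val j)).1.2.2.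
have sP j : s j \in P /\ t j \in P.
  have [jA jD] := JA j; have := hD _ jA; rewrite jD => -[_ _ _ _ [e1 e2]].
  have : s j \in (D (val j)).2.1 :&: P by rewrite e1 set11.
  have : t j \in (D (val j)).2.2 :&: P by rewrite e2 set11.
  by rewrite !inE => /andP[_ ->] /andP[_ ->].
(* The retained parts of all paths meet P only in U, so links inside P that avoid U avoid all of
   them. *)
pose U := [set s j | j : J] :|: [set t j | j : J].
have cJ : (#|{: J}| <= #|A|)%N.
  rewrite card_sig; apply: subset_leq_card; apply/subsetP => x; by rewrite !inE => /andP[].
have [||lk [lk1 lk2]] := @multilink T G J s t (fun _ => P) w L U.
- by move=> j U' hU'; have [sj tj] := sP j; exact: rob.
- move=> j; apply: leq_ltn_trans cnt; rewrite mulnDr addnC; apply: leq_add.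
    rewrite mulnC leq_mul2r; apply/orP; right.
    exact: leq_trans (max_card _) cJ.
  apply: leq_trans (subset_leq_card (subsetIl _ _)) _.
  apply: leq_trans (leq_card_setU _ _) _; rewrite muln2 -addnn; apply: leq_add.
    exact: leq_trans (leq_imset_card _ _) cJ.
  exact: leq_trans (leq_imset_card _ _) cJ.
pose Ra a := if insub a is Some j then lk (j : J) else set0.
have Ra_J (j : J) : Ra (val j) = lk j by rewrite /Ra valK.
pose Q' : {ffun T -> {set T}} := [ffun a => if (D a).1.1 then ((D a).2.1 :|: (D a).2.2) :|: Ra a else (D a).2.1].
have RaP a : a \in A -> (D a).1.1 -> exists j : J, val j = a.
  move=> aA aD; have h : a \in [set a in A | (D a).1.1] by rewrite inE aA.
  by exists (exist _ a h).
pose old a := if (D a).1.1 then (D a).2.1 :|: (D a).2.2 else (D a).2.1.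
have oldQ a : a \in A -> old a \subset Q a.
  move=> aA; rewrite /old; have := hD a aA; case: ((D a).1.1) => -[] //.
  by move=> s1 s2 _ _ _; rewrite subUset s1.
have oldP a : a \in A -> old a :&: P \subset U.
  move=> aA; rewrite /old; have := hD a aA; case aD: ((D a).1.1).
    move=> [_ _ _ _ [e1 e2]]; rewrite setIUl e1 e2.
    have [j ja] := RaP a aA aD; apply: setUSS; rewrite sub1set; apply/imsetP; exists j => //.
      by rewrite /s ja.
    by rewrite /t ja.
  by move=> [_ _ _ d _]; rewrite (disjoint_setI0 d) sub0set.
have Q'E a : Q' a = old a :|: (if (D a).1.1 then Ra a else set0).
  by rewrite ffunE /old; case: ifP => // _; rewrite setU0.
have oldlk a j : a \in A -> [disjoint old a & lk j].
  move=> aA; have [sl _ _] := lk1 j; apply/pred0P => x /=; apply/negP => /andP[xo xl].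
  have := subsetP sl x xl; rewrite inE => /andP[/negP xU xP]; apply: xU.
  by apply: (subsetP (oldP a aA)); rewrite inE xo.
exists Q'.
  split=> [a aA|a b aA bA ab].
    rewrite ffunE; have := hD a aA; case aD: ((D a).1.1); last by move=> [? ? ? ? ?]; split.
    move=> [_ _ [c1 c2] [a1 f1 l2 [b bP b2]] _].
    have [j ja] := RaP a aA aD; have [_ _ /andP[cl /exists_inP[z zl zt]]] := lk1 j.
    rewrite -ja Ra_J ja; split; first last.
    - by exists b => //; rewrite !inE b2 orbT.
    - by rewrite !inE a1.
    have -> : (D a).2.1 :|: (D a).2.2 :|: lk j = ((D a).2.1 :|: (s j |: lk j)) :|: (D a).2.2.
      have sD : s j \in (D a).2.1 by rewrite /s ja.
      apply/setP => x; rewrite !inE; case: (eqVneq x (s j)) => [->|_] /=; first by rewrite sD.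
      by rewrite -!orbA; congr (_ || _); rewrite orbC.
    apply: (connected_inU (x := z) (y := t j)) => //.
    - apply: (connected_inU (x := s j) (y := s j)) => //; rewrite ?setU11 ?eqxx //.
      by rewrite /s ja.
    - by rewrite in_setU zl orbT.
    - by rewrite /t ja.
    by rewrite zt orbT.
  rewrite !Q'E; have dab : [disjoint old a & old b].
    by apply: disjointWl (oldQ a aA) (disjointWr (oldQ b bA) (Qdis a b aA bA ab)).
  apply/pred0P => x /=; apply/negP; rewrite !in_setU => /andP[/orP[xa|xa] /orP[xb|xb]].
  - by have /pred0P/(_ x) := dab; rewrite /= xa xb.
  - move: xb; case: ifP => [bD xb|_]; last by rewrite inE.
    have [j jb] := RaP b bA bD; rewrite -jb Ra_J in xb.
    by have /pred0P/(_ x) := oldlk a j aA; rewrite /= xa xb.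
  - move: xa; case: ifP => [aD xa|_]; last by rewrite inE.
    have [j ja] := RaP a aA aD; rewrite -ja Ra_J in xa.
    by have /pred0P/(_ x) := oldlk b j bA; rewrite /= xa xb.
  move: xa xb; case: ifP => [aD xa|_]; last by rewrite inE.
  case: ifP => [bD xb|_]; last by rewrite inE.
  have [j ja] := RaP a aA aD; have [j' jb] := RaP b bA bD.
  rewrite -ja Ra_J in xa; rewrite -jb Ra_J in xb.
  have jj' : j != j' by apply: contra ab => /eqP e; rewrite -ja -jb e.
  by have /pred0P/(_ x) := lk2 j j' jj'; rewrite /= xa xb.
rewrite -sum_nat_const -big_split /=; apply: leq_sum => a aA.
rewrite Q'E; apply: leq_trans (leq_card_setU _ _) _.
have -> : (#|old a| = #|old a :\: P| + #|old a :&: P|)%N by rewrite addnC cardsID.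
rewrite -addnA; apply: leq_add; first by rewrite subset_leq_card // setSD // oldQ.
rewrite addnC; apply: leq_add.
  case: ifP => [aD|_]; last by rewrite cards0.
  by have [j ja] := RaP a aA aD; rewrite -ja Ra_J; have [] := lk1 j.
rewrite /old; have := hD a aA; case aD: ((D a).1.1).
  move=> [_ _ _ _ [e1 e2]]; rewrite setIUl e1 e2.
  by apply: leq_trans (leq_card_setU _ _) _; rewrite !cards1.
by move=> [_ _ _ d _]; rewrite (disjoint_setI0 d) cards0.
Qed.

(** Menger's theorem gives one system; take one of minimum total size. Rerouting it through any
    single [Ps k] cannot shrink it, which bounds its intersection with every [Ps k] at once. *)
Lemma hub_paths A P0 (K : finType) (Ps : K -> {set T}) w L :
  (forall X Y : {set T}, X :|: Y = [set: T] -> X :\: Y != set0 -> Y :\: X != set0 ->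
     (forall u v, u \in X :\: Y -> v \in Y :\: X -> ~~ adj G u v) -> (#|A| <= #|X :&: Y|)%N) ->
  (#|A| <= #|P0|)%N -> (forall k, robust G (Ps k) (Ps k) w L) -> (#|A| * (L + 2) < w)%N ->
  exists Q : {ffun T -> {set T}}, path_system A P0 Q /\
    forall k, (#|Ps k :&: \bigcup_(a in A) Q a| <= #|A| * (L + 2))%N.
Proof.
move=> conn AP0 rob cnt.
have rC : symmetric (adj G) by exact: adjC.
have lk : linked (adj G) P0 A #|A|.
  apply: menger => // X /(separatesC rC) sX; rewrite leqNgt; apply/negP => ltX.
  have ex (Y : {set T}) : (#|X| < #|Y|)%N -> exists2 y, y \in Y & y \notin X.
    move=> lt; have /subsetPn[y yY yX] : ~~ (Y \subset X).
      by apply: contraTN lt => /subset_leq_card; rewrite -leqNgt.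
    by exists y.
  have [a aA aX] := ex A ltX; have [b bP bX] := ex P0 (leq_trans ltX AP0).
  (* Reachability from A turns a separating set X into the separation (C + X, complement of C) of
     order |X|. *)
  pose C := [set v | (v \notin X) && [exists a in A, (a \notin X) && connect (avoiding (adj G) X) a v]].
  have CX z : z \in C -> z \notin X by rewrite inE => /andP[].
  have e1 : (C :|: X) :|: ~: C = [set: T].
    by apply/setP => z; rewrite in_setU in_setU in_setC in_setT; case: (z \in C); rewrite ?orbT.
  have e2 : (C :|: X) :\: ~: C = C.
    by apply/setP => z; rewrite in_setD in_setU in_setC negbK; case: (z \in C).
  have e3 : (C :|: X) :&: ~: C = X.
    apply/setP => z; rewrite in_setI in_setU in_setC.
    by case zC: (z \in C); rewrite ?andbT ?andbF // (negPf (CX z zC)).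
  have := conn (C :|: X) (~: C) e1; rewrite e2 e3.
  rewrite leqNgt ltX => h; apply: notF; apply: h.
  - apply/set0Pn; exists a; rewrite inE aX; apply/exists_inP; exists a => //.
    by rewrite aX connect0.
  - apply/set0Pn; exists b; rewrite !inE negb_or bX /=.
    rewrite andbT andbb; apply/negP => /exists_inP[a' a'A /andP[a'X]]; apply/negP.
    exact: sX.
  move=> u v uC; rewrite in_setD in_setU in_setC negb_or => /andP[/andP[nv vX] _].
  apply: contra nv => uv; rewrite inE vX.
  move: uC; rewrite inE => /andP[uX /exists_inP[a' a'A /andP[a'X a'u]]].
  apply/exists_inP; exists a' => //; rewrite a'X; apply: connect_trans a'u (connect1 _).
  by rewrite /avoiding /= uX vX.
have [_ [Q0 [c0 z0 m0 d0]]] := linked_onto lk (leqnn _).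
have Q0ok : `[< path_system A P0 [ffun a => Q0 a] >].
  apply/asboolP; split=> [a aA|a b aA bA ab]; rewrite !ffunE; last exact: d0.
  split; [exact/rconn_connected/c0|exact: z0|exact: m0].
case: (arg_minnP (P := fun Q : {ffun T -> {set T}} => `[< path_system A P0 Q >]) (fun Q : {ffun T -> {set T}} => \sum_(a in A) #|Q a|)%N Q0ok).
move=> Q /asboolP Qok Qmin; exists Q; split=> // k.
have [Q' Q'ok leQ'] := reroute Qok (rob k) cnt.
have := leq_trans (Qmin Q' (introT (asboolP _) Q'ok)) leQ'.
have -> : (\sum_(a in A) #|Q a| = \sum_(a in A) #|Q a :\: Ps k| + \sum_(a in A) #|Q a :&: Ps k|)%N.
  by rewrite -big_split /=; apply: eq_bigr => a _; rewrite addnC cardsID.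
rewrite leq_add2l; apply: leq_trans.
rewrite setIC big_distrl /=; apply: leq_trans (leq_card_bigcup _ _ _) _.
by [].
Qed.

End HubPaths.

(** * Distributing a cover over cut-dense sets *)

Section SparseEmbedding.

Lemma card_fibers (I V : finType) (E : {set I * V}) :
  #|E| = (\sum_i #|[set v | (i, v) \in E]|)%N.
Proof.
transitivity (\sum_i \sum_(v | (i, v) \in E) 1)%N.
  by rewrite pair_big_dep -sum1_card; apply: eq_bigl => -[i v].
by apply: eq_bigr => i _; rewrite sum1_card -cardsE.
Qed.

Lemma choose_roots (T C K : finType) (kc : C -> K) (Z : K -> {set T}) :
  (forall k, (#|[set c | kc c == k]| <= #|Z k|)%N) ->
  (forall k k', k != k' -> [disjoint Z k & Z k']) ->
  exists f : C -> T, injective f /\ forall c, f c \in Z (kc c).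
Proof.
move=> cZ dZ; have [x0 _|T0] := pickP [pred x : T | true]; last first.
  have noC (c : C) : False.
    have : (0 < #|Z (kc c)|)%N.
      by apply: leq_trans (cZ (kc c)); rewrite card_gt0; apply/set0Pn; exists c; rewrite inE.
    by move=> /card_gt0P[x _]; have := T0 x.
  have /choice[f _] : forall c : C, exists x : T, True by move=> c; case: (noC c).
  by exists f; split=> [c|c]; case: (noC c).
pose F (c : C) := enum [set c' | kc c' == kc c].
pose f c := nth x0 (enum (Z (kc c))) (index c (F c)).
have lt c : (index c (F c) < size (enum (Z (kc c))))%N.
  rewrite -cardE; apply: leq_trans (cZ (kc c)); rewrite cardE index_mem mem_enum inE //.
have fZ c : f c \in Z (kc c) by rewrite -mem_enum mem_nth.
exists f; split=> // c d fcd; have kcd : kc c = kc d.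
  apply/eqP/negPn/negP => /dZ/pred0P/(_ (f c)); by rewrite /= fZ fcd fZ.
have FE : F c = F d by rewrite /F kcd.
move: fcd => /eqP; rewrite /f kcd nth_uniq ?enum_uniq //; last by rewrite -kcd.
rewrite FE => /eqP e; rewrite -(nth_index c (s := F d) (x := c)) ?e ?nth_index // mem_enum inE ?kcd //.
Qed.

Variables (T V I K : finType) (Gm : sgraph T) (G : sgraph V).
Variables (B : I -> {set V}) (g : I -> K) (P0 : {set T}) (Ps : K -> {set T}) (w L : nat).

Definition overlap : {set V} := [set v | (1 < #|[set i | v \in B i]|)%N].

(** A vertex v has a copy (i, v) for every part B i containing it, placed in [Ps (g i)], where the
    edges of the part are realised as links. Copies of a vertex in several parts are prolonged by
    disjoint paths to [P0] and merged there. *)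
Lemma sparse_embedding (Rr := (\sum_i #|B i :&: overlap|)%N) :
  (forall v, exists i, v \in B i) ->
  (forall u v, adj G u v -> exists i, (u \in B i) && (v \in B i)) ->
  (forall X Y : {set T}, X :|: Y = [set: T] -> X :\: Y != set0 -> Y :\: X != set0 ->
     (forall u v, u \in X :\: Y -> v \in Y :\: X -> ~~ adj Gm u v) -> (Rr <= #|X :&: Y|)%N) ->
  (forall k k', k != k' -> [disjoint Ps k & Ps k']) -> (forall k, [disjoint P0 & Ps k]) ->
  robust Gm P0 P0 w L -> (forall k, robust Gm (Ps k) (Ps k) w L) ->
  (w <= #|P0|)%N -> (forall k, w <= #|Ps k|)%N ->
  (Rr * (L + 2) + L * Rr < w)%N ->
  (forall k, Rr * (L + 2) + \sum_(i | g i == k) (#|B i| + L * arcs G (B i) (B i)) < w)%N ->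
  has_minor Gm G.
Proof.
move=> cov ecov conn dPs dP0 rob0 robs w0 ws hubw grw.
pose Cp := {c : I * V | c.2 \in B c.1}.
pose Lk (c : Cp) := (val c).2 \in overlap.
pose kc (c : Cp) := g (val c).1.
have ccop k : (#|[set c | kc c == k]| = \sum_(i | g i == k) #|B i|)%N.
  rewrite -(card_imset _ val_inj) card_fibers [RHS]big_mkcond; apply: eq_bigr => i _.
  case: (boolP (g i == k)) => gi.
    apply: eq_card => v; rewrite inE; apply/imsetP/idP => [[c _ e]|vB].
      by have := valP c; rewrite -e.
    by exists (exist _ (i, v) vB); rewrite // inE.
  apply/eqP; rewrite cards_eq0 -subset0; apply/subsetP => v; rewrite inE => /imsetP[c].
  by rewrite inE /kc => cg e; rewrite -e /= (negPf gi) in cg.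
have cLk : (#|[set c | Lk c]| = Rr)%N.
  rewrite -(card_imset _ val_inj) card_fibers; apply: eq_bigr => i _.
  apply: eq_card => v; rewrite !inE; apply/imsetP/andP => [[c]|[vB vX]].
    by rewrite inE /Lk => cX e; have := valP c; move: cX; rewrite -e /= inE.
  by exists (exist _ (i, v) vB); rewrite // inE /Lk /= inE.
have grc k : (#|[set c | kc c == k]| + Rr * (L + 2) < w)%N.
  by apply: leq_ltn_trans (grw k); rewrite ccop addnC leq_add2l leq_sum // => i _; exact: leq_addr.
(* [f1] places the copies of overlapping vertices, where the paths to [P0] start. *)
have [||f1 [f1I f1P]] := @choose_roots T Cp K kc Ps.
- by move=> k; apply: leq_trans (ws k); apply: leq_trans (ltnW (grc k)); exact: leq_addr.
- exact: dPs.
pose A := [set f1 c | c in [set c | Lk c]].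
have cA : #|A| = Rr by rewrite card_imset.
pose Ps' (o : option K) := if o is Some k then Ps k else P0.
have [||||Q [[Qok Qdis] cQ]] := @hub_paths T Gm A P0 (option K) Ps' w L.
- by move=> X Y *; rewrite cA; exact: conn.
- rewrite cA; apply: leq_trans w0; apply: leq_trans (ltnW hubw).
  by apply: leq_trans (leq_addr _ _); rewrite leq_pmulr // addn2.
- by case=> [k|] /=.
- by rewrite cA; apply: leq_ltn_trans hubw; exact: leq_addr.
pose U1 := \bigcup_(a in A) Q a.
(* The other copies are placed after the paths are known, off all of them. *)
have [||f2 [f2I f2P]] := @choose_roots T Cp K kc (fun k => Ps k :\: U1).
- move=> k; have h1 := cQ (Some k); rewrite /= cA -/U1 in h1.
  rewrite -(leq_add2l #|Ps k :&: U1|) cardsID; apply: leq_trans (ws k).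
  by apply: leq_trans (ltnW (grc k)); rewrite addnC leq_add2l.
- by move=> k k' kk'; apply: disjointWl (subsetDl _ _) (disjointWr (subsetDl _ _) (dPs k k' kk')).
have f1A c : Lk c -> f1 c \in A by move=> lc; apply/imsetP; exists c; rewrite ?inE.
pose S c := if Lk c then Q (f1 c) else [set f2 c].
pose rt c := if Lk c then f1 c else f2 c.
have rtS c : rt c \in S c.
  by rewrite /rt /S; case: ifP => lc; rewrite ?set11 //; have [] := Qok _ (f1A c lc).
have rtP c : rt c \in Ps (kc c).
  by rewrite /rt; case: ifP => _ //; have := f2P c; rewrite inE => /andP[].
(* [hb c] is a vertex of [P0] on the path of c; the merging links join these. *)
have /choice[hb hhb] : forall c, exists b, Lk c -> b \in P0 /\ b \in S c.
  move=> c; have [lc|lc] := boolP (Lk c); last by exists (f1 c).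
  by have [_ _ [b bP bQ]] := Qok _ (f1A c lc); exists b; rewrite /S lc.
have /choice[ctr hctr] : forall v, exists c : Cp, (val c).2 = v.
  by move=> v; have [i vi] := cov v; exists (exist _ (i, v) vi).
pose pi (c : Cp) := (val c).2.
have ctr_Lk c : c != ctr (pi c) -> Lk c.
  move=> nc; rewrite /Lk inE; have := hctr (pi c); set d := ctr (pi c) in nc *.
  move=> e; have cd : (val c).1 != (val d).1.
    apply: contra nc => /eqP e1; apply/eqP/val_inj.
    by rewrite [val c]surjective_pairing [val d]surjective_pairing e1 e.
  apply: (@leq_trans #|[set (val c).1; (val d).1]|); first by rewrite cards2 cd.
  apply: subset_leq_card; apply/subsetP => i; rewrite !inE => /orP[]/eqP->.
    exact: (valP c).
  by have := valP d; rewrite e.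
have Lk_ctr c : Lk c -> Lk (ctr (pi c)) by rewrite /Lk hctr.
(* One link for every part and every orientation of an edge inside it; the duplication costs only
   constant factors. *)
pose JE := {j : I * (V * V) | [&& j.2.1 \in B j.1, j.2.2 \in B j.1 & adj G j.2.1 j.2.2]}.
pose JH := {c : Cp | Lk c}.
have JE1 (j : JE) : (val j).2.1 \in B (val j).1 by have /and3P[] := valP j.
have JE2 (j : JE) : (val j).2.2 \in B (val j).1 by have /and3P[] := valP j.
pose c1 (j : JE) : Cp := exist _ ((val j).1, (val j).2.1) (JE1 j).
pose c2 (j : JE) : Cp := exist _ ((val j).1, (val j).2.2) (JE2 j).
pose J : finType := (JE + JH)%type.
pose src (j : J) := match j with inl e => c1 e | inr c => val c end.
pose tgt (j : J) := match j with inl e => c2 e | inr c => ctr (pi (val c)) end.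
pose s (j : J) := match j with inl e => rt (c1 e) | inr c => hb (val c) end.
pose t (j : J) := match j with inl e => rt (c2 e) | inr c => hb (ctr (pi (val c))) end.
(* Links of parts compete only within the same bin, merging links only with one another: two
   separate budgets. *)
pose Zs (j : J) := match j with inl e => Ps (g (val e).1) | inr c => P0 end.
pose U := \bigcup_c S c.
have sS j : s j \in S (src j).
  by case: j => [e|c] /=; [exact: rtS|have [] := hhb _ (valP c)].
have tS j : t j \in S (tgt j).
  by case: j => [e|c] /=; [exact: rtS|have [] := hhb _ (Lk_ctr _ (valP c))].
have UU1 x : x \in U -> x \in U1 \/ exists2 c, x = f2 c & x \in Ps (kc c).
  move=> /bigcupP[c _]; rewrite /S; case: ifP => lc.
    by left; apply/bigcupP; exists (f1 c) => //; exact: f1A.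
  by move=> /set1P->; right; exists c => //; have := f2P c; rewrite inE => /andP[].
have cUP0 : (#|U :&: P0| <= Rr * (L + 2))%N.
  have := cQ None; rewrite /= cA; apply: leq_trans; apply: subset_leq_card; apply/subsetP => x.
  rewrite inE => /andP[/UU1[xU1|[c _ xP]] x0]; first by rewrite inE x0.
  by have /pred0P/(_ x) := dP0 (kc c); rewrite /= x0 xP.
have cUPs k : (#|U :&: Ps k| <= Rr * (L + 2) + #|[set c | kc c == k]|)%N.
  have h1 := cQ (Some k); rewrite /= cA in h1.
  apply: leq_trans (leq_add h1 (leq_imset_card f2 _)).
  apply: leq_trans (leq_card_setU _ _); apply: subset_leq_card; apply/subsetP => x.
  rewrite inE => /andP[/UU1[xU1|[c xc xP]] xk]; first by rewrite !inE xk xU1.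
  rewrite inE; apply/orP; right; apply/imsetP; exists c => //; rewrite inE.
  apply/negPn/negP => kk; have /pred0P/(_ x) := dPs _ _ kk; by rewrite /= xk xP.
have cJH : (#|{: JH}| <= Rr)%N.
  by rewrite card_sig -cLk; apply: subset_leq_card; apply/subsetP => c; rewrite !inE.
have cJE k : (#|[set e : JE | g (val e).1 == k]| <= \sum_(i | g i == k) arcs G (B i) (B i))%N.
  rewrite -(card_imset _ val_inj) card_fibers [leqRHS]big_mkcond; apply: leq_sum => i _.
  case: (boolP (g i == k)) => gi.
    rewrite card_fibers /arcs [leqRHS]big_mkcond; apply: leq_sum => x _.
    case: (boolP (x \in B i)) => xB.
      apply: subset_leq_card; apply/subsetP => y; rewrite inE inE => /imsetP[e _ ee].
      by have /and3P[_ h1 h2] := valP e; move: h1 h2; rewrite -ee !inE => -> ->.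
    rewrite leqn0 cards_eq0 -subset0; apply/subsetP => y; rewrite inE inE => /imsetP[e _ ee].
    by have := JE1 e; rewrite -ee (negPf xB).
  rewrite leqn0 cards_eq0 -subset0; apply/subsetP => y; rewrite inE => /imsetP[e].
  by rewrite inE => ge ee; rewrite -ee /= (negPf gi) in ge.
have dZ x k : x \in Ps k -> [disjoint P0 & Ps k] by move=> _; exact: dP0.
have inl_inj' : injective (@inl JE JH) by move=> a b [].
have inr_inj' : injective (@inr JE JH) by move=> a b [].
have [||lk [lk1 lk2]] := @multilink T Gm J s t Zs w L U.
- case=> [e|c] U' hU' /=.
    by apply: robs hU'; [exact: (rtP (c1 e))|exact: (rtP (c2 e))].
  have [h1 _] := hhb _ (valP c); have [h2 _] := hhb _ (Lk_ctr _ (valP c)).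
  exact: rob0.
- case=> [e|c].
    apply: leq_ltn_trans (grw (g (val e).1)).
    rewrite big_split /= -big_distrr /= addnA; apply: leq_add.
      by rewrite -ccop; exact: cUPs.
    rewrite leq_mul2l; apply/orP; right; apply: leq_trans (cJE (g (val e).1)).
    rewrite -(card_imset _ inl_inj'); apply: subset_leq_card; apply/subsetP => -[e'|c'].
      rewrite inE /= => h; apply/imsetP; exists e' => //; rewrite inE.
      by apply: contraNT h => /dPs.
    by rewrite inE /= dP0.
  apply: leq_ltn_trans hubw; apply: leq_add; first exact: cUP0.
  rewrite leq_mul2l; apply/orP; right; apply: leq_trans cJH.
  rewrite -cardsT -(card_imset _ inr_inj'); apply: subset_leq_card; apply/subsetP => -[e'|c'].
    by rewrite inE /= disjoint_sym dP0.
  by move=> _; apply/imsetP; exists c'; rewrite ?inE.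
apply: (assemble_minor (pi := pi) (S := S) (src := src) (tgt := tgt) (s := s) (t := t) (Q := lk) (ctr := ctr)) => //.
- move=> c; rewrite /S; case: ifP => lc; last exact: connected_in1.
  by have [] := Qok _ (f1A c lc).
- move=> c c' cc'; rewrite /S.
  have nU1 d d' : Lk d -> [disjoint Q (f1 d) & [set f2 d']].
    move=> ld; rewrite disjoint_sym disjoints1; have := f2P d'; rewrite inE => /andP[h _].
    by apply: contra h => h; apply/bigcupP; exists (f1 d) => //; exact: f1A.
  case: ifP => lc; case: ifP => lc'.
  + by apply: Qdis; rewrite ?f1A ?(inj_eq f1I).
  + exact: nU1.
  + by rewrite disjoint_sym nU1.
  by rewrite disjoints1 inE (inj_eq f2I).
- by move=> j; have [_ _ lj] := lk1 j; split.
- move=> j c; have [sl _ _] := lk1 j; apply: disjointWl sl _.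
  rewrite disjoint_sym disjoints_subset setCD; apply: subset_trans (subsetUr _ _).
  exact: bigcup_sup.
- move=> c nc; have lc := ctr_Lk c nc; by exists (inr (exist _ c lc)).
move=> u v uv; right; have [i /andP[ui vi]] := ecov u v uv.
have h : [&& (i, (u, v)).2.1 \in B (i, (u, v)).1, (i, (u, v)).2.2 \in B (i, (u, v)).1 & adj G (i, (u, v)).2.1 (i, (u, v)).2.2].
  by rewrite /= ui vi uv.
by exists (inl (exist _ (i, (u, v)) h)); rewrite /pi /= eqxx.
Qed.

End SparseEmbedding.

(** * Families with strongly sublinear separators *)

(** Classical equality, so that types can be listed and counted as elements of sequences. *)
HB.instance Definition _ := gen_eqMixin gtype.

Section SublinearFamilies.
Variables (R : realType) (F : gfamily).
Local Open Scope ring_scope.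

(** h n = n^(-tau) with tau = (1 - beta)/2. A separator has order about n h(n)^2: one factor h is
    made small against constants, the other matches the growth of h by mu = (4/3)^tau when n drops
    to 3n/4. *)
Lemma decay (beta : R) : beta < 1 -> exists (h : nat -> R) (mu : R),
  [/\ 1 < mu, forall n, (0 < n)%N -> 0 < h n,
      forall n, (0 < n)%N -> n%:R `^ beta = n%:R * h n ^+ 2,
      forall a n, (0 < a)%N -> (4 * a <= 3 * n)%N -> mu * h n <= h a &
      forall dl, 0 < dl -> exists N, forall n, (N <= n)%N -> (0 < n)%N -> h n <= dl].
Proof.
move=> b1; pose tau := (1 - beta) / 2.
have tau0 : 0 < tau by rewrite /tau; lra.
exists (fun n => n%:R `^ (- tau)), ((4 / 3) `^ tau); split.
- have h : 1 `^ tau < (4 / 3) `^ tau :> R by apply: gt0_ltr_powR => //; rewrite ?nnegrE; lra.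
  by rewrite powR1 in h.
- by move=> n n0; rewrite powR_gt0 // ltr0n.
- move=> n n0; have nn : n%:R != 0 :> R by rewrite pnatr_eq0 -lt0n.
  rewrite expr2 -powRD; last by rewrite nn implybT.
  rewrite -{2}[n%:R]powRr1 ?ler0n // -powRD; last by rewrite nn implybT.
  by congr (_ `^ _); rewrite /tau; field.
- move=> a n a0 an; have n0 : (0 < n)%N by clear -a0 an; lia.
  rewrite !powRN; have nn : 0 < n%:R `^ tau :> R by rewrite powR_gt0 // ltr0n.
  have aa : 0 < a%:R `^ tau :> R by rewrite powR_gt0 // ltr0n.
  rewrite -[leRHS]div1r ler_pdivlMr // mulrAC ler_pdivrMr // mul1r -powRM ?ler0n ?divr_ge0 //.
  apply: ge0_ler_powR; rewrite ?nnegrE ?ler0n //; first exact: ltW.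
  have : (4 * a)%:R <= (3 * n)%:R :> R by rewrite ler_nat.
  by rewrite !natrM; lra.
move=> dl dl0; exists (Num.truncn (dl^-1 `^ tau^-1)).+1 => n Nn n0.
rewrite powRN invf_ple ?posrE //; last by rewrite powR_gt0 // ltr0n.
have -> : dl^-1 = (dl^-1 `^ tau^-1) `^ tau.
  by rewrite -powRrM mulVf ?lt0r_neq0 // powRr1 // invr_ge0 ltW.
apply: ge0_ler_powR; rewrite ?nnegrE ?ler0n ?powR_ge0 //; first exact: ltW.
by apply: ltW; apply: lt_le_trans (truncnS_gt _) _; rewrite ler_nat.
Qed.

Lemma separation_no_cross (T : finType) (G : sgraph T) (A B : {set T}) u v :
  separation G A B -> u \in A :\: B -> v \in B :\: A -> ~~ adj G u v.
Proof.
case/and4P => _ /eqP eAB _ _; rewrite !inE => /andP[uB uA] /andP[vA vB].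
apply/negP => uv; have : [set u; v] \in edges_in G A :|: edges_in G B by rewrite eAB.
rewrite !inE => /orP[] /andP[_] /subsetP h.
  by have := h v; rewrite !inE eqxx orbT (negPf vA) => /(_ isT).
by have := h u; rewrite !inE eqxx (negPf uB) => /(_ isT).
Qed.

Lemma nonadj_separation (T : finType) (G : sgraph T) x y : x != y -> ~~ adj G x y ->
  separation G [set~ x] [set~ y].
Proof.
move=> xy nxy; apply/and4P; split.
- apply/eqP/setP => z; rewrite !inE; case: eqP => //= ->; exact: xy.
- apply/eqP/setP => e; rewrite !inE -andb_orr; apply: andb_idr => eG.
  have [a [b [ee ab hab]]] := edgeP eG.
  have [xe|xe] := boolP (x \in e); last first.
    apply/orP; left; apply/subsetP => z ze; rewrite !inE.
    by apply: contraNneq xe => <-.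
  have [ye|ye] := boolP (y \in e); last first.
    apply/orP; right; apply/subsetP => z ze; rewrite !inE.
    by apply: contraNneq ye => <-.
  exfalso; move: nxy; rewrite (_ : adj G x y); first by [].
  rewrite /adj; suff <- : e = [set x; y] by [].
  apply/esym/eqP; rewrite eqEcard subUset !sub1set xe ye cards2 xy.
  by rewrite (eqP (forall_inP (edges_card2 G) _ eG)).
- by apply/set0Pn; exists y; rewrite !inE eqxx eq_sym xy.
- by apply/set0Pn; exists x; rewrite !inE eqxx xy.
Qed.

Hypothesis hF : strongly_sublinear_separators R F.

(* Complete graphs have no separation, but large ones are not in [F]: deleting an edge leaves a graph of [F] all of whose separations have order [#|T| - 2]. *)
Lemma sublinear_separation : exists (c : R) (h : nat -> R) (mu : R) (m0 : nat),
  [/\ 0 < c, 1 < mu, forall n, (0 < n)%N -> 0 < h n,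
      forall a n, (0 < a)%N -> (4 * a <= 3 * n)%N -> mu * h n <= h a &
      (forall dl, 0 < dl -> exists N, forall n, (N <= n)%N -> (0 < n)%N -> h n <= dl) /\
      forall (T : finType) (G : sgraph T), F G -> (m0 <= #|T|)%N ->
        exists A B, [/\ separation G A B, balanced A B &
          #|A :&: B|%:R <= c * (#|T|%:R * h #|T| ^+ 2)]].
Proof.
case: hF => Fsub [beta [c [b1 c0 sepF]]].
have [h [mu [mu1 h0 hb hm hl]]] := decay b1.
(* Then c h^2 <= 1/12, so the separator has at most n/12 vertices, against n - 2 in the complete
   graph minus an edge; impossible for n >= 3. *)
pose d := Num.min 1 (1 / (12 * c)).
have d0 : 0 < d by rewrite /d lt_min ltr01 /= divr_gt0 // mulr_gt0.
have [N hN] := hl d d0.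
exists c, h, mu, (maxn N 3); do 2 split=> //.
move=> T G FG; rewrite geq_max => /andP[NT T3].
suff : exists A B, separation G A B.
  move=> hs; have [A [B [s1 s2 s3]]] := sepF T G FG hs; exists A, B; split=> //.
  by rewrite hb // in s3; clear -T3; lia.
apply: contrapT => nosep.
have comp x y : x != y -> adj G x y.
  move=> xy; apply: contrapT => /negP nxy; apply: nosep; do 2 eexists; exact: (nonadj_separation xy nxy).
have [x0 [y0 xy0]] : exists x0 y0 : T, x0 != y0.
  have : (1 < #|[set: T]|)%N by rewrite cardsT; clear -T3; lia.
  by move=> /card_gt1P[x [y [_ _ xy]]]; exists x, y.
pose G' := mkgraph [rel u v | adj G u v && ([set u; v] != [set x0; y0])].
have G'E u v : adj G' u v = (u != v) && ([set u; v] != [set x0; y0]).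
  rewrite adj_mkgraph /= (adjC G v u) (setUC [set v]) orbb.
  by case: (boolP (u != v)) => //= uv; rewrite comp.
have FG' : F G'.
  apply: Fsub FG; exists id => [//|e /edgeP[u [v [-> uv _]]]].
  by rewrite imset_id; exact: comp.
have [|A [B [s1 s2 s3]]] := sepF T G' FG'.
  by do 2 eexists; apply: (nonadj_separation xy0); rewrite G'E xy0 eqxx.
have cross u v : u \in A :\: B -> v \in B :\: A -> [set u; v] = [set x0; y0].
  move=> uA vB; have := separation_no_cross s1 uA vB.
  rewrite G'E negb_and !negbK => /orP[/eqP uv|/eqP//].
  by move: uA vB; rewrite uv !inE => /andP[/negPf-> ->].
have set2_inj (a b z : T) : [set a; z] = [set b; z] -> a = b.
  move=> e; have : a \in [set b; z] by rewrite -e !inE eqxx.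
  have : b \in [set a; z] by rewrite e !inE eqxx.
  by rewrite !inE => /orP[/eqP->//|/eqP->]; rewrite orbb => /eqP.
case/and4P: (s1) => /eqP AB _ /set0Pn[a aA] /set0Pn[b bB].
have cA : (#|A :\: B| <= 1)%N.
  apply/card_le1P => u uA v; apply/idP/idP => [vA|/eqP->//].
  rewrite inE; apply/eqP; apply: (@set2_inj _ _ b); by rewrite (cross v b) // (cross u b).
have cB : (#|B :\: A| <= 1)%N.
  apply/card_le1P => u uA v; apply/idP/idP => [vA|/eqP->//].
  by rewrite inE; apply/eqP; apply: (@set2_inj _ _ a); rewrite [LHS]setUC [RHS]setUC (cross a v) // (cross a u).
have T0 : (0 < #|T|)%N by clear -T3; lia.
have cT : (#|T| <= #|A :&: B| + 2)%N.
  rewrite -cardsT -AB; have := cardsUI A B; have := cardsID B A; have := cardsID A B.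
  rewrite (setIC B A); clear -cA cB; lia.
have := hN _ NT T0; rewrite le_min => /andP[h1 h2].
have hh : c * h #|T| ^+ 2 <= 1 / 12.
  have h3 : h #|T| ^+ 2 <= 1 / (12 * c).
    rewrite expr2; apply: le_trans h2; rewrite ler_piMl //; exact/ltW/h0.
  have := ler_wpM2l (ltW c0) h3; have -> : c * (1 / (12 * c)) = 1 / 12 by field; rewrite lt0r_neq0.
  by [].
have cTR : #|T|%:R <= #|A :&: B|%:R + 2 :> R by rewrite -(natrD _ _ 2) ler_nat.
have T3R : 3 <= #|T|%:R :> R by rewrite ler_nat.
rewrite hb // in s3.
have : c * (#|T|%:R * h #|T| ^+ 2) <= #|T|%:R * (1 / 12) by rewrite mulrCA ler_wpM2l.
lra.
Qed.

Definition cover_by (T : finType) (G : sgraph T) (r : seq {set T}) : Prop :=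
  (forall v, exists2 B : {set T}, B \in r & v \in B) /\
  (forall u v, adj G u v -> exists2 B : {set T}, B \in r & (u \in B) && (v \in B)).

Lemma cover_by1 (T : finType) (G : sgraph T) : cover_by G [:: [set: T]].
Proof. by split=> *; exists [set: T]; rewrite ?inE. Qed.

Lemma cover_by_separation (T : finType) (G : sgraph T) (A1 A2 : {set T})
    (r1 : seq {set {x | x \in A1}}) (r2 : seq {set {x | x \in A2}}) :
  separation G A1 A2 -> cover_by (induced G A1) r1 -> cover_by (induced G A2) r2 ->
  cover_by G ([seq [set val x | x in B] | B : {set {x | x \in A1}} <- r1] ++
              [seq [set val x | x in B] | B : {set {x | x \in A2}} <- r2]).
Proof.
move=> sA [v1 e1] [v2 e2]; split=> [v|u v uv].
  have : v \in A1 :|: A2 by case/and4P: sA => /eqP->; rewrite inE.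
  case/setUP => vA.
    have [B Br vB] := v1 (exist _ v vA); exists [set val x | x in B].
      by rewrite mem_cat map_f.
    exact: (imset_f val vB).
  have [B Br vB] := v2 (exist _ v vA); exists [set val x | x in B].
    by rewrite mem_cat orbC map_f.
  exact: (imset_f val vB).
have : [set u; v] \in edges_in G A1 :|: edges_in G A2 by case/and4P: sA => _ /eqP->.
rewrite !inE !subUset !sub1set => /orP[] /andP[_ /andP[uA vA]].
  have [|B Br /andP[uB vB]] := e1 (exist _ u uA) (exist _ v vA); first by rewrite adj_induced.
  exists [set val x | x in B]; first by rewrite mem_cat map_f.
  by rewrite (imset_f val uB) (imset_f val vB).
have [|B Br /andP[uB vB]] := e2 (exist _ u uA) (exist _ v vA); first by rewrite adj_induced.
exists [set val x | x in B]; first by rewrite mem_cat orbC map_f.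
by rewrite (imset_f val uB) (imset_f val vB).
Qed.

(* Split along balanced separations, with the potential [n * (1 + eps - h n)]: [h] gains a factor [mu] at each split, which pays for the vertices of the separator. *)
Lemma sublinear_cover (eps : R) : 0 < eps -> exists s : nat,
  forall (T : finType) (G : sgraph T), F G -> exists r : seq {set T},
    [/\ cover_by G r, forall B, B \in r -> (#|B| <= s)%N &
        (\sum_(B <- r) #|B|)%:R <= (1 + eps) * #|T|%:R].
Proof.
move=> eps0; have [c [h [mu [m0 [c0 mu1 h0 hm [hl sep]]]]]] := sublinear_separation.
(* Bounds on h, in this order: the potential is at least n in the base case; h^2 <= h; separators
   have at most n/12 vertices, so both sides have at most 3n/4; and the gain (mu - 1) h n pays for
   the separator. *)
pose d := Num.min eps (Num.min 1 (Num.min (1 / (12 * c)) ((mu - 1) / ((1 + eps) * c)))).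
have d0 : 0 < d.
  rewrite /d !lt_min eps0 ltr01 !divr_gt0 ?mulr_gt0 //; lra.
have [N hN] := hl d d0.
(* Above 3 s0 vertices, both sides of a balanced separation keep at least s0 vertices, so the
   induction applies to them. *)
pose s0 := (m0 + N + 1)%N; exists (3 * s0)%N => T G FG.
suff main n : forall (T : finType) (G : sgraph T), (#|T| <= n)%N -> F G -> (s0 <= #|T|)%N ->
    exists r : seq {set T}, [/\ cover_by G r, forall B, B \in r -> (#|B| <= 3 * s0)%N &
        (\sum_(B <- r) #|B|)%:R <= (1 + eps - h #|T|) * #|T|%:R].
  have [Ts|Ts] := leqP s0 #|T|.
    have [r [r1 r2 r3]] := main _ T G (leqnn _) FG Ts; exists r; split=> //.
    apply: le_trans r3 _; rewrite ler_wpM2r // lerBlDr lerDl; apply/ltW/h0.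
    by clear -Ts; lia.
  exists [:: [set: T]]; split; first exact: cover_by1.
    by move=> B; rewrite inE => /eqP->; rewrite cardsT; clear -Ts; lia.
  by rewrite big_seq1 cardsT; have := ler0n R #|T|; nra.
elim: n => [|n IH] {FG G T}T G Tn FG Ts; first by exfalso; clear -Tn Ts; lia.
have T0 : (0 < #|T|)%N by clear -Ts; lia.
have NT : (N <= #|T|)%N by clear -Ts; lia.
have := hN _ NT T0; rewrite !le_min => /and4P[h1 h2 h3 h4].
have := h0 _ T0; set hT := h #|T| in h1 h2 h3 h4 *; move=> hT0.
have tR0 : 0 <= #|T|%:R :> R by [].
have [Tb|Tb] := leqP #|T| (3 * s0).
  exists [:: [set: T]]; split; first exact: cover_by1.
    by move=> B; rewrite inE => /eqP->; rewrite cardsT.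
  by rewrite big_seq1 cardsT; nra.
have [|A1 [A2 [sA /andP[bA1 bA2] oA]]] := sep T G FG; first by clear -Ts; lia.
rewrite -/hT in oA.
have hc1 : c * hT ^+ 2 <= 1 / 12.
  have h5 : hT ^+ 2 <= 1 / (12 * c) by rewrite expr2; apply: le_trans h3; rewrite ler_piMl // ltW.
  have := ler_wpM2l (ltW c0) h5; have -> : c * (1 / (12 * c)) = 1 / 12 by field; rewrite lt0r_neq0.
  by [].
have hc2 : (1 + eps) * c * hT <= mu - 1.
  by rewrite mulrC -ler_pdivlMr // mulr_gt0 //; lra.
have oA1 : #|A1 :&: A2|%:R <= #|T|%:R * (1 / 12) :> R.
  by apply: le_trans oA _; rewrite mulrCA ler_wpM2l.
have oA1n : (12 * #|A1 :&: A2| <= #|T|)%N by rewrite -(ler_nat R) natrM; lra.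
have sumA : (#|A1| + #|A2| = #|T| + #|A1 :&: A2|)%N.
  by rewrite -cardsUI; case/and4P: sA => /eqP->; rewrite cardsT.
have s00 : (0 < s0)%N by rewrite /s0; clear; lia.
have Find (A : {set T}) : F (induced G A) by case: hF => Fsub _; exact: Fsub (subgraph_induced G A) FG.
have [r1 [cr1 sr1 wr1]] : exists r : seq {set {x | x \in A1}}, [/\ cover_by (induced G A1) r,
    forall B, B \in r -> (#|B| <= 3 * s0)%N &
    (\sum_(B <- r) #|B|)%:R <= (1 + eps - h #|A1|) * #|A1|%:R].
  rewrite -(card_induced A1); apply: IH; rewrite ?card_induced; [|exact: Find|]; clear -bA1 bA2 sumA oA1n Tn Tb s00; lia.
have [r2 [cr2 sr2 wr2]] : exists r : seq {set {x | x \in A2}}, [/\ cover_by (induced G A2) r,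
    forall B, B \in r -> (#|B| <= 3 * s0)%N &
    (\sum_(B <- r) #|B|)%:R <= (1 + eps - h #|A2|) * #|A2|%:R].
  rewrite -(card_induced A2); apply: IH; rewrite ?card_induced; [|exact: Find|]; clear -bA1 bA2 sumA oA1n Tn Tb s00; lia.
have ci (A : {set T}) (B : {set {x | x \in A}}) : #|[set val x | x in B]| = #|B|.
  by rewrite card_imset //; exact: val_inj.
eexists; split; first exact: (cover_by_separation sA cr1 cr2).
  move=> B; rewrite mem_cat => /orP[] /mapP[B' B'r ->]; rewrite ci; [exact: sr1|exact: sr2].
have hA (A : {set T}) : (#|T| <= 3 * #|A|)%N -> (4 * #|A| <= 3 * #|T|)%N ->
  (1 + eps - h #|A|) * #|A|%:R <= (1 + eps - mu * hT) * #|A|%:R.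
  move=> a1 a2; rewrite ler_wpM2r // lerD2l lerN2; apply: hm => //.
  by clear -a1 T0; lia.
have hA1 : (1 + eps - h #|A1|) * #|A1|%:R <= (1 + eps - mu * hT) * #|A1|%:R.
  by apply: hA => //; clear -bA1 bA2 sumA oA1n; lia.
have hA2 : (1 + eps - h #|A2|) * #|A2|%:R <= (1 + eps - mu * hT) * #|A2|%:R.
  by apply: hA => //; clear -bA1 bA2 sumA oA1n; lia.
rewrite big_cat /= !big_map natrD.
under eq_bigr do rewrite ci; under [X in _ + X%:R]eq_bigr do rewrite ci.
have sumR : #|A1|%:R + #|A2|%:R = #|T|%:R + #|A1 :&: A2|%:R :> R by rewrite -!natrD sumA.
have key : (1 + eps) * #|A1 :&: A2|%:R <= (mu - 1) * hT * #|T|%:R.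
  have e1 : (1 + eps) * #|A1 :&: A2|%:R <= (1 + eps) * (c * (#|T|%:R * hT ^+ 2)).
    by rewrite ler_wpM2l //; lra.
  apply: le_trans e1 _.
  have -> : (1 + eps) * (c * (#|T|%:R * hT ^+ 2)) = ((1 + eps) * c * hT) * (hT * #|T|%:R) by ring.
  by rewrite -[leRHS]mulrA ler_wpM2r // mulr_ge0 // ltW.
have o0 : 0 <= mu * hT * #|A1 :&: A2|%:R by rewrite !mulr_ge0 //; [lra|exact: ltW].
have -> : (1 + eps - hT) * #|T|%:R = (1 + eps - mu * hT) * (#|A1|%:R + #|A2|%:R)
   + ((mu - 1) * hT * #|T|%:R - (1 + eps) * #|A1 :&: A2|%:R) + mu * hT * #|A1 :&: A2|%:R.
  by rewrite sumR; ring.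
rewrite mulrDr; lra.
Qed.

Lemma card_cover (T : finType) (r : seq {set T}) :
  (\sum_(B <- r) #|B| = \sum_v #|[set i : 'I_(size r) | v \in nth set0 r i]|)%N.
Proof.
rewrite (big_nth set0) big_mkord; under eq_bigr do rewrite -sum1_card big_mkcond.
rewrite exchange_big; apply: eq_bigr => v _; rewrite -big_mkcond -sum1_card.
by apply: eq_bigl => i; rewrite inE.
Qed.

(** The total size of the cover exceeds n by at most (eps/2) n. An overlapping vertex of
    multiplicity mu contributes mu - 1 >= mu/2 to this excess, so all multiplicities of overlapping
    vertices sum to at most eps n. *)
Lemma sublinear_overlap (eps : R) : 0 < eps -> exists s : nat,
  forall (T : finType) (G : sgraph T), F G -> exists (m : nat) (B : 'I_m -> {set T}),
    [/\ forall v, exists i, v \in B i,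
        forall u v, adj G u v -> exists i, (u \in B i) && (v \in B i),
        forall i, (#|B i| <= s)%N,
        #|overlap B|%:R <= eps * #|T|%:R &
        (\sum_i #|B i :&: overlap B|)%:R <= eps * #|T|%:R /\
        (\sum_i #|B i|)%:R <= (1 + eps) * #|T|%:R].
Proof.
move=> eps0; have [|s hs] := @sublinear_cover (eps / 2); first by rewrite divr_gt0.
exists s => T G FG; have [r [[c1 c2] r2 r3]] := hs T G FG.
pose B (i : 'I_(size r)) := nth set0 r i; exists (size r), B.
have inr (C : {set T}) : C \in r -> exists i, B i = C.
  move=> Cr; have h : (index C r < size r)%N by rewrite index_mem.
  by exists (Ordinal h); rewrite /B /= nth_index.
pose mu v := #|[set i | v \in B i]|.
have mu1 v : (1 <= mu v)%N.
  have [C /inr[i <-] vC] := c1 v; rewrite card_gt0; apply/set0Pn; exists i; by rewrite inE.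
have sB : (\sum_i #|B i| = \sum_v mu v)%N by rewrite -card_cover (big_nth set0) big_mkord.
have sO : (\sum_i #|B i :&: overlap B| = \sum_(v in overlap B) mu v)%N.
  have e i : #|B i :&: overlap B| = (\sum_(v in overlap B) (v \in B i))%N.
    rewrite -sum1_card big_mkcond [RHS]big_mkcond; apply: eq_bigr => v _.
    by rewrite inE andbC; case: (v \in overlap B) => //; case: (v \in B i).
  under eq_bigr do rewrite e.
  rewrite exchange_big; apply: eq_bigr => v _; rewrite /mu -sum1_card [RHS]big_mkcond.
  by apply: eq_bigr => i _; rewrite inE; case: (v \in B i).
have tot : (\sum_v mu v = \sum_(v in overlap B) mu v + \sum_(v in ~: overlap B) mu v)%N.
  by rewrite (bigID [in overlap B]) /=; congr (_ + _)%N; apply: eq_bigl => v; rewrite ?[_ \in ~: _]inE.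
have h1 : (#|~: overlap B| <= \sum_(v in ~: overlap B) mu v)%N.
  by rewrite -sum1_card; apply: leq_sum.
have h2 : (2 * #|overlap B| <= \sum_(v in overlap B) mu v)%N.
  by rewrite -sum1_card big_distrr; apply: leq_sum => v; rewrite inE.
have h3 := cardsC (overlap B).
rewrite (big_nth set0) big_mkord sB in r3.
have t0 : 0 <= #|T|%:R :> R by [].
have {}h3 : #|overlap B|%:R + #|~: overlap B|%:R = #|T|%:R :> R by rewrite -natrD h3.
have {}h1 : #|~: overlap B|%:R <= (\sum_(v in ~: overlap B) mu v)%:R :> R by rewrite ler_nat.
have {}h2 : 2 * #|overlap B|%:R <= (\sum_(v in overlap B) mu v)%:R :> R by rewrite -natrM ler_nat.
have {}tot : (\sum_v mu v)%:R = (\sum_(v in overlap B) mu v)%:R + (\sum_(v in ~: overlap B) mu v)%:R :> R.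
  by rewrite tot natrD.
split.
- by move=> v; have [C /inr[i <-] vC] := c1 v; exists i.
- by move=> u v uv; have [C /inr[i <-] vC] := c2 u v uv; exists i.
- by move=> i; apply: r2; rewrite mem_nth.
- nra.
rewrite sO sB; split; nra.
Qed.

Lemma arcs_cover (T I : finType) (G : sgraph T) (B : I -> {set T}) :
  (forall u v, adj G u v -> exists i, (u \in B i) && (v \in B i)) ->
  (arcs G [set: T] [set: T] <= \sum_i arcs G (B i) (B i))%N.
Proof.
move=> cB; rewrite /arcs.
have e (A : {set T}) : (\sum_(x in A) deg_in G A x = \sum_x \sum_y ((x \in A) && (y \in A) && adj G x y))%N.
  rewrite big_mkcond; apply: eq_bigr => x _; rewrite deg_inE.
  case: (x \in A) => /=; last by rewrite big1.
  by rewrite big_mkcond; apply: eq_bigr => y _; case: (y \in A).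
rewrite e; under [leqRHS]eq_bigr do rewrite e.
rewrite [leqRHS]exchange_big; apply: leq_sum => x _; rewrite [leqRHS]exchange_big; apply: leq_sum => y _.
rewrite !inE /=; have [/cB[i /andP[xi yi]]|//] := boolP (adj G x y).
by rewrite (bigD1 i) //= xi yi.
Qed.

(** Parts of size at most s span at most s |B| arcs each, and their total size is at most 2n. *)
Lemma sublinear_sparse : exists2 C : nat, (0 < C)%N & forall (T : finType) (G : sgraph T), F G ->
  (#|edges G| <= C * #|T|)%N.
Proof.
have [s hs] := sublinear_overlap ltr01; exists s.+1 => // T G FG.
have [m [B [_ cB sB _ [_ tB]]]] := hs T G FG.
have h1 := arcs_cover cB; rewrite arcsT in h1.
have h2 : (\sum_i arcs G (B i) (B i) <= \sum_i s * #|B i|)%N.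
  by apply: leq_sum => i _; apply: leq_trans (arcs_le _ _ _) _; rewrite leq_mul.
rewrite -big_distrr /= in h2.
have h3 : (\sum_i #|B i| <= 2 * #|T|)%N by rewrite -(ler_nat R) natrM.
rewrite -(leq_pmul2l (isT : 0 < 2)%N); apply: leq_trans h1 _; apply: leq_trans h2 _.
by rewrite mulnCA leq_mul.
Qed.

Definition realizes (T : finType) (G : sgraph T) (D : {set T}) (t : gtype) : Prop :=
  exists f : 'I_(tag t) -> T, [/\ injective f, f @: [set: 'I_(tag t)] = D &
    forall p q, adj (tagged t) p q = adj G (f p) (f q)].

Definition type_of (T : finType) (G : sgraph T) (D : {set T}) : gtype :=
  Tagged (fun h => sgraph 'I_h)
    (mkgraph [rel p q : 'I_#|D| | adj G (enum_val p) (enum_val q)]).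

Lemma type_ofP (T : finType) (G : sgraph T) (D : {set T}) : realizes G D (type_of G D).
Proof.
exists (fun p => enum_val p); split.
- exact: enum_val_inj.
- apply/setP => x; apply/imsetP/idP => [[p _ ->]|xD]; first exact: enum_valP.
  by exists (enum_rank_in xD x); rewrite ?inE // enum_rankK_in.
move=> p q; rewrite adj_mkgraph /= (adjC G (enum_val q)) orbb.
by case: eqP => //= ->; rewrite adjxx.
Qed.

Lemma realizes_copies (T I : finType) (G : sgraph T) (D : I -> {set T}) (t : gtype) (A : {set I}) :
  (forall i j, i != j -> [disjoint D i & D j]) -> (forall i, i \in A -> realizes G (D i) t) ->
  subgraph (copies #|A| (tagged t)) G.
Proof.
move=> dD rD; have rf (j : 'I_#|A|) := rD _ (enum_valP j).
pose f j := sval (cid (rf j)); have fP j : [/\ injective (f j), f j @: [set: 'I_(tag t)] = D (enum_val j) &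
    forall p q, adj (tagged t) p q = adj G (f j p) (f j q)] := svalP (cid (rf j)).
exists (fun x : 'I_#|A| * 'I_(tag t) => f x.1 x.2).
  move=> [i p] [j q] /= fe; have [ij|ij] := eqVneq i j.
    by subst j; have [fi _ _] := fP i; rewrite (fi _ _ fe).
  have h : enum_val i != enum_val j by rewrite (inj_eq enum_val_inj).
  have [_ Di _] := fP i; have [_ Dj _] := fP j.
  have /pred0P/(_ (f i p)) := dD _ _ h; rewrite /= -Di imset_f ?inE //= fe -Dj imset_f ?inE //.
move=> e /imset2P[j e' _ /edgeP[p [q [-> _ pq]]] ->].
have [_ _ fa] := fP j.
by rewrite -imset_comp imsetU !imset_set1 /=; rewrite fa in pq.
Qed.

Definition small_types (s : nat) : seq gtype :=
  flatten [seq [seq Tagged (fun h => sgraph 'I_h) K | K <- enum {: sgraph 'I_h}] | h <- iota 1 s].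

Lemma small_typesP s (t : gtype) : (t \in small_types s) = (0 < tag t <= s)%N.
Proof.
apply/flatten_mapP/idP => [[h]|].
  by rewrite mem_iota add1n ltnS => hs /mapP[K _ ->].
move=> ht; exists (tag t); first by rewrite mem_iota add1n ltnS.
by apply/mapP; exists (tagged t); rewrite ?mem_enum //; case: t ht.
Qed.

(* A type occurring boundedly often is moved to the exceptional set. *)
Lemma sublinear_types (eps : R) : 0 < eps -> exists (ts : seq gtype) (n0 : nat),
  (forall t : gtype, t \in ts -> (0 < tag t)%N /\ nucleus F (tagged t)) /\
  forall (T : finType) (G : sgraph T), F G -> (n0 <= #|T|)%N ->
    exists (X : {set T}) (I : finType) (D : I -> {set T}) (ty : I -> gtype),
      [/\ #|X|%:R <= eps * #|T|%:R,
          forall i, ty i \in ts /\ realizes G (D i) (ty i),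
          forall i j, i != j -> [disjoint D i & D j],
          forall v, v \notin X <-> exists i, v \in D i &
          forall i j u v, u \in D i -> v \in D j -> adj G u v -> i = j].
Proof.
move=> eps0; have [|s hs] := @sublinear_overlap (eps / 2); first by rewrite divr_gt0.
have hk (t : gtype) : exists k, ~ nucleus F (tagged t) -> ~ F (copies k (tagged t)).
  have [nt|nt] := pselect (nucleus F (tagged t)); first by exists 0%N.
  by have [k hk] : exists k, ~ F (copies k (tagged t)); [exact/existsNP|exists k].
move: hk => /choice[kk hkk].
pose ts : seq gtype := [seq t : gtype <- small_types s | `[< nucleus F (tagged t) >]].
(* Bounds the number of parts of types outside the nucleus, hence n0: the at most K0 s vertices in
   them are at most half of eps n. *)
pose K0 := (\sum_(t <- small_types s) kk t)%N.
exists ts, (Num.truncn ((K0 * s)%:R * 2 / eps)).+1; split.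
  by move=> t; rewrite mem_filter small_typesP => /andP[/asboolP nt /andP[t0 _]].
move=> T G FG nT; have [m [B [cv ce sB oB _]]] := hs T G FG.
(* Without the overlap the parts are pairwise disjoint and no edge joins two of them. *)
pose D i := B i :\: overlap B; pose good i := (D i != set0) && (type_of G (D i) \in ts).
have onlyi i j v : v \in D i -> v \in B j -> j = i.
  rewrite !inE -leqNgt => /andP[/card_le1P le1 vi] vj.
  by have := le1 i; rewrite inE => /(_ vi j); rewrite inE vj => /esym/eqP.
have dD i j : i != j -> [disjoint D i & D j].
  move=> ij; apply/pred0P => v /=; apply/negP => /andP[vi /setDP[vj _]].
  by rewrite (onlyi _ _ _ vi vj) eqxx in ij.
have sD i : (#|D i| <= s)%N by apply: leq_trans (sB i); rewrite subset_leq_card // subsetDl.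
pose X := overlap B :|: \bigcup_(i | ~~ good i) D i.
exists X, {i | good i}, (fun i => D (val i)), (fun i => type_of G (D (val i))); split.
- pose bad := [set i | (D i != set0) && (type_of G (D i) \notin ts)].
  have Xb : (#|X| <= #|overlap B| + #|bad| * s)%N.
    apply: leq_trans (leq_card_setU _ _) _; rewrite leq_add2l.
    apply: leq_trans (leq_card_bigcup _ _ _) _; rewrite -sum_nat_const.
    rewrite [leqRHS]big_mkcond [leqLHS]big_mkcond; apply: leq_sum => i _.
    rewrite /good inE; case: (eqVneq (D i) set0) => [->|_]; first by rewrite cards0.
    by case: ifP.
  have cb : (#|bad| <= K0)%N.
    rewrite -sum1_card.
    apply: (@leq_trans (\sum_(i in bad) \sum_(t <- small_types s) ((t \notin ts) && (type_of G (D i) == t)))%N).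
      apply: leq_sum => i; rewrite inE => /andP[Di nt].
      rewrite (big_rem (type_of G (D i))) /=; first by rewrite nt eqxx.
      by rewrite small_typesP /= sD card_gt0 Di.
    rewrite exchange_big /K0 big_seq [leqRHS]big_seq; apply: leq_sum => t tS.
    (* More than [kk t] parts of type t would put [kk t] disjoint copies of t into F. *)
    rewrite leqNgt; apply/negP => kt.
    have nt : t \notin ts by apply/negP => h; move: kt; rewrite big1 // => i _; rewrite h.
    have nnt : ~ nucleus F (tagged t).
      by move=> h; move: nt; rewrite mem_filter tS andbT => /asboolP.
    pose A := [set i in bad | type_of G (D i) == t].
    have cA : (kk t < #|A|)%N.
      apply: leq_trans kt _; rewrite -sum1_card big_mkcond [leqRHS]big_mkcond; apply: leq_sum => i _.
      by rewrite [_ \in A]inE; case: ifP => // _; rewrite nt; case: eqP.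
    have [A' sA' cA'] : exists2 A' : {set 'I_m}, A' \subset A & #|A'| = kk t.
      exists [set x in take (kk t) (enum A)].
        by apply/subsetP => x; rewrite inE => /mem_take; rewrite mem_enum.
      rewrite cardsE (card_uniqP _) ?take_uniq ?enum_uniq // size_takel // -cardE; exact: ltnW.
    apply: (hkk t nnt); case: hF => Fsub _; apply: Fsub FG; rewrite -cA'.
    apply: (@realizes_copies _ _ _ D _ _ dD) => i /(subsetP sA'); rewrite inE => /andP[_ /eqP<-].
    exact: type_ofP.
  have XR : #|X|%:R <= #|overlap B|%:R + (K0 * s)%:R :> R.
    by rewrite -natrD ler_nat; apply: leq_trans Xb _; rewrite leq_add2l leq_mul2r cb orbT.
  have : (K0 * s)%:R * 2 / eps <= #|T|%:R.
    by apply: ltW; apply: lt_le_trans (truncnS_gt _) _; rewrite ler_nat.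
  rewrite ler_pdivrMr //; lra.
- move=> [i /= /andP[_ it]]; split=> //; exact: type_ofP.
- by move=> [i gi] [j gj] ij /=; apply: dD.
- move=> v; split=> [|[[i gi] /= vi]].
    rewrite !inE negb_or => /andP[vO /bigcupP vD]; have [i vi] := cv v.
    have vDi : v \in D i by rewrite !inE vO vi.
    have gi : good i by apply: contrapT => /negP gi; apply: vD; exists i.
    by exists (exist _ i gi).
  rewrite inE negb_or; apply/andP; split; first by case/setDP: vi.
  apply/bigcupP => -[j gj vj]; have /setDP[vjB _] := vj.
  by rewrite (onlyi _ _ _ vi vjB) gi in gj.
move=> [i gi] [j gj] u v /= ui vj uv; apply: val_inj => /=.
have [k /andP[uk vk]] := ce u v uv.
by rewrite -(onlyi _ _ _ ui uk) -(onlyi _ _ _ vj vk).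
Qed.

End SublinearFamilies.

(** * Upper bound *)

Section Embedding.
Variables (T V : finType) (Gm : sgraph T) (G : sgraph V).
Implicit Types (P Z : {set T}) (w L : nat).

Lemma card_adj_pairs (X : {set V}) :
  #|{: {e : V * V | [&& e.1 \in X, e.2 \in X & adj G e.1 e.2]}}| = arcs G X X.
Proof.
rewrite card_sig -sum1_card /arcs.
under [RHS]eq_bigr do rewrite deg_inE.
rewrite pair_big_dep /= [RHS]big_mkcond [LHS]big_mkcond; apply: eq_bigr => -[u v] _ /=.
by rewrite inE /=; case: (u \in X); case: (v \in X); case: (adj G u v).
Qed.

Lemma robust_minor P w L : robust Gm P P w L -> (w <= #|P|)%N ->
  (#|V| + L * arcs G [set: V] [set: V] < w)%N -> has_minor Gm G.
Proof.
move=> rob wP lw; pose J := {e : V * V | [&& e.1 \in [set: V], e.2 \in [set: V] & adj G e.1 e.2]}.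
have [f [f_inj fP]] : exists f : V -> T, injective f /\ forall v, f v \in P.
  have VP : (#|V| <= #|P|)%N by clear -lw wP; lia.
  exists (fun v => enum_val (widen_ord VP (enum_rank v))); split=> [u v|v]; last exact: enum_valP.
  by move=> /enum_val_inj/(congr1 val) /= h; apply/enum_rank_inj/val_inj.
pose s (j : J) := f (val j).1; pose t (j : J) := f (val j).2; pose U := [set f v | v in [set: V]].
have [||Q [Q1 Q2]] := @multilink T Gm J s t (fun=> P) w L U.
- by move=> j U'; apply: rob; exact: fP.
- move=> j; apply: leq_ltn_trans lw; apply: leq_add.
    apply: leq_trans (subset_leq_card (subsetIl _ _)) _.
    by apply: leq_trans (leq_imset_card _ _) _; rewrite cardsT.
  by rewrite leq_mul2l -card_adj_pairs max_card orbT.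
apply: (assemble_minor (pi := id) (S := fun v => [set f v]) (src := fun j : J => (val j).1)
  (tgt := fun j : J => (val j).2) (s := s) (t := t) (Q := Q) (ctr := id)) => //.
- by move=> v; exact: connected_in1.
- by move=> u v uv; rewrite disjoints1 inE (inj_eq f_inj).
- by move=> j; rewrite !inE !eqxx; have [] := Q1 j.
- move=> j v; have [QU _ _] := Q1 j; rewrite disjoint_sym disjoints1.
  by apply/negP => /(subsetP QU); rewrite !inE imset_f ?inE.
- by move=> c; rewrite eqxx.
move=> u v uv; right; have h : [&& (u, v).1 \in [set: V], (u, v).2 \in [set: V] & adj G (u, v).1 (u, v).2].
  by rewrite !inE.
by exists (exist _ (u, v) h); rewrite /= eqxx.
Qed.

(* Each [y] in [Y] gets a neighbour [h y] in [Z]; greedily taking the vertex of [Z] seen by the most remaining [y] keeps the image small. *)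
Lemma dominating_map (R : realType) (Z Y : {set T}) (kp : R) (K : nat) :
  (0 < kp)%R -> (kp <= 1)%R -> (forall y, y \in Y -> (kp * #|Z|%:R <= (deg_in Gm Z y)%:R)%R) -> Z != set0 ->
  exists2 h : T -> T, forall y, y \in Y -> h y \in Z /\ adj Gm (h y) y &
    (#|h @: Y|%:R <= K%:R + (1 - kp) ^+ K * #|Y|%:R)%R.
Proof.
move=> kp0 kp1; elim: K Y => [|K IH] Y dY Z0.
  have hh y : exists z, y \in Y -> z \in Z /\ adj Gm z y.
    have [yY|yY] := boolP (y \in Y); last by exists y.
    have : (0 < deg_in Gm Z y)%N.
      rewrite -(ltr_nat R); apply: lt_le_trans (dY y yY).
      by rewrite mulr_gt0 // ltr0n card_gt0.
    by rewrite card_gt0 => /set0Pn[z]; rewrite !inE adjC => /andP[? ?]; exists z.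
  have /choice[h hP] := hh; exists h => //.
  by rewrite expr0 mul1r add0r ler_nat leq_imset_card.
have [z zZ hz] : exists2 z, z \in Z & (kp * #|Y|%:R <= (deg_in Gm Y z)%:R)%R.
  apply: contrapT => no; have h1 : (kp * #|Z|%:R * #|Y|%:R <= (arcs Gm Y Z)%:R)%R.
    rewrite /arcs natr_sum mulr_natr -sumr_const; apply: ler_sum => y yY; exact: dY.
  have h2 : ((arcs Gm Z Y)%:R < kp * #|Y|%:R * #|Z|%:R :> R)%R.
    rewrite /arcs natr_sum [ltRHS]mulr_natr -sumr_const.
    have e z : z \in Z -> ((deg_in Gm Y z)%:R < kp * #|Y|%:R :> R)%R.
      by move=> zZ; rewrite ltNge; apply/negP => h; apply: no; exists z.
    apply: ltr_sum => [|z]; last exact: e.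
    by case/set0Pn: Z0 => z zZ; apply/hasP; exists z; rewrite ?mem_index_enum.
  by rewrite arcsC in h2; have := le_lt_trans h1 h2; rewrite mulrAC ltxx.
have [|h hP hc] := IH (Y :\: nbhd Gm z) _ Z0; first by move=> y /setDP[/dY].
exists (fun y => if y \in nbhd Gm z then z else h y).
  move=> y yY; case: ifP => [|yz]; first by rewrite inE.
  by apply: hP; rewrite inE yz.
have c1 : (#|[set if y \in nbhd Gm z then z else h y | y in Y]| <= 1 + #|h @: (Y :\: nbhd Gm z)|)%N.
  rewrite -(cards1 z); apply: leq_trans (leq_card_setU _ _); apply: subset_leq_card.
  apply/subsetP => _ /imsetP[y yY ->]; rewrite !inE; case: ifP => yz; first by rewrite eqxx.
  by apply/orP; right; apply: imset_f; rewrite !inE yz.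
have c2 : (#|Y :\: nbhd Gm z|%:R <= (1 - kp) * #|Y|%:R :> R)%R.
  have h3 : (#|Y :\: nbhd Gm z|%:R + (deg_in Gm Y z)%:R = #|Y|%:R :> R)%R.
    by rewrite -natrD /deg_in setIC addnC cardsID.
  lra.
have {}c1 : (#|[set if y \in nbhd Gm z then z else h y | y in Y]|%:R <= 1 + #|h @: (Y :\: nbhd Gm z)|%:R :> R)%R.
  by rewrite -(natrD _ 1) ler_nat.
have c3 : ((1 - kp) ^+ K * #|Y :\: nbhd Gm z|%:R <= (1 - kp) ^+ K.+1 * #|Y|%:R)%R.
  by rewrite exprSr -mulrA ler_wpM2l // exprn_ge0 // subr_ge0.
rewrite -natr1; lra.
Qed.

(** The vertices x are served one after another inside what is left of Z. At most tau vertices of Z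
    are used in all, so tau + kp |Z| <= w keeps the degree condition of [dominating_map]. The hubs
    need not be connected; links do that later. *)
Lemma disjoint_hubs (R : realType) (Z : {set T}) (Y : V -> {set T}) (X : {set V}) (kp : R) (K : nat) (tau : R) (w : nat) :
  (0 < kp)%R -> (kp <= 1)%R -> (forall x y, x \in X -> y \in Y x -> (w <= deg_in Gm Z y)%N) ->
  (w <= #|Z|)%N ->
  (tau = \sum_(x in X) (K%:R + 1 + (1 - kp) ^+ K * #|Y x|%:R))%R ->
  (tau + kp * #|Z|%:R <= w%:R)%R -> (0 < w)%N ->
  exists Hb : V -> {set T},
    [/\ forall x, x \in X -> Hb x \subset Z /\ Hb x != set0,
        forall x y, x \in X -> y \in Y x -> exists2 z, z \in Hb x & adj Gm z y,
        forall x x', x \in X -> x' \in X -> x != x' -> [disjoint Hb x & Hb x'] &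
        ((\sum_(x in X) #|Hb x|)%:R <= tau)%R].
Proof.
move=> kp0 kp1 dY wZ tauE tw w0.
have Kp0 : (0 <= (1 - kp) ^+ K)%R by rewrite exprn_ge0 // subr_ge0.
have cost0 (x : V) : (0 <= K%:R + 1 + (1 - kp) ^+ K * #|Y x|%:R)%R.
  by rewrite addr_ge0 ?mulr_ge0 // addr_ge0.
suff main : forall s : seq V, uniq s -> {subset s <= X} -> exists Hb : V -> {set T},
    [/\ forall x, x \in s -> Hb x \subset Z /\ Hb x != set0,
        forall x y, x \in s -> y \in Y x -> exists2 z, z \in Hb x & adj Gm z y,
        forall x x', x \in s -> x' \in s -> x != x' -> [disjoint Hb x & Hb x'] &
        ((\sum_(x <- s) #|Hb x|)%:R <= \sum_(x <- s) (K%:R + 1 + (1 - kp) ^+ K * #|Y x|%:R))%R].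
  have [|Hb [h1 h2 h3 h4]] := main (enum X) (enum_uniq _); first by move=> x; rewrite mem_enum.
  exists Hb; split.
  - by move=> x xX; apply: h1; rewrite mem_enum.
  - by move=> x y xX; apply: h2; rewrite mem_enum.
  - by move=> x x' xX xX'; apply: h3; rewrite mem_enum.
  by rewrite tauE; move: h4; rewrite !big_enum.
elim=> [|x s IH] us sX.
  by exists (fun=> set0); split=> //; rewrite !big_nil.
have [xs us'] := andP us.
have [|Hb [h1 h2 h3 h4]] := IH us'; first by move=> y ys; apply: sX; rewrite inE ys orbT.
have xX : x \in X by apply: sX; rewrite inE eqxx.
pose U := \bigcup_(y <- s) Hb y.
have cU : (#|U|%:R + (K%:R + 1 + (1 - kp) ^+ K * #|Y x|%:R) <= tau)%R.
  have e1 : (#|U|%:R <= (\sum_(y <- s) #|Hb y|)%:R :> R)%R by rewrite ler_nat leq_card_bigcup.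
  have e2 : (\sum_(y <- x :: s) (K%:R + 1 + (1 - kp) ^+ K * #|Y y|%:R) <= tau)%R.
    rewrite tauE big_uniq //= [leRHS](bigID [in x :: s]) /=.
    rewrite [X in (_ <= X + _)%R](_ : _ = \sum_(i in x :: s) (K%:R + 1 + (1 - kp) ^+ K * #|Y i|%:R))%R.
      by rewrite lerDl sumr_ge0.
    by apply: eq_bigl => i; apply: andb_idl => /sX.
  rewrite big_cons in e2; lra.
pose Z' := Z :\: U.
have UZ : U \subset Z.
  rewrite /U big_seq; elim/big_ind: _ => [|A B a b|y /h1[]//]; first exact: sub0set.
  by rewrite subUset a b.
have U_lt : (#|U| < w)%N.
  rewrite -(ltr_nat R); apply: lt_le_trans tw; apply: lt_le_trans (_ : tau <= _)%R; last by rewrite lerDl mulr_ge0 // ltW.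
  apply: lt_le_trans cU; rewrite ltrDl -addrA addrC -addrA; rewrite ltr_wpDr //; rewrite ?addr_ge0 // mulr_ge0 //.
have Z'0 : Z' != set0.
  rewrite -card_gt0 cardsD (setIidPr UZ); clear -U_lt wZ; lia.
have [z0 z0Z] := set0Pn _ Z'0.
have [|h hP hc] := @dominating_map R Z' (Y x) kp K kp0 kp1 _ Z'0.
  move=> y yY; have e1 : (w%:R <= (deg_in Gm Z y)%:R :> R)%R by rewrite ler_nat; exact: (dY x).
  have e2 : ((deg_in Gm Z y)%:R <= (deg_in Gm Z' y)%:R + #|U|%:R :> R)%R.
    rewrite -natrD ler_nat /deg_in -(cardsID U) addnC leq_add //.
      by rewrite -setIDA subset_leq_card.
    exact/subset_leq_card/subsetIr.
  have e3 : (kp * #|Z'|%:R <= kp * #|Z|%:R)%R.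
    by apply: ler_wpM2l; [exact: ltW|rewrite ler_nat subset_leq_card // subsetDl].
  have := cost0 x; lra.
(* [z0] keeps the hub nonempty when [Y x] is empty; it is the 1 in the cost. *)
exists (fun y => if y == x then z0 |: (h @: Y x) else Hb y).
have ifs y : y \in s -> (y == x) = false by move=> ys; apply: contraNF xs => /eqP<-.
have xsE y : y \in x :: s -> y = x \/ (y \in s /\ y != x).
  by rewrite inE => /orP[/eqP->|ys]; [left|right; rewrite ys ifs].
have sZ' : z0 |: (h @: Y x) \subset Z'.
  rewrite subUset sub1set z0Z; apply/subsetP => _ /imsetP[y yY ->]; by have [] := hP y yY.
have dis y : y \in s -> [disjoint z0 |: (h @: Y x) & Hb y].
  move=> ys; apply: disjointWl sZ' _; rewrite disjoint_sym disjoints_subset setCD.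
  apply: subset_trans (subsetUr _ _); rewrite /U (big_rem y) //=; exact: subsetUl.
split.
- move=> y /xsE[->|[ys /negPf->]]; last exact: h1.
  rewrite eqxx; split; first exact: subset_trans sZ' (subsetDl _ _).
  by apply/set0Pn; exists z0; rewrite !inE eqxx.
- move=> y y' /xsE[->|[ys /negPf->]]; last exact: h2.
  move=> yY; rewrite eqxx; have [q1 q2] := hP y' yY; exists (h y') => //.
  by rewrite inE imset_f ?orbT.
- move=> y y' /xsE[->|[ys yx]] /xsE[->|[ys' yx']]; rewrite ?eqxx ?(negPf yx) ?(negPf yx') //.
  + by move=> _; exact: dis.
  + by move=> _; rewrite disjoint_sym; exact: dis.
  exact: h3.
rewrite !big_cons eqxx natrD; apply: lerD.
  have : (#|z0 |: h @: Y x|%:R <= 1 + #|h @: Y x|%:R :> R)%R.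
    by rewrite -(natrD _ 1) ler_nat -(cards1 z0) leq_card_setU.
  lra.
by rewrite (@eq_big_seq _ _ _ _ _ _ (fun y => #|Hb y|)) // => y ys; rewrite ifs.
Qed.

(** Each vertex of the hub of x is a copy of x. Links in Z merge the copies and realise the edges
    inside X; edges from X to the outside come from domination, the remaining ones from the models
    S. *)
Lemma dense_embedding (X : {set V}) (V0 Z : {set T}) (S Hb : V -> {set T}) (r : V -> T) w L :
  robust Gm V0 Z w L -> Z \subset V0 ->
  (forall v, v \notin X -> connected_in Gm (S v) /\ [disjoint S v & Z]) ->
  (forall v, v \notin X -> r v \in S v) ->
  (forall u v, u \notin X -> v \notin X -> u != v -> [disjoint S u & S v]) ->
  (forall u v, u \notin X -> v \notin X -> adj G u v ->
     exists x y, [/\ x \in S u, y \in S v & adj Gm x y]) ->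
  (forall x, x \in X -> Hb x \subset Z /\ Hb x != set0) ->
  (forall x v, x \in X -> v \notin X -> adj G x v -> exists2 z, z \in Hb x & adj Gm z (r v)) ->
  (forall x x', x \in X -> x' \in X -> x != x' -> [disjoint Hb x & Hb x']) ->
  (\sum_(x in X) #|Hb x| + L * (\sum_(x in X) #|Hb x| + arcs G X X) < w)%N ->
  has_minor Gm G.
Proof.
move=> rob ZV0 cS rS dS eS HZ He dH lw.
(* A vertex outside X has the single copy [r v], realised by the whole set [S v]. *)
pose Cb v := if v \in X then Hb v else [set r v].
pose Cp := {c : V * T | c.2 \in Cb c.1}.
pose S' (c : Cp) := if (val c).1 \in X then [set (val c).2] else S (val c).1.
have cen v : exists z, z \in Cb v.
  by rewrite /Cb; case: ifP => [/HZ[_ /set0Pn]//|_]; exists (r v); rewrite inE.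
have /choice[z0 z0P] := cen.
pose ctr v : Cp := exist _ (v, z0 v) (z0P v).
pose J1 := {c : V * T | (c.1 \in X) && (c.2 \in Hb c.1)}.
pose J2 := {e : V * V | [&& e.1 \in X, e.2 \in X & adj G e.1 e.2]}.
have inC (x : V) z : x \in X -> z \in Hb x -> (x, z).2 \in Cb (x, z).1 by rewrite /Cb => /= ->.
have J1C (c : J1) : (val c).2 \in Cb (val c).1.
  by case/andP: (valP c) => cX cH; rewrite /Cb cX.
pose src (j : J1 + J2) : Cp := match j with inl c => exist _ (val c) (J1C c) | inr e => ctr (val e).1 end.
pose tgt (j : J1 + J2) : Cp := match j with inl c => ctr (val c).1 | inr e => ctr (val e).2 end.
pose s j := (val (src j)).2; pose t j := (val (tgt j)).2.
have srcX j : (val (src j)).1 \in X by case: j => [c|e] /=; [case/andP: (valP c)|case/and3P: (valP e)].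
have tgtX j : (val (tgt j)).1 \in X by case: j => [c|e] /=; [case/andP: (valP c)|case/and3P: (valP e)].
have CpZ (c : Cp) : (val c).1 \in X -> (val c).2 \in Z.
  by move=> cX; have := valP c; rewrite /Cb cX; have [/subsetP h _] := HZ _ cX; apply: h.
pose U := \bigcup_(x in X) Hb x.
have cJ1 : #|{: J1}| = (\sum_(x in X) #|Hb x|)%N.
  rewrite card_sig -sum1_card (eq_bigr (fun x : V => \sum_(z in Hb x) 1)%N); last by move=> x _; rewrite sum1_card.
  by rewrite pair_big_dep /=; apply: eq_bigl => -[a b]; rewrite inE.
have [||Q [Q1 Q2]] := @multilink T Gm (J1 + J2)%type s t (fun=> Z) w L U.
- by move=> j U'; apply: rob; apply: (subsetP ZV0); apply: CpZ.
- move=> j; apply: leq_ltn_trans lw; apply: leq_add.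
    exact: leq_trans (subset_leq_card (subsetIl _ _)) (leq_card_bigcup _ _ _).
  by rewrite leq_mul2l -cJ1 -card_adj_pairs -card_sum max_card orbT.
have CpU (c : Cp) : (val c).1 \in X -> (val c).2 \in U.
  by move=> cX; have := valP c; rewrite /Cb cX => h; apply/bigcupP; exists (val c).1.
have SX (c : Cp) : (val c).1 \in X -> S' c = [set (val c).2] by rewrite /S' => ->.
apply: (assemble_minor (pi := fun c : Cp => (val c).1) (S := S') (src := src)
  (tgt := tgt) (s := s) (t := t) (Q := Q) (ctr := ctr)) => //.
- by move=> c; rewrite /S'; case: ifP => [_|/negbT/cS[]//]; exact: connected_in1.
- move=> c c' cc'.
  have mix (d d' : Cp) : (val d).1 \in X -> (val d').1 \notin X -> [disjoint S' d & S' d'].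
    move=> dX dX'; rewrite SX // disjoints1 /S' (negPf dX').
    have [_ /pred0P/(_ (val d).2) /=] := cS _ dX'; rewrite (CpZ d dX) andbT => h.
    by rewrite h.
  have [cX|cX] := boolP ((val c).1 \in X); have [cX'|cX'] := boolP ((val c').1 \in X).
  + rewrite !SX // disjoints1 inE; apply: contra cc' => /eqP e2; apply/eqP/val_inj.
    have [e1|ne] := eqVneq (val c).1 (val c').1; first by apply: injective_projections.
    have := valP c; have := valP c'; rewrite /Cb cX cX' -e2 => h h'.
    by have /pred0P/(_ (val c).2) := dH _ _ cX cX' ne; rewrite /= h h'.
  + exact: mix.
  + by rewrite disjoint_sym; exact: mix.
  rewrite /S' (negPf cX) (negPf cX'); apply: dS => //; apply: contra cc' => /eqP e1.
  have := valP c; have := valP c'; rewrite /Cb (negPf cX) (negPf cX') !inE => /eqP h /eqP h'.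
  by apply/eqP/val_inj/injective_projections => //; rewrite h h' e1.
- by move=> j; rewrite !SX // !inE !eqxx; have [] := Q1 j.
- move=> j c; have [QU _ _] := Q1 j; have [cX|cX] := boolP ((val c).1 \in X).
    by rewrite SX // disjoint_sym disjoints1; apply/negP => /(subsetP QU); rewrite !inE CpU.
  rewrite /S' (negPf cX); apply: disjointWl (subset_trans QU (subsetDl _ _)) _.
  by rewrite disjoint_sym; have [] := cS _ cX.
- move=> c nc; have [cX|cX] := boolP ((val c).1 \in X).
    have h : ((val c).1 \in X) && ((val c).2 \in Hb (val c).1) by have := valP c; rewrite /Cb cX.
    by exists (inl (exist _ (val c) h)) => //; apply: val_inj.
  exfalso; apply: (negP nc); apply/eqP/val_inj/injective_projections => //=.
  have := valP c; have := z0P (val c).1; rewrite /Cb (negPf cX) !inE => /eqP-> /eqP->.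
  by [].
have rX v (vX : v \notin X) : (v, r v).2 \in Cb (v, r v).1 by rewrite /Cb /= (negPf vX) inE.
have SrX v (vX : v \notin X) : S' (exist _ (v, r v) (rX v vX)) = S v by rewrite /S' /= (negPf vX).
move=> u v uv; have [uX|uX] := boolP (u \in X); have [vX|vX] := boolP (v \in X).
- right; have h : [&& (u, v).1 \in X, (u, v).2 \in X & adj G (u, v).1 (u, v).2] by rewrite /= uX vX.
  by exists (inr (exist _ (u, v) h)); rewrite /= eqxx.
- left; have [z zH zr] := He u v uX vX uv.
  exists (exist _ (u, z) (inC u z uX zH)), (exist _ (v, r v) (rX v vX)), z, (r v).
  by rewrite SrX SX // inE eqxx rS.
- left; rewrite adjC in uv; have [z zH zr] := He v u vX uX uv.
  exists (exist _ (u, r u) (rX u uX)), (exist _ (v, z) (inC v z vX zH)), (r u), z.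
  by rewrite SrX SX // inE eqxx rS // adjC.
left; have [x [y [xu yv xy]]] := eS u v uX vX uv.
by exists (exist _ (u, r u) (rX u uX)), (exist _ (v, r v) (rX v vX)), x, y; rewrite !SrX.
Qed.

End Embedding.

Section Components.
Variable R : realType.
Local Open Scope ring_scope.

(** As many models of each type are extracted as G has components of that type; they use at most |V|
    vertices in all, so the cost is (1 + eps) B (|V| + c0). Duplicate types are removed so that a
    component has only one position to be counted at. *)
Lemma extract_components (B eps C : R) (ts : seq gtype) : 0 <= B ->
  (forall t : gtype, t \in ts -> frac_pack_bound (tagged t) (B * (tag t)%:R)) ->
  0 < eps -> eps <= 1 -> 0 < C -> exists c0 n0 : nat,
  forall (T V : finType) (Gm : sgraph T) (G : sgraph V) (W : {set T}) (D Dlow : R)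
      (X : {set V}) (I : finType) (Dc : I -> {set V}) (ty : I -> gtype),
    W != set0 -> 2 * D * #|W|%:R <= (arcs Gm W W)%:R -> #|W|%:R <= C * Dlow -> n0%:R < Dlow ->
    Dlow + (1 + eps) * B * (#|V| + c0)%:R <= D ->
    (forall i, ty i \in ts /\ realizes G (Dc i) (ty i)) ->
    (forall i j, i != j -> [disjoint Dc i & Dc j]) ->
    (forall v, v \notin X <-> exists i, v \in Dc i) ->
    (forall i j u v, u \in Dc i -> v \in Dc j -> adj G u v -> i = j) ->
    exists S : V -> {set T},
      [/\ forall v, v \notin X -> connected_in Gm (S v) /\ S v \subset W,
          forall u v, u \notin X -> v \notin X -> u != v -> [disjoint S u & S v] &
          forall u v, u \notin X -> v \notin X -> adj G u v ->
            exists x y, [/\ x \in S u, y \in S v & adj Gm x y]].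
Proof.
move=> B0 fb eps0 eps1 C0; pose us := undup ts.
pose t0 : gtype := Tagged (fun h => sgraph 'I_h) (mkgraph [rel x y : 'I_0 | false]).
have [|c0 [n0 ext]] := @extract_types R B eps C t0 us B0 _ eps0 eps1 C0.
  by move=> i iu; apply: fb; rewrite -mem_undup mem_nth.
exists (c0 * \sum_(i < size us) tag (nth t0 us i))%N, n0.
move=> T V Gm G W D Dlow X I Dc ty W0 aW cW nD hD ty_ts dD cov cross.
pose ks := [seq #|[set i | ty i == t]| | t : gtype <- us].
pose j i := index (ty i) us.
have jP i : (j i < size us)%N /\ nth t0 us (j i) = ty i.
  have [tt _] := ty_ts i; by rewrite /j index_mem nth_index mem_undup tt.
have ksE i : nth 0%N ks (j i) = #|[set i' | ty i' == ty i]|.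
  by have [h1 h2] := jP i; rewrite (nth_map t0) // h2.
have cardD i : #|Dc i| = tag (ty i).
  have [_ [f [fi <- _]]] := ty_ts i.
  by rewrite card_imset // cardsT card_ord.
have sumI : (\sum_i tag (ty i) <= #|V|)%N.
  under eq_bigr do rewrite -cardD.
  have e : (\sum_i #|Dc i| = \sum_i \sum_(v in Dc i) 1)%N by apply: eq_bigr => i _; rewrite sum1_card.
  by rewrite e -(sum_bigcup _ dD) sum1_card max_card.
have sumks : (\sum_(i < size us) tag (nth t0 us i) * nth 0 ks i <= #|V|)%N.
  apply: leq_trans sumI.
  have e : (\sum_i tag (ty i) = \sum_i \sum_(k < size us) (k == j i :> nat) * tag (nth t0 us k))%N.
    apply: eq_bigr => i _; have [h1 h2] := jP i.
    rewrite (bigD1 (Ordinal h1)) //= eqxx mul1n h2 big1 ?addn0 // => k kj.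
    by case: eqP => // kk; case/eqP: kj; apply: val_inj.
  rewrite e exchange_big; apply: leq_sum => k _; rewrite -big_distrl /= mulnC leq_mul2r.
  apply/orP; right; rewrite (nth_map t0) // -sum1_card big_mkcond; apply: leq_sum => i _.
  rewrite inE; case: eqP => // tk; rewrite /j tk index_uniq ?undup_uniq // eqxx //.
have [||M [Vs [V1 V2 V3]]] := ext T Gm W D Dlow ks _ W0 aW cW nD; first by rewrite size_map.
  apply: le_trans hD; rewrite lerD2l; apply: ler_wpM2l; first by rewrite mulr_ge0 //; lra.
  rewrite -natr_sum ler_nat; under eq_bigr do rewrite mulnDr.
  by rewrite big_split /= -big_distrl /= leq_add // mulnC.
(* The rank of a component among those of its type selects its model. *)
pose rk i := index i (enum [set i' | ty i' == ty i]).
have rkP i : (rk i < nth 0%N ks (j i))%N.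
  by rewrite ksE cardE index_mem mem_enum inE.
have rk_inj i i' : ty i = ty i' -> rk i = rk i' -> i = i'.
  move=> tyE; rewrite /rk -tyE => h.
  have mi : i \in enum [set i' | ty i' == ty i] by rewrite mem_enum inE.
  have mi' : i' \in enum [set i' | ty i' == ty i] by rewrite mem_enum inE tyE.
  by rewrite -(nth_index i mi) h nth_index.
have hp i : hpack Gm (tagged (ty i)) (Vs (j i)) (nth 0%N ks (j i)) (fun c (u : 'I_(tag (ty i))) => M (j i) c u).
  have [h1 h2] := jP i; have := V3 _ h1; by rewrite h2.
have tyf i : realizes G (Dc i) (ty i) by have [] := ty_ts i.
pose f i := sval (cid (tyf i)).
have fP i : [/\ injective (f i), f i @: [set: 'I_(tag (ty i))] = Dc i &
    forall p q, adj (tagged (ty i)) p q = adj G (f i p) (f i q)] := svalP (cid (tyf i)).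
have fD i p : f i p \in Dc i by have [_ <- _] := fP i; rewrite imset_f ?inE.
have /choice[S SP] : forall v, exists A : {set T}, v \notin X ->
    exists i (p : 'I_(tag (ty i))), f i p = v /\ A = M (j i) (rk i) p.
  move=> v; have [vX|vX] := boolP (v \in X); first by exists set0.
  have [i vi] := (cov v).1 vX; have [_ fi _] := fP i.
  move: vi; rewrite -fi => /imsetP[p _ vp].
  by exists (M (j i) (rk i) p) => _; exists i, p.
exists S; split.
- move=> v vX; have [i [p [_ ->]]] := SP v vX; have [h1 h2 _] := hp i; split.
    by have [] := h1 _ (rkP i).
  apply: subset_trans (h2 _ p (rkP i)) _; by have [h3 _] := jP i; apply: V1.
- move=> u v uX vX uv; have [i [p [fp ->]]] := SP u uX; have [i' [q [fq ->]]] := SP v vX.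
  have [jj|jj] := eqVneq (j i) (j i'); last first.
    have [_ h2 _] := hp i; have [_ h2' _] := hp i'.
    apply: disjointWl (h2 _ p (rkP i)) _; apply: disjointWr (h2' _ q (rkP i')) _.
    by have [h3 _] := jP i; have [h3' _] := jP i'; apply: V2.
  have tyE : ty i = ty i' by have [_ <-] := jP i; have [_ <-] := jP i'; rewrite jj.
  have [_ _ h3] := hp i; have rk' : (rk i' < nth 0%N ks (j i))%N by rewrite jj.
  have hq : (q < tag (ty i))%N by rewrite tyE.
  rewrite -jj; apply: (h3 (rk i) (rk i') p (Ordinal hq) (rkP i) rk').
  apply: contra uv => /eqP[e1 e2]; have ii := rk_inj _ _ tyE e1; subst i'.
  by rewrite -fp -fq e2; apply/eqP; congr (f i _); apply: val_inj.
move=> u v uX vX uv; have [i [p [fp ->]]] := SP u uX; have [i' [q [fq ->]]] := SP v vX.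
have ii : i = i' by apply: cross uv; rewrite -?fp -?fq.
subst i'; have [_ _ fa] := fP i; have [h1 _ _] := hp i.
have [_ adjM] := h1 _ (rkP i); apply: adjM; by rewrite fa fp fq.
Qed.

(** The next item goes to a bin of load at most c, which exists by averaging and ends with load at
    most c + m. *)
Lemma balanced_bins (I : finType) (K : nat) (wt : I -> nat) (c m : nat) : (0 < K)%N ->
  (forall i, (wt i <= m)%N) -> (\sum_i wt i <= K * c)%N ->
  exists g : I -> 'I_K, forall k, (\sum_(i | g i == k) wt i <= c + m)%N.
Proof.
move=> K0 wm tot.
elim: (index_enum I) (index_enum_uniq I) tot => [|x s IH] us tot.
  by exists (fun=> Ordinal K0) => k; rewrite big_nil.
move: us; rewrite cons_uniq => /andP[xs us]; rewrite big_cons in tot.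
have [|g hg] := IH us; first by apply: leq_trans tot; rewrite leq_addl.
have [k0 hk0] : exists k0, (\sum_(i <- s | g i == k0) wt i <= c)%N.
  apply: contrapT => no.
  have h : (\sum_(k < K) c.+1 <= \sum_(k < K) \sum_(i <- s | g i == k) wt i)%N.
    by apply: leq_sum => k _; rewrite ltnNge; apply/negP => h; apply: no; exists k.
  rewrite sum_nat_const card_ord (exchange_big_dep xpredT) //= in h.
  have e : (\sum_(i <- s) \sum_(k | g i == k) wt i = \sum_(i <- s) wt i)%N.
    by apply: eq_bigr => i _; rewrite (big_pred1 (g i)) // => k; rewrite eq_sym.
  rewrite e in h; clear -h tot K0; nia.
exists (fun i => if i == x then k0 else g i) => k.
rewrite big_cons eqxx.
have e : (\sum_(i <- s | (if i == x then k0 else g i) == k) wt i = \sum_(i <- s | g i == k) wt i)%N.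
  rewrite big_seq_cond [RHS]big_seq_cond; apply: eq_bigl => i.
  case: (boolP (i \in s)) => //= si; case: (eqVneq i x) => // ix; by rewrite -ix si in xs.
rewrite e; case: eqP => [<-|_]; last exact: hg.
by rewrite addnC leq_add.
Qed.

End Components.

(** * Graphs of F as minors of dense graphs *)

Section LargeMinors.
Variables (R : realType) (F : gfamily).
Hypothesis hF : strongly_sublinear_separators R F.
Local Open Scope ring_scope.

Lemma natr_ceil (x : R) : 0 <= x -> exists n : nat, x <= n%:R <= x + 1.
Proof.
move=> x0; exists (Num.truncn x).+1; rewrite ltW ?truncnS_gt //=.
by rewrite -natr1 lerD2r truncn_le.
Qed.

Lemma natr_floor (x : R) : 0 <= x -> exists n : nat, x - 1 <= n%:R <= x.
Proof.
move=> x0; exists (Num.truncn x); rewrite truncn_le // lerBlDr natr1 ltW //; exact: truncnS_gt.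
Qed.

(** A single cut-dense set of linear size suffices if the constant need not be sharp. It serves to
    show that rho is finite. *)
Lemma crude_minor : exists K : R, 0 < K /\
  forall (V T : finType) (G : sgraph V) (Gm : sgraph T), F G -> (0 < #|V|)%N -> (0 < #|T|)%N ->
    K * #|V|%:R <= density R Gm -> has_minor Gm G.
Proof.
have [C1 C10 sp] := sublinear_sparse hF.
pose a : R := 1 / 2 / 8; have a0 : 0 < a by rewrite /a !divr_gt0.
have a1 : a <= 1 by rewrite /a; lra.
have [L rob] := cut_dense_robust a0 a1.
(* A piece has at least D/4 vertices and thus tolerates about kp D forbidden ones; K makes kp D
   exceed the demand n + 2 L C1 n. *)
pose kp := a ^+ 2 / 8 / 4; have kp0 : 0 < kp by rewrite /kp !divr_gt0 // exprn_gt0.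
have kp1 : kp <= 1 by rewrite /kp; have : a ^+ 2 <= 1; [rewrite expr_le1 // ltW|lra].
pose K : R := (3 + L%:R * (2 * C1%:R)) / kp.
have q0 : 0 <= L%:R * (2 * C1%:R) :> R by rewrite !mulr_ge0.
exists K; split; first by rewrite divr_gt0 //; lra.
move=> V T G Gm FG V0 T0 dK.
have V1 : 1 <= #|V|%:R :> R by rewrite (ler_nat _ 1).
pose D := K * #|V|%:R.
have DE : kp * D = 3 * #|V|%:R + L%:R * (2 * C1%:R * #|V|%:R).
  by rewrite /D /K; field; rewrite lt0r_neq0.
have q1 : 0 <= L%:R * (2 * C1%:R * #|V|%:R) :> R by rewrite !mulr_ge0.
have kpP (p : R) : D / 4 <= p -> kp * D <= a ^+ 2 * p / 8.
  have -> : a ^+ 2 * p / 8 = kp * (4 * p) by rewrite /kp; field.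
  by move=> h; rewrite ler_pM2l //; lra.
have aE : 1 / 2 / 8 = a by [].
have a2 : a ^+ 2 / 8 <= 1 by have : a ^+ 2 <= 1; [rewrite expr_le1 // ltW|lra].
rewrite -/D in dK; clearbody D kp a; clear K q0.
have D2 : 2 <= D.
  have : kp * D <= D by rewrite ler_piMl //; nra.
  lra.
have [|||||T1 [G1 [m1 [dT deg cod _ ed]]]] := @minimal_minor R T Gm D (1 / 4) T0; [lra|lra|lra|nra| |].
  by move: dK; rewrite /density ler_pdivlMr // ltr0n.
apply: has_minor_trans m1 _.
(* Exists because the average degree is at most 2 D; by the triangle condition its neighbourhood is
   dense. *)
have [x dx] : exists x : T1, #|nbhd G1 x|%:R <= 4 * D.
  apply: contrapT => no; have : 4 * D * #|T1|%:R <= (arcs G1 [set: T1] [set: T1])%:R.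
    rewrite /arcs natr_sum -cardsT mulr_natr -sumr_const; apply: ler_sum => y _.
    by rewrite /deg_in setIT leNgt; apply/negP => h; apply: no; exists y; exact: ltW.
  rewrite arcsT natrM; have : 0 < D * #|T1|%:R by rewrite mulr_gt0 //; lra.
  by case/andP: ed; lra.
pose W := nbhd G1 x; have W0 : W != set0.
  by rewrite -card_gt0 -(ltr_nat R); apply: lt_trans (deg x); lra.
have [||P PW [cdP lowP upP]] := @exists_piece R T1 G1 W (1 / 2) D _ W0 dx; first lra.
  rewrite /arcs natr_sum mulr_natr -sumr_const; apply: ler_sum => y; rewrite inE => xy.
  have := cod x y xy; rewrite /deg_in setIC -/W; lra.
have lowP' : kp * D <= a ^+ 2 * #|P|%:R / 8 by apply: kpP; lra.
have [|th /andP[th1 th2]] := @natr_floor (a ^+ 2 * #|P|%:R / 8).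
  by rewrite divr_ge0 // mulr_ge0 // exprn_ge0 // ltW.
have P1 : (1 < #|P|)%N.
  rewrite -(ltr_nat R); have : a ^+ 2 / 8 * #|P|%:R <= #|P|%:R by rewrite ler_piMl.
  by rewrite mulrAC; lra.
rewrite aE in cdP.
apply: (robust_minor (rob T1 G1 P th P1 cdP th2)).
  rewrite -(ler_nat R); apply: le_trans th2 _; rewrite mulrAC ler_piMl //.
rewrite arcsT -(ltr_nat R) natrD !natrM.
have e1 : #|edges G|%:R <= C1%:R * #|V|%:R :> R by rewrite -natrM ler_nat; exact: sp.
have e2 : L%:R * (2 * #|edges G|%:R) <= L%:R * (2 * C1%:R * #|V|%:R) :> R.
  by rewrite ler_wpM2l // -mulrA ler_wpM2l.
lra.
Qed.

Lemma sparse_arcs : exists2 C : nat, (0 < C)%N & forall (V : finType) (G : sgraph V) (A : {set V}), F G ->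
  (arcs G A A <= 2 * C * #|A|)%N.
Proof.
have [C C0 sp] := sublinear_sparse hF; exists C => // V G A FG.
rewrite -arcs_induced -mulnA leq_mul2l /=.
have FA : F (induced G A) by case: hF => Fsub _; exact: Fsub (subgraph_induced G A) FG.
by have := sp _ _ FA; rewrite card_induced.
Qed.

Lemma eventually_ge (x y : R) : 0 < y -> exists n : nat, forall m, (n <= m)%N -> x <= y * m%:R.
Proof.
move=> y0; exists (Num.truncn (x / y)).+1 => m nm.
rewrite mulrC -ler_pdivrMr //; apply/ltW/(lt_le_trans (truncnS_gt _)).
by rewrite ler_nat.
Qed.

(** The robustness of each piece, about dl n, is shared out: a quarter for the paths and merging
    links of overlapping vertices, a quarter for the load of a bin, and the rest absorbs m and the
    rounding. *)
Lemma pieces_minor (gm lam : R) : 0 < gm -> gm <= 1 -> 0 < lam -> exists M n1 : nat,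
  forall (V T : finType) (G : sgraph V) (Gm : sgraph T), F G -> (n1 <= #|V|)%N ->
    (forall A B : {set T}, A :|: B = [set: T] -> A :\: B != set0 -> B :\: A != set0 ->
       (forall u v, u \in A :\: B -> v \in B :\: A -> ~~ adj Gm u v) ->
       gm * (lam * #|V|%:R) < #|A :&: B|%:R) ->
    (exists Ps : nat -> {set T}, (forall i, (i < M)%N -> piece Gm gm (lam * #|V|%:R) (Ps i)) /\
       (forall i j, (i < M)%N -> (j < M)%N -> i != j -> [disjoint Ps i & Ps j])) ->
    has_minor Gm G.
Proof.
move=> gm0 gm1 lam0; have [C1 C10 sp] := sparse_arcs.
pose a := gm / 8; have a0 : 0 < a by rewrite divr_gt0.
have a1 : a <= 1 by rewrite /a; lra.
have [L rob] := cut_dense_robust a0 a1.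
pose dl := a ^+ 2 / 8 * (gm * lam / 2).
have dl0 : 0 < dl by rewrite /dl !mulr_gt0 // ?invr_gt0 // exprn_gt0.
have L0 : 0 <= L%:R :> R by [].
(* The bound gm lam keeps the number of paths below the connectivity gm D; the last one keeps their
   cost (2L + 2) e0 n within dl n / 4. *)
pose e0 := Num.min 1 (Num.min (gm * lam) (dl / (4 * (2 * L%:R + 2)))).
have e00 : 0 < e0 by rewrite /e0 !lt_min ltr01 mulr_gt0 //= divr_gt0 // mulr_gt0 //; lra.
have [s cov] := sublinear_overlap hF e00.
have : e0 <= e0 by []; rewrite {2}/e0 !le_min => /and3P[e01 e02 e03].
have {}e03 : e0 * (2 * L%:R + 2) <= dl / 4.
  rewrite -ler_pdivlMr; last lra.
  by apply: le_trans e03 _; rewrite -[leRHS]mulrA -invfM.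
pose m := (s + L * (s * s))%N.
(* The parts weigh at most qn n in all, and a bin takes at least dl n / 8, so K + 1 bins with dl K
   >= 8 qn suffice. *)
pose qn := ((1 + L * (2 * C1)) * 2)%N.
have [K hK] := @eventually_ge (8 * qn%:R) dl dl0.
have [n1 hn1] := @eventually_ge (8 * (m%:R + 2)) dl dl0.
(* K + 1 pieces are bins, the last one is the hub. *)
exists K.+2, n1 => V T G Gm FG nV; set D := lam * #|V|%:R => sepGm [Ps [pP dP]].
have := hn1 _ nV; set n := #|V|; move=> dn.
have [nB [B [cv ce sB _ [oB tB]]]] := cov V G FG.
have n0 : 0 <= n%:R :> R by [].
have m0 : 0 <= m%:R :> R by [].
have [|w /andP[w1 w2]] := @natr_floor (dl * n%:R); first by rewrite mulr_ge0 // ltW.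
have [|c /andP[c1 c2]] := @natr_floor (dl * n%:R / 4); first by rewrite divr_ge0 // mulr_ge0 // ltW.
pose wt i := (#|B i| + L * arcs G (B i) (B i))%N.
have wtm i : (wt i <= m)%N.
  by rewrite leq_add ?sB // leq_mul2l; apply/orP; right; apply: leq_trans (arcs_le _ _ _) (leq_mul _ _).
have cK : (\sum_i wt i <= K.+1 * c)%N.
  have e1 : (\sum_i wt i <= (1 + L * (2 * C1)) * \sum_i #|B i|)%N.
    rewrite big_distrr /=; apply: leq_sum => i _; rewrite mulnDl mul1n leq_add2l -mulnA leq_mul2l.
    by apply/orP; right; exact: sp.
  have e2 : (\sum_i #|B i| <= 2 * n)%N.
    rewrite -(ler_nat R) natrM; apply: le_trans tB _; rewrite ler_wpM2r //; lra.
  have e3 : (\sum_i wt i <= qn * n)%N.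
    by apply: leq_trans e1 _; rewrite /qn -mulnA leq_mul2l e2 orbT.
  rewrite -(ler_nat R) natrM; apply: (@le_trans _ _ (qn * n)%:R); first by rewrite ler_nat.
  have k1 : 8 * qn%:R <= dl * K.+1%:R by apply: hK.
  have k2 : dl * n%:R / 8 <= c%:R by lra.
  have k3 : 8 * (qn * n)%:R <= K.+1%:R * (dl * n%:R).
    by rewrite natrM mulrA [leRHS]mulrA [K.+1%:R * _]mulrC ler_wpM2r.
  have := ler_wpM2l (ler0n R K.+1) k2; rewrite [X in X <= _ -> _]mulrA; lra.
have [g hg] := balanced_bins (ltn0Sn K) wtm cK.
pose Rr := (\sum_i #|B i :&: overlap B|)%N.
have RrL : Rr%:R * (2 * L%:R + 2) <= dl * n%:R / 4.
  apply: (@le_trans _ _ (e0 * n%:R * (2 * L%:R + 2))); first by rewrite ler_wpM2r //; lra.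
  by rewrite mulrAC [leRHS]mulrAC ler_wpM2r.
have RrLn : (Rr * (L + 2) + L * Rr)%:R <= dl * n%:R / 4.
  apply: le_trans RrL; rewrite natrD !natrM natrD; nra.
have pw i : (i < K.+2)%N -> robust Gm (Ps i) (Ps i) w L /\ (w <= #|Ps i|)%N.
  move=> iK; have [cd p1 _] := pP i iK.
  have wp : w%:R <= a ^+ 2 * #|Ps i|%:R / 8.
    apply: le_trans w2 _; rewrite /dl mulrAC [leRHS]mulrAC -mulrA ler_wpM2l //.
      by rewrite divr_ge0 // exprn_ge0 // ltW.
    by apply: le_trans p1; rewrite /D; lra.
  have wP : (w <= #|Ps i|)%N.
    rewrite -(ler_nat R); apply: le_trans wp _; rewrite mulrAC ler_piMl //.
    have : a ^+ 2 <= 1 by rewrite expr_le1 // ltW.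
    lra.
  split=> //; apply: (rob T Gm (Ps i) w _ cd wp).
  apply: leq_trans wP; rewrite -(ler_nat R); lra.
have P0 := pw K.+1 (ltnSn _).
apply: (@sparse_embedding T V 'I_nB 'I_K.+1 Gm G B g (Ps K.+1) (fun k => Ps k) w L) => //.
- move=> X Y XY X1 Y1 cr; rewrite -(ler_nat R); apply/ltW.
  apply: le_lt_trans (sepGm X Y XY X1 Y1 cr); apply: le_trans oB _.
  by rewrite /D mulrA ler_wpM2r.
- move=> k k' kk; apply: dP; [exact: (ltnW (ltn_ord _))|exact: (ltnW (ltn_ord _))|exact: kk].
- move=> k; apply: dP; [exact: ltnSn|exact: (ltnW (ltn_ord _))|by rewrite neq_ltn ltn_ord orbT].
- by case: P0.
- by move=> k; have [] := pw k (ltnW (ltn_ord k)).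
- by case: P0.
- by move=> k; have [] := pw k (ltnW (ltn_ord k)).
- rewrite -(ltr_nat R); lra.
move=> k; have h := hg k; rewrite -(ltr_nat R) natrD.
have {}h : (\sum_(i | g i == k) wt i)%:R <= c%:R + m%:R :> R by rewrite -natrD ler_nat.
have k4 : (Rr * (L + 2))%:R <= (Rr * (L + 2) + L * Rr)%:R :> R by rewrite ler_nat leq_addr.
lra.
Qed.

(** Account of the density in units of gm D: 4 are lost on entry, the fifth buys cut-density of P,
    the sixth the removal of the reserve Z, and the seventh is the floor at which extraction stops.
    Hence the slack (1 - 7 gm) lam. *)
Lemma dense_minor (B lam gm eps C0 : R) :
  0 <= B -> 0 < gm -> gm <= 1 / 10 -> 0 < eps -> eps <= 1 -> 0 < C0 ->
  (1 + eps) * B < (1 - 7 * gm) * lam ->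
  (forall t : gtype, (0 < tag t)%N -> nucleus F (tagged t) ->
     frac_pack_bound (tagged t) (B * (tag t)%:R)) ->
  exists n1 : nat, forall (V T : finType) (G : sgraph V) (Gm : sgraph T) (V1 : {set T}),
    F G -> (n1 <= #|V|)%N -> V1 != set0 -> #|V1|%:R <= C0 * (lam * #|V|%:R) ->
    2 * ((1 - 4 * gm) * (lam * #|V|%:R)) * #|V1|%:R <= (arcs Gm V1 V1)%:R ->
    has_minor Gm G.
Proof.
move=> B0 gm0 gm1 eps0 eps1 C00 slack fb.
have lam0 : 0 < lam.
  have h1 : 0 <= (1 + eps) * B by rewrite mulr_ge0 //; clear -eps0; lra.
  by have := le_lt_trans h1 slack; rewrite pmulr_rgt0 //; clear -gm1; lra.
have [C1 C10 sp] := sparse_arcs.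
pose a := Num.min 1 (gm / C0).
have a0 : 0 < a by rewrite lt_min ltr01 divr_gt0.
have a1 : a <= 1 by rewrite ge_min lexx.
have aC : a * C0 <= gm by rewrite -ler_pdivlMr // ge_min lexx orbT.
(* With gm q >= C0 the reserve has at most |P| / q <= gm D vertices. *)
have [|q' /andP[hq' _]] := @natr_ceil (C0 / gm); first by rewrite divr_ge0 // ltW.
pose q := q'.+2; have q0 : (0 < q)%N by [].
have hq : C0 <= gm * q%:R.
  rewrite mulrC -ler_pdivrMr //; apply: le_trans hq' _; rewrite ler_nat /q; clear; lia.
have [L [N0 res]] := cut_dense_reserve a0 a1 q0.
pose kp0 := a ^+ 2 / (128 * q%:R).
have qR : 1 <= q%:R :> R by rewrite (ler_nat _ 1).
have q128 : 0 < 128 * q%:R :> R by rewrite mulr_gt0 // ltr0n.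
have kp00 : 0 < kp0 by rewrite divr_gt0 ?exprn_gt0 // mulr_gt0 // ltr0n.
have kp01 : kp0 <= 1.
  rewrite ler_pdivrMr; last lra.
  have : a ^+ 2 <= 1 by rewrite expr_le1 // ltW.
  lra.
(* Half of the degree into Z may be consumed by hubs already chosen. *)
pose kp := kp0 / 2; have kpp : 0 < kp by rewrite divr_gt0.
have kp1 : kp <= 1 by rewrite /kp; lra.
have L0 : 0 <= L%:R :> R by [].
have C1R : 1 <= C1%:R :> R by rewrite (ler_nat _ 1).
(* Chosen so that the vertices left undominated after K greedy steps cost at most kp0 D / 8, links
   included. *)
pose eta := kp0 * lam / (16 * ((1 + L%:R) * C1%:R)).
have eta0 : 0 < eta.
  apply: divr_gt0; first exact: mulr_gt0.
  by apply: mulr_gt0 => //; apply: mulr_gt0; clear -L0 C1R; lra.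
have etaE : (1 + L%:R) * (eta * (2 * C1%:R)) = kp0 * lam / 8.
  rewrite /eta; field; rewrite !lt0r_neq0 //; lra.
have [K hK] := exists_expr_le kpp kp1 eta0.
(* Cost of one exceptional vertex: K + 1 hub vertices with their links, and links for its edges
   inside X. The bound on |X| makes the total at most kp0 D / 8. *)
pose cX : R := (1 + L%:R) * (K%:R + 1) + L%:R * (2 * C1%:R).
have K0 : 0 <= K%:R :> R by [].
have cX0 : 0 < cX.
  have : 0 <= L%:R * (2 * C1%:R) :> R by rewrite !mulr_ge0.
  have : 0 < (1 + L%:R) * (K%:R + 1) :> R by rewrite mulr_gt0 //; clear -L0 K0; lra.
  rewrite /cX; clear; lra.
have epX0 : 0 < kp0 * lam / (8 * cX) by apply: divr_gt0; apply: mulr_gt0.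
have [ts [nt [tsP types]]] := sublinear_types hF epX0.
have gC : 0 < C0 / gm by rewrite divr_gt0.
have [t tin|c0 [n0 ext]] := @extract_components R B eps (C0 / gm) ts B0 _ eps0 eps1 gC.
  by have [t0 nt0] := tsP t tin; exact: fb.
have gl0 : 0 < gm * lam by rewrite mulr_gt0.
have [n2 h2] := eventually_ge (n0%:R + 1) gl0.
have [n3 h3] := eventually_ge (N0%:R + 1) lam0.
have sl0 : 0 < (1 - 7 * gm) * lam - (1 + eps) * B by rewrite subr_gt0.
have [n4 h4] := eventually_ge ((1 + eps) * B * c0%:R) sl0.
rewrite -/kp0 in res; clearbody kp0 eta a q.
exists (nt + n2 + n3 + n4 + 1)%N => V T G Gm V1 FG nV V10 cV1 aV1.
have {h2} : n0%:R + 1 <= gm * lam * #|V|%:R by apply: h2; clear -nV; lia.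
have {h3} : N0%:R + 1 <= lam * #|V|%:R by apply: h3; clear -nV; lia.
have {h4} : (1 + eps) * B * c0%:R <= ((1 - 7 * gm) * lam - (1 + eps) * B) * #|V|%:R by apply: h4; clear -nV; lia.
have nnt : (nt <= #|V|)%N by clear -nV; lia.
have V0 : (0 < #|V|)%N by clear -nV; lia.
have [X [I [Dc [ty [cXn tyP dD covD crossD]]]]] := types V G FG nnt.
set n := #|V|%:R; pose D := lam * n; rewrite -/D => h4 h3 h2.
have nR : 0 < n by rewrite ltr0n.
have D0 : 0 < D by rewrite mulr_gt0.
rewrite -/n -/D in cV1 aV1.
have [|P PV1 [P0 cdP arcP]] := @exists_cut_dense R T Gm a (2 * ((1 - 5 * gm) * D)) V1 V10.
  have -> : 2 * ((1 - 5 * gm) * D) * #|V1|%:R + a * #|V1|%:R ^+ 2 = (2 * ((1 - 5 * gm) * D) + a * #|V1|%:R) * #|V1|%:R by ring.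
  apply: le_trans aV1; rewrite ler_wpM2r //.
  have : a * #|V1|%:R <= gm * D.
    by apply: le_trans (ler_wpM2l (ltW a0) cV1) _; rewrite mulrA ler_wpM2r // ltW.
  have : 0 < gm * D by rewrite mulr_gt0.
  clear; lra.
have PR : 0 < #|P|%:R :> R by rewrite ltr0n card_gt0.
have gD : gm * D <= D / 10 by have := ler_wpM2r (ltW D0) gm1; clear; lra.
have cP1 : D <= #|P|%:R.
  have e1 : (arcs Gm P P)%:R <= #|P|%:R * #|P|%:R :> R by rewrite -natrM ler_nat arcs_le.
  have e2 : 2 * ((1 - 5 * gm) * D) * #|P|%:R <= #|P|%:R * #|P|%:R.
    apply: le_trans e1; apply: le_trans arcP; rewrite lerDl mulr_ge0 // ?exprn_ge0 // ltW //.
  have : 2 * ((1 - 5 * gm) * D) <= #|P|%:R by rewrite -(ler_pM2r PR).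
  clear -gD D0; lra.
have cP2 : #|P|%:R <= C0 * D.
  by apply: le_trans cV1; rewrite ler_nat subset_leq_card.
have [|Z [w [ZP qZ wP robZ degZ]]] := res T Gm P _ cdP.
  rewrite -(ltr_nat R); clear -h3 cP1; lra.
pose W := P :\: Z.
have cZ : #|Z|%:R <= gm * D.
  have e1 : q%:R * #|Z|%:R <= C0 * D by apply: le_trans cP2; rewrite -natrM ler_nat.
  have e2 : C0 * D <= q%:R * (gm * D) by rewrite mulrA [q%:R * gm]mulrC ler_wpM2r // ltW.
  by rewrite -(ler_pM2l (_ : 0 < q%:R)) ?ltr0n //; apply: le_trans e1 e2.
have W0 : W != set0.
  rewrite -card_gt0 -(ltr_nat R) cardsD (setIidPr ZP) natrB ?subset_leq_card //; clear -cZ gD cP1 D0; lra.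
have WP : W \subset P by exact: subsetDl.
have aW : 2 * ((1 - 6 * gm) * D) * #|W|%:R <= (arcs Gm W W)%:R.
  have e1 : (arcs Gm P P)%:R <= (arcs Gm W W)%:R + 2 * (arcs Gm Z P)%:R :> R.
    by rewrite -natrM -natrD ler_nat arcsD.
  have e2 : (arcs Gm Z P)%:R <= #|Z|%:R * #|P|%:R :> R by rewrite -natrM ler_nat arcs_le.
  have e3 : #|Z|%:R * #|P|%:R <= gm * D * #|P|%:R by rewrite ler_wpM2r.
  have e4 : 0 <= a * #|P|%:R ^+ 2 by rewrite mulr_ge0 // ?exprn_ge0 // ltW.
  have e5 : 2 * ((1 - 6 * gm) * D) * #|W|%:R <= 2 * ((1 - 6 * gm) * D) * #|P|%:R.
    by rewrite ler_wpM2l ?ler_nat ?subset_leq_card //; clear -gD D0; lra.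
  move: arcP e5; rewrite !mulrBl !mulrBr !mulrBl !mul1r => arcP e5; clear -e1 e2 e3 e4 arcP e5; lra.
have cW : #|W|%:R <= C0 / gm * (gm * D).
  rewrite mulrA divfK ?lt0r_neq0 //; apply: le_trans cP2; by rewrite ler_nat subset_leq_card.
have nD : n0%:R < gm * D by rewrite /D mulrA; clear -h2; lra.
have hD : gm * D + (1 + eps) * B * (#|V| + c0)%:R <= (1 - 6 * gm) * D.
  rewrite natrD -/n /D; clear -h4; lra.
have [S [S1 S2 S3]] := ext T V Gm G W ((1 - 6 * gm) * D) (gm * D) X I Dc ty W0 aW cW nD hD tyP dD covD crossD.
have /choice[r rP] : forall v, exists y, v \notin X -> y \in S v.
  move=> v; have [vX|vX] := boolP (v \in X); last first.
    by have [cS _] := S1 v vX; have [y yS] := connected_in_neq0 cS; exists y.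
  by have /set0Pn[y _] := V10; exists y.
(* The hub of x has to see only one representative of each neighbour outside X. *)
pose Y x := r @: (nbhd G x :\: X).
have YW x y : y \in Y x -> y \in P.
  move=> /imsetP[v /setDP[_ vX] ->]; apply: (subsetP WP).
  by have [_ /subsetP sS] := S1 v vX; apply: sS; apply: rP.
have wR : kp0 * D <= w%:R by apply: le_trans wP; rewrite ler_wpM2l // ltW.
have kD : 0 < kp0 * D by rewrite mulr_gt0.
have w0 : (0 < w)%N by rewrite -(ltr_nat R); apply: lt_le_trans wR.
have wZ : (w <= #|Z|)%N.
  by have /set0Pn[v vP] := P0; apply: leq_trans (degZ v vP) (deg_in_le _ _ _).
pose tau : R := \sum_(x in X) (K%:R + 1 + (1 - kp) ^+ K * #|Y x|%:R).
have kpK0 : 0 <= (1 - kp) ^+ K by rewrite exprn_ge0 // subr_ge0.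
have tauX : tau <= (K%:R + 1) * #|X|%:R + eta * (2 * C1%:R) * n.
  have -> : tau = (K%:R + 1) * #|X|%:R + (1 - kp) ^+ K * \sum_(x in X) #|Y x|%:R.
    by rewrite /tau big_split /= sumr_const mulr_sumr mulr_natr.
  rewrite lerD2l -mulrA.
  apply: ler_pM => //; first by rewrite sumr_ge0.
  rewrite -natr_sum -!natrM ler_nat.
  apply: (@leq_trans (\sum_(x in X) deg_in G [set: V] x)).
    by apply: leq_sum => x _; rewrite /deg_in setIT; apply: leq_trans (leq_imset_card _ _) (subset_leq_card (subsetDl _ _)).
  have := sp V G [set: V] FG; rewrite cardsT; apply: leq_trans.
  exact: arcs_sub (subsetT _) (subxx _).
have aX : (arcs G X X)%:R <= 2 * C1%:R * #|X|%:R :> R by rewrite -!natrM ler_nat; exact: sp.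
have total : (1 + L%:R) * tau + L%:R * (2 * C1%:R * #|X|%:R) <= kp0 * D / 4.
  have e1 : (1 + L%:R) * tau <= (1 + L%:R) * ((K%:R + 1) * #|X|%:R + eta * (2 * C1%:R) * n).
    by rewrite ler_wpM2l //; clear -L0; lra.
  have e2 : cX * #|X|%:R <= kp0 * D / 8.
    apply: le_trans (ler_wpM2l (ltW cX0) cXn) _; rewrite -/n /D le_eqVlt; apply/orP; left; apply/eqP.
    by field; rewrite lt0r_neq0.
  have e3 : (1 + L%:R) * ((K%:R + 1) * #|X|%:R + eta * (2 * C1%:R) * n) + L%:R * (2 * C1%:R * #|X|%:R)
      = cX * #|X|%:R + (1 + L%:R) * (eta * (2 * C1%:R)) * n by rewrite /cX; ring.
  have e4 : (1 + L%:R) * (eta * (2 * C1%:R)) * n = kp0 * D / 8 by rewrite etaE /D; ring.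
  clear -e1 e2 e3 e4; lra.
have tau0 : 0 <= tau.
  by rewrite sumr_ge0 // => x _; rewrite addr_ge0 ?mulr_ge0 // addr_ge0.
have tauL : tau <= (1 + L%:R) * tau by rewrite ler_peMl //; clear -L0; lra.
have X0 : 0 <= L%:R * (2 * C1%:R * #|X|%:R) :> R by rewrite !mulr_ge0.
have [||Hb [H1 H2 H3 H4]] := @disjoint_hubs T V Gm R Z Y X kp K tau w kpp kp1 _ wZ erefl _ w0.
- by move=> x y _ /YW; exact: degZ.
- have e1 : kp * #|Z|%:R <= kp0 * #|P|%:R / 2.
    by rewrite /kp mulrAC ler_wpM2r // ler_wpM2l ?(ltW kp00) // ler_nat subset_leq_card.
  have e2 : kp0 * D <= kp0 * #|P|%:R by rewrite ler_wpM2l // ltW.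
  clear -e1 e2 tauL total X0 wP kD; lra.
apply: (@dense_embedding T V Gm G X P Z S Hb r w L) => //.
- move=> v vX; have [cS sS] := S1 v vX; split=> //.
  by apply: disjointWl sS _; rewrite disjoint_sym disjoints_subset setCD subsetUr.
- move=> x v xX vX xv; apply: (H2 x) => //; apply: imset_f; by rewrite !inE vX.
rewrite -(ltr_nat R) natrD natrM natrD.
have e5 : L%:R * ((\sum_(x in X) #|Hb x|)%:R + (arcs G X X)%:R) <= L%:R * (tau + 2 * C1%:R * #|X|%:R).
  by rewrite ler_wpM2l // lerD.
rewrite mulrDr in e5; rewrite mulrDl mul1r in total; clear -e5 total H4 wR kD; lra.
Qed.

Lemma large_minor (B lam : R) : 0 <= B -> B < lam ->
  (forall t : gtype, (0 < tag t)%N -> nucleus F (tagged t) ->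
     frac_pack_bound (tagged t) (B * (tag t)%:R)) ->
  exists n1 : nat, forall (V T : finType) (G : sgraph V) (Gm : sgraph T),
    F G -> (n1 <= #|V|)%N -> (0 < #|T|)%N -> lam * #|V|%:R <= density R Gm -> has_minor Gm G.
Proof.
move=> B0 Bl fb; have lam0 : 0 < lam by lra.
pose eps := Num.min 1 ((lam - B) / (4 * lam)).
have eps0 : 0 < eps by rewrite lt_min ltr01 divr_gt0 ?mulr_gt0 // subr_gt0.
have eps1 : eps <= 1 by rewrite ge_min lexx.
have eps2 : eps * (4 * lam) <= lam - B by rewrite -ler_pdivlMr ?mulr_gt0 // ge_min lexx orbT.
(* The losses eps B + 7 gm lam stay below 2 eps lam, while lam - B >= 4 eps lam. *)
pose gm := eps / 20.
have gm0 : 0 < gm by rewrite divr_gt0.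
have slack : (1 + eps) * B < (1 - 7 * gm) * lam.
  have : eps * B <= eps * lam by rewrite ler_wpM2l // ltW.
  rewrite /gm; nra.
have [|M [n1 pm]] := @pieces_minor gm lam gm0 _ lam0; first by rewrite /gm; lra.
pose C0 := 16 * (M%:R + 1) / gm.
have C00 : 0 < C0 by rewrite divr_gt0 // mulr_gt0 // ltr_wpDl.
have gm1 : gm <= 1 / 10 by rewrite /gm; lra.
have [n2 dm] := dense_minor B0 gm0 gm1 eps0 eps1 C00 slack fb.
have [n3 h3] := eventually_ge 2 lam0.
have gl0 : 0 < gm * lam by rewrite mulr_gt0.
have [n4 h4] := eventually_ge 1 gl0.
exists (n1 + n2 + n3 + n4)%N => V T0 G G0 FG nV T00 dG.
have {h3} : 2 <= lam * #|V|%:R by apply: h3; clear -nV; lia.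
have {h4} : 1 <= gm * (lam * #|V|%:R) by rewrite mulrA; apply: h4; clear -nV; lia.
have nV1 : (n1 <= #|V|)%N by clear -nV; lia.
have nV2 : (n2 <= #|V|)%N by clear -nV; lia.
set D := lam * #|V|%:R => h4 h3.
have [|||T [Gm [m1 [dT deg cod sepG ed]]]] := @minimal_minor R T0 G0 D gm T00 h3 gm0.
- lra.
- nra.
- by move: dG; rewrite /density ler_pdivlMr // ltr0n.
apply: has_minor_trans m1 _.
have T0' : (0 < #|T|)%N by rewrite -(ltr_nat R); lra.
have [|pcs|[V1 V10 [cV1 aV1]]] := @pieces_or_small_subgraph R T Gm gm D M gm0 _ h4 T0' deg cod ed.
- rewrite /gm; lra.
- exact: (pm V T G Gm FG nV1 sepG pcs).
exact: (dm V T G Gm V1 FG nV2 V10 cV1 aV1).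
Qed.

End LargeMinors.

(** * Lower bound and convergence *)

Section Blowup.
Variables (T : finType) (G : sgraph T) (m : nat).

Definition blowup : sgraph (T * 'I_m)%type := mkgraph [rel a b : T * 'I_m | adj G a.1 b.1].

Lemma adj_blowup a b : adj blowup a b = adj G a.1 b.1.
Proof.
rewrite adj_mkgraph /= (adjC G b.1) orbb; case: eqP => //= ->.
by rewrite adjxx.
Qed.

Lemma edges_blowup : #|edges blowup| = (m * m * #|edges G|)%N.
Proof.
apply/eqP; rewrite -(eqn_pmul2l (isT : 0 < 2)%N) mulnCA -!arcsT; apply/eqP; rewrite /arcs.
under eq_bigr do rewrite deg_inE.
under [in RHS]eq_bigr do rewrite deg_inE.
have sumP (F : T * 'I_m -> nat) : (\sum_(a in [set: T * 'I_m]) F a = \sum_x \sum_i F (x, i))%N.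
  by rewrite pair_bigA /=; apply: eq_big => [a|[x i] _]; rewrite ?inE.
rewrite sumP; under eq_bigr do under eq_bigr do rewrite sumP.
have sumT (F : T -> nat) : (\sum_(x in [set: T]) F x = \sum_x F x)%N.
  by apply: eq_bigl => x; rewrite inE.
rewrite sumT; under [in RHS]eq_bigr do rewrite sumT.
rewrite big_distrr /=; apply: eq_bigr => x _.
under eq_bigr do under eq_bigr do under eq_bigr do rewrite adj_blowup /=.
have sumc (c : nat) : (\sum_(i < m) c = m * c)%N by rewrite sum_nat_const card_ord.
by rewrite sumc; under eq_bigr do rewrite sumc; rewrite -big_distrr mulnA.
Qed.

Lemma density_blowup (R : realType) : (0 < m)%N -> density R blowup = (m%:R * density R G)%R.
Proof.
move=> m0; rewrite /density edges_blowup card_prod card_ord !natrM invfM.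
have mR : (m%:R != 0 :> R)%R by rewrite pnatr_eq0 -lt0n.
rewrite (_ : m%:R * m%:R * #|edges G|%:R * (#|T|%:R^-1 / m%:R) = m%:R * (#|edges G|%:R / #|T|%:R) * (m%:R / m%:R))%R; last by ring.
by rewrite divff // mulr1.
Qed.

End Blowup.

Lemma adj_copies k (U : finType) (H : sgraph U) i u v : adj H u v -> adj (copies k H) (i, u) (i, v).
Proof.
move=> uv; rewrite /adj /= /copies_edges; apply/imset2P; exists i [set u; v] => //.
by rewrite imsetU !imset_set1.
Qed.

(** The maximum is over graphs with exactly n vertices, and |U| need not divide n. The upper copies
    put the graph into F, the lower ones supply the minor to be excluded. *)
Lemma subgraph_between_copies (U : finType) (H : sgraph U) (n : nat) : (0 < #|U|)%N ->
  exists G : sgraph 'I_n, subgraph G (copies (n %/ #|U|).+1 H) /\ subgraph (copies (n %/ #|U|) H) G.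
Proof.
move=> U0; set h := #|U|; set k := n %/ h.
have lk (x : 'I_n) : (x %/ h < k.+1)%N by rewrite ltnS leq_div2r // ltnW.
pose f (x : 'I_n) : 'I_k.+1 * U := (Ordinal (lk x), enum_val (Ordinal (ltn_pmod x U0))).
have f_inj : injective f.
  move=> x y [e1 /enum_val_inj [e2]]; apply: val_inj.
  by rewrite /= (divn_eq x h) (divn_eq y h) e1 e2.
have lg (a : 'I_k * U) : (a.1 * h + enum_rank a.2 < n)%N.
  case: a => i u /=; apply: (@leq_trans (i * h + h)); first by rewrite ltn_add2l.
  by rewrite -mulSnr; apply: leq_trans (leq_trunc_div n h); rewrite leq_mul2r ltn_ord orbT.
pose g a := Ordinal (lg a).
have fg i u : f (g (i, u)) = (widen_ord (leqnSn k) i, u).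
  congr (_, _); first by apply: val_inj; rewrite /= divnMDl // divn_small ?addn0.
  rewrite -[RHS](enum_rankK u); congr enum_val; apply: val_inj => /=.
  by rewrite modnMDl modn_small.
exists (mkgraph [rel x y | adj (copies k.+1 H) (f x) (f y)]); split.
  exists f => // e /edgeP[x [y [-> _]]]; rewrite adj_mkgraph /= [adj _ (f y) _]adjC orbb => /andP[_ xy].
  by rewrite imsetU !imset_set1.
exists g => [[i u] [j v] /(congr1 f)|e].
  by rewrite !fg => -[e1 e2]; congr (_, _) => //; apply: val_inj.
move=> /imset2P[i e' _ /edgeP[u [v [-> uv huv]]] ->].
rewrite !imsetU !imset_set1; rewrite -/(adj _ _ _) adj_mkgraph /= !fg adj_copies // andbT.
apply: contra uv => /eqP/(congr1 f); rewrite !fg => -[->]; exact: eqxx.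
Qed.

Lemma density_unit (R : realType) (G : sgraph unit) : density R G = 0%R.
Proof.
rewrite /density (_ : edges G = set0) ?cards0 ?mul0r //.
by apply/setP => e; rewrite in_set0; apply/negP => /edgeP[[] [[] []]]; rewrite eqxx.
Qed.

Section Volume.
Variables (R : realType) (T U : finType) (G : sgraph T) (H : sgraph U).
Hypothesis U0 : (0 < #|U|)%N.
Local Open Scope ring_scope.

Lemma sum_multiplicity (mu : U -> {set T}) : (\sum_x multiplicity mu x = \sum_u #|mu u|)%N.
Proof.
rewrite /multiplicity; under eq_bigr do rewrite -sum1_card big_mkcond.
rewrite exchange_big; apply: eq_bigr => u _; rewrite -sum1_card [RHS]big_mkcond.
by apply: eq_bigr => x _; rewrite inE.
Qed.

Lemma vol_weight_le k (alpha : 'I_k -> R) (mu : 'I_k -> U -> {set T}) :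
  (forall i, 0 <= alpha i) -> (forall i, jumbled_model G H (mu i)) ->
  (forall x, \sum_(i < k) alpha i * (multiplicity (mu i) x)%:R <= 1) ->
  \sum_i alpha i <= #|T|%:R.
Proof.
move=> a0 jm le1.
apply: (@le_trans _ _ (\sum_x \sum_(i < k) alpha i * (multiplicity (mu i) x)%:R)).
  rewrite exchange_big; apply: ler_sum => i _; rewrite -mulr_sumr -natr_sum sum_multiplicity.
  rewrite ler_peMr // ler1n; apply: leq_trans U0 _; rewrite -sum1_card; apply: leq_sum => u _.
  have [c _] := jm i; have [x xu] := connected_in_neq0 (c u).
  by rewrite card_gt0; apply/set0Pn; exists x.
by rewrite -sum1_card natr_sum; apply: ler_sum => x _; exact: le1.
Qed.

(** Passage to real numbers. The real and the extended quotient agree also for v = 0, since then the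
    density is 0. *)
Lemma vol_real : exists v : R,
  [/\ vol R H G = v%:E, 0 <= v, ((density R G)%:E / vol R H G)%E = (density R G / v)%:E &
      density R G != 0 -> 0 < v].
Proof.
have v0 : (0%:E <= vol R H G)%E.
  apply: ereal_sup_ubound; exists 0%N, (fun=> 0), (fun _ _ => set0).
  by split=> [||x|]; rewrite ?big_ord0 //; case.
have v1 : (vol R H G <= (#|T|%:R)%:E)%E.
  apply: ge_ereal_sup => z [k [alpha [mu [a0 jm le1 ->]]]]; rewrite lee_fin.
  exact: (vol_weight_le a0 jm le1).
have [v vE] : exists v, vol R H G = v%:E.
  by case: (vol R H G) v0 v1 => [v _ _| |]//; exists v.
have vpos : density R G != 0 -> 0 < v.
  move=> d0; have : edges G != set0.
    by apply: contra d0 => /eqP e; rewrite /density e cards0 mul0r.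
  case/set0Pn => e /edgeP[x [y [_ xy hxy]]].
  have : ((#|U|%:R^-1)%:E <= vol R H G)%E.
    (* Overlaps are allowed, so every vertex of H can be sent to one and the same edge. *)
    apply: ereal_sup_ubound; exists 1%N, (fun=> #|U|%:R^-1), (fun _ _ => [set x; y]); split.
    - by move=> _; rewrite invr_ge0.
    - move=> _; split=> [u|u u' _]; last by exists x, y; rewrite !inE !eqxx orbT.
      apply: (connected_inU (x := x) (y := y)) => //; rewrite ?connected_in1 ?set11 //.
      by rewrite hxy orbT.
    - move=> z; rewrite big_ord1 mulrC ler_pdivrMr ?ltr0n // mul1r ler_nat; exact: max_card.
    - by rewrite big_ord1.
  by rewrite vE lee_fin; apply: lt_le_trans; rewrite invr_gt0 ltr0n.
exists v; split=> //; first by rewrite vE lee_fin in v0.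
rewrite vE inver; case: eqP => [v00|//].
have [->|/vpos] := eqVneq (density R G) 0; first by rewrite mul0e mul0r.
by rewrite v00 ltxx.
Qed.

Lemma vol_adherent (v e : R) : vol R H G = v%:E -> 0 < e ->
  exists (k : nat) (alpha : 'I_k -> R) (mu : 'I_k -> U -> {set T}),
    [/\ forall i, 0 <= alpha i, forall i, jumbled_model G H (mu i),
        forall x, \sum_(i < k) alpha i * (multiplicity (mu i) x)%:R <= 1 &
        v - e < \sum_(i < k) alpha i].
Proof.
move=> vE e0; have : ((v - e)%:E < vol R H G)%E by rewrite vE lte_fin ltrBlDr ltrDl.
move=> /ereal_sup_gt[z [k [alpha [mu [a0 jm le1 ->]]]]]; rewrite lte_fin => h.
by exists k, alpha, mu.
Qed.

(** Disjoint models of H in the blow-up project to jumbled models in G. A vertex of G has m copies,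
    so it is covered at most m times and each model can get weight 1/m. *)
Lemma blowup_minor_vol (m k : nat) (v : R) : (0 < m)%N -> vol R H G = v%:E ->
  has_minor (blowup G m) (copies k H) -> k%:R <= v * m%:R.
Proof.
move=> m0 vE [mu [cmu amu] dmu].
pose nu (i : 'I_k) (u : U) := [set a.1 | a in mu (i, u)].
suff : ((\sum_(i < k) m%:R^-1)%:E <= vol R H G)%E.
  by rewrite vE lee_fin sumr_const card_ord -[_ *+ k]mulr_natl ler_pdivrMr // ltr0n.
apply: ereal_sup_ubound; exists k, (fun=> m%:R^-1), nu; split=> //.
- move=> i; split=> [u|u u' uu'].
    by apply: connected_imset (cmu (i, u)) => a b _ _; rewrite adj_blowup.
  have [a [b [au bu]]] := amu _ _ (adj_copies i uu'); rewrite adj_blowup => ab.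
  by exists a.1, b.1; rewrite !imset_f.
move=> x; rewrite -mulr_sumr mulrC ler_pdivrMr ?ltr0n // mul1r -natr_sum ler_nat.
pose P := [set w : 'I_k * U | x \in nu w.1 w.2].
have -> : (\sum_(i < k) multiplicity (nu i) x = #|P|)%N.
  rewrite card_fibers; apply: eq_bigr => i _; rewrite /multiplicity.
  by apply: eq_card => u; rewrite !inE.
have /choice[s sP] : forall w : 'I_k * U, exists j : 'I_m, w \in P -> (x, j) \in mu w.
  move=> [i u]; have [|h] := boolP ((i, u) \in P); last by exists (Ordinal m0).
  by rewrite inE => /imsetP[[y j] yj /= ->]; exists j.
rewrite -[leqRHS](card_ord m); apply: leq_trans (max_card [in s @: P]).
rewrite card_in_imset // => w w' wP w'P e; apply/eqP; apply: contrapT => /negP ww'.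
have /pred0P/(_ (x, s w)) /= := dmu _ _ ww'; by rewrite (sP w wP) e (sP w' w'P).
Qed.

End Volume.

Section Asymptotics.
Variables (R : realType) (F : gfamily).
Hypothesis hF : strongly_sublinear_separators R F.
Local Open Scope ring_scope.

(** Otherwise a large blow-up of G would be dense enough for [crude_minor] to yield more copies of H
    than its volume permits. *)
Lemma nucleus_density_le : exists2 K : R, 0 < K &
  forall (T U : finType) (G : sgraph T) (H : sgraph U) (v : R), (0 < #|T|)%N -> (0 < #|U|)%N ->
    nucleus F H -> vol R H G = v%:E -> density R G <= K * #|U|%:R * v.
Proof.
have [K [K0 crude]] := crude_minor hF; exists K => // T U G H v T0 U0 nH vE.
have U0R : 0 < #|U|%:R :> R by rewrite ltr0n.
have Kh : 0 < K * #|U|%:R by rewrite mulr_gt0.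
have d0 : 0 <= density R G by rewrite divr_ge0.
rewrite leNgt; apply/negP => lt.
have gap : 0 < density R G - K * #|U|%:R * v by rewrite subr_gt0.
have [n hn] := eventually_ge (2 * (K * #|U|%:R)) gap.
have {}hn := hn n.+1 (leqnSn n); set m := n.+1 in hn.
have mR : 0 < m%:R :> R by rewrite ltr0n.
have [|k /andP[k1 k2]] := @natr_floor R (m%:R * density R G / (K * #|U|%:R)).
  by rewrite divr_ge0 ?mulr_ge0 // ltW.
have kv : k%:R <= v * m%:R.
  case: (posnP k) => [->|k0].
    have [v' [vE' v'0 _ _]] := vol_real R G H U0.
    by move: vE'; rewrite vE => -[->]; rewrite mulr_ge0.
  apply: (@blowup_minor_vol R T U G H m k v) => //; apply: crude => //.
  - by rewrite card_prod card_ord muln_gt0 k0.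
  - by rewrite card_prod card_ord muln_gt0 T0.
  rewrite density_blowup // card_prod card_ord natrM.
  by move: k2; rewrite ler_pdivlMr // mulrCA.
have : m%:R * density R G <= (v * m%:R + 1) * (K * #|U|%:R).
  by rewrite -ler_pdivrMr //; lra.
move: hn Kh; nra.
Qed.

Lemma rho_real : (exists (U : finType) (H : sgraph U), (0 < #|U|)%N /\ nucleus F H) ->
  exists2 r : R, rho R F = r%:E & 0 <= r.
Proof.
move=> [U [H [U0 nH]]]; have [K K0 dK] := nucleus_density_le.
have divE (x : \bar R) (n : nat) : (0 < n)%N -> (x / n%:R%:E = x * (n%:R^-1)%:E)%E.
  by move=> n0; rewrite inver pnatr_eq0 -[n == 0%N]negbK -lt0n n0.
have up : (rho R F <= K%:E)%E.
  apply: ge_ereal_sup => z [U' [H' [U'0 nH' ->]]].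
  rewrite divE // lee_pdivrMr ?ltr0n //; apply: ge_ereal_sup => y [T [G [T0 ->]]].
  have [v [vE v0 -> dv]] := vol_real R G H' U'0; rewrite -EFinM lee_fin.
  have [->|/dv vpos] := eqVneq (density R G) 0; first by rewrite mul0r mulr_ge0 // ltW.
  by rewrite ler_pdivrMr //; exact: (dK _ _ _ _ _ T0 U'0).
have low : (0%:E <= rho R F)%E.
  apply: (@le_trans _ _ (frac_extremal R H / #|U|%:R%:E)%E); last first.
    by apply: ereal_sup_ubound; exists U, H.
  rewrite divE // lee_pdivlMr ?ltr0n // mul0e; apply: ereal_sup_ubound.
  (* The one-vertex graph has density 0, which makes rho nonnegative. *)
  exists unit, (mkgraph [rel x y : unit | false]); split; first by rewrite card_unit.
  have T0 : (0 < #|{: unit}|)%N by rewrite card_unit.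
  have [v [_ _ -> _]] := vol_real R (mkgraph [rel x y : unit | false]) H U0.
  by rewrite density_unit mul0r.
by case: (rho R F) up low => [r _ r0| |]//; exists r.
Qed.

Lemma frac_pack_nucleus (r : R) (U : finType) (H : sgraph U) : (0 < #|U|)%N -> nucleus F H ->
  rho R F = r%:E -> 0 <= r -> frac_pack_bound H (r * #|U|%:R).
Proof.
move=> U0 nH rE r0 m S eta m0 eta0.
have T0 : (0 < #|'I_m|)%N by rewrite card_ord.
have U0R : 0 < #|U|%:R :> R by rewrite ltr0n.
have [v [vE v0 vd dv]] := vol_real R S H U0.
have rU : 0 <= r * #|U|%:R by rewrite mulr_ge0.
have dle : density R S <= r * #|U|%:R * v.
  have [->|/dv vpos] := eqVneq (density R S) 0; first by rewrite mulr_ge0.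
  have : (frac_extremal R H / #|U|%:R%:E <= r%:E)%E.
    by rewrite -rE; apply: ereal_sup_ubound; exists U, H.
  rewrite inver gt_eqF // lee_pdivrMr // -EFinM => h.
  rewrite -ler_pdivrMr // -lee_fin -vd; apply: le_trans h.
  by apply: ereal_sup_ubound; exists 'I_m, S.
(* The added 1 covers r = 0. *)
have e0 : 0 < eta / (r * #|U|%:R + 1) by rewrite divr_gt0 //; lra.
have [k [alpha [mu [a0 jm le1 hv]]]] := vol_adherent vE e0.
exists k, alpha, mu; split=> //.
have h1 : r * #|U|%:R * (v - eta / (r * #|U|%:R + 1)) <= r * #|U|%:R * \sum_(i < k) alpha i.
  by apply: ler_wpM2l => //; exact: ltW.
have h2 : r * #|U|%:R * (eta / (r * #|U|%:R + 1)) <= eta.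
  by rewrite mulrA ler_pdivrMr; nra.
rewrite mulrBr in h1; lra.
Qed.

Lemma extremal_ge (T U : finType) (G : sgraph T) (H : sgraph U) : (0 < #|T|)%N ->
  ~ has_minor G H -> ((density R G)%:E <= extremal R H)%E.
Proof. by move=> T0 nm; apply: ereal_sup_ubound; exists T, G. Qed.

Lemma max_extremal_ge (n : nat) (G : sgraph 'I_n) (x : R) : (0 < n)%N -> F G ->
  ((n%:R * x)%:E <= extremal R G)%E -> (x%:E <= max_extremal R F n)%E.
Proof.
move=> n0 FG h; apply: (@le_trans _ _ (extremal R G / n%:R%:E)%E).
  rewrite inver gt_eqF ?ltr0n // lee_pdivlMr ?ltr0n //.
  by rewrite -EFinM mulrC.
by rewrite /max_extremal; apply: (le_bigmax_cond _ (fun G : sgraph 'I_n => (extremal R G / n%:R%:E)%E)); apply/asboolP.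
Qed.

Lemma max_extremal_lower (T U : finType) (G : sgraph T) (H : sgraph U) (v eps : R) :
  (0 < #|T|)%N -> (0 < #|U|)%N -> nucleus F H -> vol R H G = v%:E -> 0 < eps ->
  exists n0, forall n, (n0 <= n)%N -> ((density R G / v / #|U|%:R - eps)%:E <= max_extremal R F n)%E.
Proof.
move=> T0 U0 nH vE eps0; set d := density R G; set h := #|U|.
have FGn n : exists2 Gn : sgraph 'I_n, F Gn & subgraph (copies (n %/ h) H) Gn.
  have [Gn [s1 s2]] := subgraph_between_copies H n U0; exists Gn => //.
  by case: hF => Fsub _; apply: Fsub s1 (nH _).
have [v' [vE' v0 _ dv]] := vol_real R G H U0; move: vE'; rewrite vE => -[vv]; subst v'.
have hR : 0 < h%:R :> R by rewrite ltr0n.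
(* Here v may be 0. The bound to prove is -eps, and the one-vertex graph excludes every minor on at
   least two vertices. *)
have [d0|dn0] := eqVneq d 0.
  exists 2%N => n n2; have [Gn FGn' _] := FGn n.
  have n0 : (0 < n)%N by apply: leq_trans n2.
  apply: (max_extremal_ge n0 FGn'); apply: (@le_trans _ _ 0%:E).
    by rewrite lee_fin d0 !mul0r sub0r mulrN oppr_le0 mulr_ge0 // ltW.
  rewrite -(density_unit R (mkgraph [rel x y : unit | false])).
  apply: extremal_ge; first by rewrite card_unit.
  move=> [mu [cmu _] dmu]; pose a : 'I_n := Ordinal n0; pose b : 'I_n := Ordinal n2.
  have [[] xa] := connected_in_neq0 (cmu a); have [[] xb] := connected_in_neq0 (cmu b).
  by have /pred0P/(_ tt) := dmu a b isT; rewrite /= xa xb.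
have vpos := dv dn0.
have d0 : 0 < d by rewrite lt_def dn0 divr_ge0.
have [n1 h1] := eventually_ge (d / v + 2 * d) eps0.
have hv0 : 0 < (h%:R * v)^-1 by rewrite invr_gt0 mulr_gt0.
have [n2 h2] := eventually_ge (v^-1 + 3) hv0.
exists (n1 + n2 + 1)%N => n nn; have [Gn FGn' sub] := FGn n.
have {}h1 : d / v + 2 * d <= eps * n%:R by apply: h1; clear -nn; lia.
have {}h2 : v^-1 + 3 <= (h%:R * v)^-1 * n%:R by apply: h2; clear -nn; lia.
have n0 : (0 < n)%N by clear -nn; lia.
have nR : 0 < n%:R :> R by rewrite ltr0n.
set k := (n %/ h)%N in sub.
have k1 : n%:R / h%:R - 1 <= k%:R :> R.
  rewrite lerBlDr natr1 ler_pdivrMr // -natrM ler_nat; apply: ltnW; exact: ltn_ceil.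
have k2 : (h%:R * v)^-1 * n%:R - v^-1 <= k%:R / v.
  have -> : (h%:R * v)^-1 * n%:R - v^-1 = (n%:R / h%:R - 1) / v by field; rewrite !gt_eqF.
  by rewrite ler_pM2r ?invr_gt0.
(* The largest useful blow-up: v m < k excludes k copies of H, and m loses at most 2 against k /
   v. *)
have [|m /andP[m1 m2]] := @natr_floor R (k%:R / v - 1); first lra.
have m0 : (0 < m)%N by rewrite -(ltr_nat R); lra.
apply: (max_extremal_ge n0 FGn').
apply: (@le_trans _ _ (density R (blowup G m))%:E); last first.
  apply: extremal_ge; first by rewrite card_prod card_ord muln_gt0 T0.
  move=> hm; have := blowup_minor_vol m0 vE (has_minor_trans hm (subgraph_minor sub)).
  by rewrite mulrC -ler_pdivrMr //; lra.
rewrite lee_fin density_blowup // -/d.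
have e1 : (k%:R / v - 2) * d <= m%:R * d by rewrite ler_wpM2r ?(ltW d0) //; lra.
have e2 : ((h%:R * v)^-1 * n%:R - v^-1 - 2) * d <= (k%:R / v - 2) * d.
  by rewrite ler_wpM2r ?(ltW d0) //; lra.
have e3 : n%:R * (d / v / h%:R) = (h%:R * v)^-1 * n%:R * d by field; rewrite !gt_eqF.
rewrite mulrBr e3; move: e2; rewrite mulrBl mulrBl mulrC [v^-1 * d]mulrC; lra.
Qed.

Lemma max_extremal_upper (r eps : R) : rho R F = r%:E -> 0 <= r -> 0 < eps ->
  exists n0, forall n, (n0 <= n)%N -> (max_extremal R F n <= (r + eps)%:E)%E.
Proof.
move=> rE r0 eps0.
have [| |n1 lm] := @large_minor R F hF r (r + eps) r0; first by rewrite ltrDl.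
  move=> t t0 nt; have := frac_pack_nucleus _ nt rE r0; rewrite card_ord; exact.
exists n1.+1 => n nn; have n0 : (0 < n)%N by apply: leq_trans nn.
apply: bigmax_le => [|G /asboolP FG]; first exact: leNye.
rewrite inver gt_eqF ?ltr0n // lee_pdivrMr ?ltr0n // -EFinM.
apply: ge_ereal_sup => z [T [Gm [T0 nm ->]]]; rewrite lee_fin leNgt; apply/negP => lt.
by apply: nm; apply: lm => //; rewrite card_ord; [exact: ltnW|exact: ltW].
Qed.

Lemma max_extremal_cvg (r : R) : rho R F = r%:E -> 0 <= r ->
  ((max_extremal R F n @[n --> \oo]) --> rho R F)%classic.
Proof.
move=> rE r0.
have low eps : 0 < eps -> exists n0, forall n, (n0 <= n)%N -> ((r - eps)%:E <= max_extremal R F n)%E.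
  move=> eps0; have e2 : 0 < eps / 2 by rewrite divr_gt0.
  have : ((r - eps / 2)%:E < rho R F)%E by rewrite rE lte_fin ltrBlDr ltrDl.
  move=> /ereal_sup_gt[z [U [H [U0 nH ->]]]].
  rewrite inver gt_eqF ?ltr0n // lte_pdivlMr ?ltr0n // => /ereal_sup_gt[y [T [G [T0 ->]]]].
  have [v [vE _ -> _]] := vol_real R G H U0; rewrite -EFinM lte_fin => lt.
  have [n0 hn] := max_extremal_lower T0 U0 nH vE e2; exists n0 => n nn.
  apply: le_trans (hn n nn); rewrite lee_fin.
  have : r - eps / 2 <= density R G / v / #|U|%:R by rewrite ler_pdivlMr ?ltr0n //; exact: ltW.
  lra.
rewrite rE; apply/fine_cvgP; split.
  have [n1 h1] := low 1 ltr01; have [n2 h2] := max_extremal_upper rE r0 ltr01.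
  exists (n1 + n2)%N => // n /= nn.
  have {h1} : ((r - 1)%:E <= max_extremal R F n)%E by apply: h1; apply: leq_trans nn; rewrite leq_addr.
  have {h2} : (max_extremal R F n <= (r + 1)%:E)%E by apply: h2; apply: leq_trans nn; rewrite leq_addl.
  by case: (max_extremal R F n).
apply/cvgrPdist_le => eps eps0.
have [n1 h1] := low eps eps0; have [n2 h2] := max_extremal_upper rE r0 eps0.
exists (n1 + n2)%N => // n /= nn.
have {h1} : ((r - eps)%:E <= max_extremal R F n)%E by apply: h1; apply: leq_trans nn; rewrite leq_addr.
have {h2} : (max_extremal R F n <= (r + eps)%:E)%E by apply: h2; apply: leq_trans nn; rewrite leq_addl.
case: (max_extremal R F n) => [x| |] //=; rewrite !lee_fin => h2 h1.
rewrite ler_norml; lra.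
Qed.

(** In a large graph of F the exceptional set misses half of the vertices, and any of these lies in
    a component of nucleus type. *)
Lemma nucleus_nonempty : (forall N, exists V (G : sgraph V), F G /\ (N <= #|V|)%N) ->
  exists (U : finType) (H : sgraph U), (0 < #|U|)%N /\ nucleus F H.
Proof.
move=> large; have [|ts [n0 [tsP types]]] := @sublinear_types R F hF (1 / 2); first by rewrite divr_gt0.
have [V [G [FG nV]]] := large (n0 + 1)%N.
have [|X [I [D [ty [cX tyP _ cov _]]]]] := types V G FG; first by apply: leq_trans nV; rewrite leq_addr.
have [v vX] : exists v, v \notin X.
  apply/existsP; rewrite -[X in is_true X]negbK negb_exists; apply/negP => /forallP h.
  have XT : X = [set: V] by apply/setP => v; have := h v; rewrite negbK inE => ->.
  have : 1 <= #|V|%:R :> R by rewrite (ler_nat _ 1); apply: leq_trans nV; rewrite leq_addl.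
  by move: cX; rewrite XT cardsT; lra.
have [i _] := (cov v).1 vX; have [tin _] := tyP i; have [t0 nt] := tsP _ tin.
by exists 'I_(tag (ty i)), (tagged (ty i)); rewrite card_ord.
Qed.

End Asymptotics.

Local Open Scope classical_set_scope.
Local Open Scope ereal_scope.

Theorem theorem8p1 (R : realType) (F : gfamily) :
  strongly_sublinear_separators R F ->
  rho R F < +oo /\ (max_extremal R F n @[n --> \oo] --> rho R F).
Proof.
move=> hF; have [ne|nuc] := pselect (exists (U : finType) (H : sgraph U), (0 < #|U|)%N /\ nucleus F H).
  have [r rE r0] := rho_real hF ne.
  by split; [rewrite rE ltry|exact: max_extremal_cvg rE r0].
(* With no non-null graph in the nucleus, the supremum is empty and the orders in F are bounded, so
   both sides are eventually -oo. *)
have rhoE : rho R F = -oo.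
  rewrite /rho (_ : [set z | _] = classical_sets.set0) ?ereal_sup0 //.
  apply/classical_sets.seteqP; split=> // z [U [H [U0 nH _]]]; by case: nuc; exists U, H.
have [N bounded] : exists N, forall V (G : sgraph V), F V G -> (#|V| < N)%N.
  apply: contrapT => h; apply/nuc/(nucleus_nonempty hF) => N; apply: contrapT => h'.
  apply: h; exists N => V G FG; rewrite ltnNge; apply/negP => nV; apply: h'; by exists V, G.
rewrite rhoE; split=> //; apply: cvg_near_cst; exists N => // n /= Nn.
rewrite /max_extremal big_pred0 // => G; apply/asboolP => FG.
by have := bounded _ _ FG; rewrite card_ord ltnNge Nn.
Qed.
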